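(* For every integer $k\ge 2$, there is a homotopy equivalence \[\mathrm{VR}(T_{3k,3k};k)\simeq \bigvee_{6k^2-1} S^2.\]
   Context: For a metric space $X$ and $r\ge 0$, $\mathrm{VR}(X;r)$ is the simplicial complex on vertex set $X$ whose simplices are the finite nonempty subsets of diameter at most $r$. $T_{n,n}$ is the set $\{0,\dots,n-1\}^2$ with metric $d((i,j),(i',j'))=\min\{|i-i'|,n-|i-i'|\}+\min\{|j-j'|,n-|j-j'|\}$, i.e. the vertex set of the $n\times n$ torus grid graph with its shortest-path metric. *)

(* Defs.v *)
From HB Require Import structures.
From mathcomp Require Import all_boot all_order all_algebra.
From mathcomp Require Import all_classical all_reals all_analysis.
Set Implicit Arguments. Unset Strict Implicit. Unset Printing Implicit Defensive.
Import Order.TTheory GRing.Theory Num.Theory.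
Import numFieldNormedType.Exports.
Local Open Scope classical_set_scope.
Local Open Scope ring_scope.

Definition cyc_dist (n a b : nat) : nat :=
  let m := ((a - b) + (b - a))%N in minn m (n - m)%N.

(* The torus grid T_{n,n} = 'I_n * 'I_n with the l^1 sum of cyclic distances
   (= shortest-path metric of the n x n torus grid graph). *)
Definition torus_dist (n : nat) (x y : 'I_n * 'I_n) : nat :=
  (cyc_dist n x.1 y.1 + cyc_dist n x.2 y.2)%N.

Definition VR_simplex (V : finType) (d : V -> V -> nat) (r : nat) (s : {set V}) : bool :=
  (s != finset.set0) && [forall x in s, forall y in s, (d x y <= r)%N].

Definition geom_realization (R : realType) (V : finType) (simplex : {set V} -> bool)
  : set 'rV[R]_#|V| :=
  [set x | (forall i, 0 <= x ord0 i) /\ (\sum_i x ord0 i = 1) /\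
           exists s : {set V}, simplex s /\
             forall v : V, v \notin s -> x ord0 (enum_rank v) = 0].

(* Wedge of m copies of S^2, realized in R^3 as m round spheres, the i-th of
   radius i+1 centered at (i+1,0,0); any two meet only at the origin
   (internally tangent), so this is the one-point union of m 2-spheres. *)
Definition wedge_S2 (R : realType) (m : nat) : set 'rV[R]_3 :=
  [set p | exists i : 'I_m,
     \sum_(j < 3) (p ord0 j - (if (j == 0 :> nat) then i.+1%:R else 0)) ^+ 2
       = (i.+1%:R) ^+ 2].

Definition homotopy_equivalent (R : realType) (X Y : topologicalType)
  (A : set X) (B : set Y) : Prop :=
  exists (f : X -> Y) (g : Y -> X),
    [/\ {within A, continuous f} /\ f @` A `<=` B,
        {within B, continuous g} /\ g @` B `<=` A,
        (exists H : R * X -> X,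
           [/\ {within `[0%R, 1%R] `*` A, continuous H},
               H @` (`[0%R, 1%R] `*` A) `<=` A &
               forall a, A a -> H (0, a) = g (f a) /\ H (1, a) = a]) &
        (exists K : R * Y -> Y,
           [/\ {within `[0%R, 1%R] `*` B, continuous K},
               K @` (`[0%R, 1%R] `*` B) `<=` B &
               forall b, B b -> K (0, b) = f (g b) /\ K (1, b) = b])].

Arguments geom_realization : clear implicits.
Arguments geom_realization R {V} simplex.
Arguments wedge_S2 : clear implicits.
Arguments homotopy_equivalent : clear implicits.
Arguments homotopy_equivalent R {X Y} A B.
Arguments torus_dist : clear implicits.
Arguments cyc_dist : clear implicits.

(* Main.v *)
(* Write N = 3k. A clique of the Rips graph either lifts to the plane, where it
   lies in a box whose sides in the directions x + y and x - y are at most k, or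
   is one of the 6k^2 maximal triangles {a, a + k, a + 2k} on a horizontal or
   vertical line. Coning off a triangle together with the three arcs into which
   it cuts its line trades the triangle for a cone over the whole line. This
   frees the long edges, and the boxes can be collapsed to sides 1 and 2, i.e.
   to the N x N torus grid with every square cut by an antidiagonal, each of
   whose rows and columns is now coned off k times.

   Keep one cone on each row and one cone on one column. Removing a triangle
   from each of the N strips between consecutive rows, and one triangle from
   each of the (3k^2 - 3k) + (3k^2 - 1) other cones, leaves a collapsible
   complex A; so the complex is A together with 6k^2 - 1 maximal triangles.
   Attaching a cone over A does not change the homotopy type, and contracting
   that cone turns the triangles into a wedge of spheres. *)
Require Import Defs.
From HB Require Import structures.
From mathcomp Require Import all_boot all_order all_algebra.
From mathcomp Require Import all_classical all_reals all_analysis.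
From mathcomp Require Import ring lra zify.
Set Implicit Arguments. Unset Strict Implicit. Unset Printing Implicit Defensive.
Import Order.TTheory GRing.Theory Num.Theory.
Import numFieldNormedType.Exports.
Local Open Scope ring_scope.

(** * Collapses of finite simplicial complexes *)

(** In the Rips complex the link of an edge [{a, a + k}] on a line contains the third corner
    [a + 2k] as an isolated point, so such an edge is not the core of a collapse; this is why the
    triangles are traded for cones before any box shrinks. Since homotopy equivalence is defined by
    explicit maps, only two moves are used, apart from changes of the vertex set: collapses,
    realized by one formula on barycentric coordinates, and one quotient of a compact set. Cones are
    attached by running a collapse backwards: complexes may contain the empty simplex, and a link
    that collapses to the complex holding of nothing takes its cone vertex along. The same device
    attaches the cone over [A]; this is better than contracting [A] itself, because the contraction
    of a cone is explicit and extends over the triangles. The number of spheres agrees with the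
    Euler characteristic: the torus has 0, each of the 6k^2 cones over a cycle adds 1, and a wedge
    of 6k^2 - 1 spheres has 6k^2. *)

Section collapses.
Variable V : finType.
Implicit Types (K : {set V} -> bool) (s t sigma : {set V}).

Definition down_closed K := forall s t, t \subset s -> K s -> K t.

Definition star_removed K sigma s := K s && ~~ (sigma \subset s).

(* Complexes are predicates that may hold of the empty set. The core [sigma] may
   be empty, in which case [K] is a cone with apex [v] and everything, including
   the empty simplex, is removed. *)
Inductive collapses : ({set V} -> bool) -> ({set V} -> bool) -> Prop :=
| collapses_refl K : collapses K K
| collapses_step K sigma v K' : v \notin sigma ->
    (forall s, K s -> sigma \subset s -> K (v |: s)) ->
    collapses (star_removed K sigma) K' -> collapses K K'.

Lemma collapses1 K sigma v : v \notin sigma ->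
  (forall s, K s -> sigma \subset s -> K (v |: s)) ->
  collapses K (star_removed K sigma).
Proof. by move=> vs Kv; apply: collapses_step vs Kv (collapses_refl _). Qed.

Lemma collapses_trans K1 K2 K3 :
  collapses K1 K2 -> collapses K2 K3 -> collapses K1 K3.
Proof.
by elim=> // K sigma v K' vs Kv _ IH /IH; exact: collapses_step Kv.
Qed.

Lemma collapses_sub K K' s : collapses K K' -> K' s -> K s.
Proof. by elim=> // {}K sigma v {}K' _ _ _ IH /IH /andP[]. Qed.

Lemma star_removed_down K sigma :
  down_closed K -> down_closed (star_removed K sigma).
Proof.
move=> dK s t ts /andP[Ks sig]; rewrite /star_removed (dK s t ts Ks).
by apply: contra sig => st; exact: fintype.subset_trans st ts.
Qed.

(* The cores are removed in the order of increasing rank [rk]. *)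
Lemma collapses_family (I : finType) (C : pred I) (core : I -> {set V})
    (apex : I -> V) (rk : I -> nat) K K' :
  (forall i, C i -> apex i \notin core i) ->
  (forall i s, C i -> K s -> core i \subset s ->
    (forall j, C j -> core j \subset s -> (rk i <= rk j)%N) ->
    K (apex i |: s) /\
    forall j, C j -> core j \subset apex i |: s ->
      core j \subset s \/ (rk i < rk j)%N) ->
  (forall s, K' s = K s && [forall (i | C i), ~~ (core i \subset s)]) ->
  collapses K K'.
Proof.
have [n] := ubnP #|C|; elim: n => // n IH in C K K' *.
rewrite ltnS => Cn apx cond eqK'.
have [i0 Ci0|C0] := pickP C; last first.
  have -> : K' = K.
    apply/funext => s; rewrite eqK'; case: (K s) => //=.
    by apply/forall_inP => i; rewrite C0.
  exact: collapses_refl.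
pose m := [arg min_(i < i0 | C i) rk i].
have [Cm mP] : C m /\ forall j, C j -> (rk m <= rk j)%N.
  by rewrite /m; case: arg_minnP.
pose D : pred I := [pred i | C i & i != m].
apply: (@collapses_step _ (core m) (apex m)); first exact: apx.
  by move=> s Ks ms; apply: (cond m s Cm Ks ms _).1 => j Cj _; exact: mP.
apply: (IH D).
- apply: leq_trans Cn; apply: proper_card; apply/properP; split.
    by apply/fintype.subsetP => i /andP[].
  by exists m => //; rewrite !inE eqxx andbF.
- by move=> i /andP[Ci _]; exact: apx.
(* Adding an apex cannot bring back the removed [core m]: a core that it completes has rank strictly
   above [rk i], while [rk m] is minimal. Ties in rank are therefore harmless. *)
- move=> i s /andP[Ci im] /andP[Ks ms] si imin.
  have imin' j : C j -> core j \subset s -> (rk i <= rk j)%N.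
    move=> Cj js; apply: (imin j _ js); rewrite /D /= Cj /=.
    by apply: contraNneq ms => <-.
  have [Kv newc] := cond i s Ci Ks si imin'; split.
    rewrite /star_removed Kv /=; apply/negP => /(newc m Cm) [|].
      by rewrite (negbTE ms).
    by rewrite ltnNge mP.
  by move=> j /andP[Cj _]; exact: newc.
- move=> s; rewrite eqK' /star_removed -andbA; congr (_ && _).
  apply/forall_inP/andP.
    move=> allC; split; first exact: allC.
    by apply/forall_inP => i /andP[Ci _]; exact: allC.
  move=> [ms /forall_inP allD] i Ci; have [->//|im] := eqVneq i m.
  by apply: allD; rewrite /D /= Ci im.
Qed.

End collapses.

(** * Complexes with cones attached, and how collapses pass to them *)

Section cones.
Variables T J : finType.
Implicit Types (P : {set T} -> bool) (Q : J -> {set T} -> bool) (s : {set T + J}).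

(* [P] together with a new vertex [inr j] whose link is [Q j], for each [j]. *)
Definition coned P Q s : bool :=
  ((inr @^-1: s == finset.set0) && P (inl @^-1: s)) ||
  [exists j, (inr @^-1: s == [set j]%SET) && Q j (inl @^-1: s)].

Lemma coned_ind P Q s (G : Prop) :
  (inr @^-1: s = finset.set0 -> P (inl @^-1: s) -> G) ->
  (forall j, inr @^-1: s = [set j]%SET -> Q j (inl @^-1: s) -> G) ->
  coned P Q s -> G.
Proof.
move=> GP GQ /orP[/andP[/eqP s0 Ps]|/existsP[j /andP[/eqP sj Qs]]].
  exact: GP.
exact: GQ sj Qs.
Qed.

Lemma coned_base P Q s : inr @^-1: s = finset.set0 ->
  coned P Q s = P (inl @^-1: s).
Proof.
move=> s0; rewrite /coned s0 eqxx /=; case: (P _) => //=.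
by apply/existsP => -[j /andP[/eqP/setP/(_ j)]]; rewrite !inE eqxx.
Qed.

Lemma coned_set0 P Q : coned P Q finset.set0 = P finset.set0.
Proof.
rewrite coned_base; last by apply/setP => x; rewrite !inE.
by congr P; apply/setP => x; rewrite !inE.
Qed.

Lemma coned_apex P Q s j : inr @^-1: s = [set j]%SET ->
  coned P Q s = Q j (inl @^-1: s).
Proof.
move=> sj; rewrite /coned sj.
have /negbTE -> /= : [set j]%SET != finset.set0 :> {set J}.
  by apply/eqP => /setP/(_ j); rewrite !inE eqxx.
apply/existsP/idP => [[i /andP[/eqP/setP/(_ i)]]|Qj].
  by rewrite !inE eqxx => /eqP ->.
by exists j; rewrite eqxx.
Qed.

Lemma preim_inl_setU1l v s : inl @^-1: (inl v |: s) = v |: inl @^-1: s.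
Proof. by apply/setP => x; rewrite !inE. Qed.

Lemma preim_inr_setU1l v s : inr @^-1: (inl v |: s) = inr @^-1: s.
Proof. by apply/setP => x; rewrite !inE. Qed.

Lemma preim_inl_setU1r j s : inl @^-1: (inr j |: s) = inl @^-1: s.
Proof. by apply/setP => x; rewrite !inE. Qed.

Lemma preim_inr_setU1r j s : inr @^-1: (inr j |: s) = j |: inr @^-1: s.
Proof. by apply/setP => x; rewrite !inE. Qed.

Lemma imset_inl_sub (t : {set T}) s :
  (inl @: t \subset s) = (t \subset inl @^-1: s).
Proof. by rewrite sub_imset_pre. Qed.

Lemma coned_down P Q : down_closed P -> (forall j, down_closed (Q j)) ->
  (forall j t, Q j t -> P t) -> down_closed (coned P Q).
Proof.
move=> dP dQ QP s t ts; have sl : inl @^-1: t \subset inl @^-1: s by exact: preimsetS.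
have sr : inr @^-1: t \subset inr @^-1: s by exact: preimsetS.
apply: coned_ind => [s0 Ps|j sj Qs].
  rewrite s0 finset.subset0 in sr; rewrite coned_base; last exact/eqP.
  exact: dP Ps.
move: sr; rewrite sj finset.subset1 => /orP[/eqP tj|/eqP t0].
  by rewrite (coned_apex _ _ tj); exact: dQ Qs.
by rewrite coned_base //; apply: QP; exact: dQ Qs.
Qed.

(** All links lie in the smallest complex [P'], so no removed core is contained in a link, and the
    simplices through cone vertices are never touched. *)
Lemma collapses_coned_base P P' Q : collapses P P' ->
  (forall j t, Q j t -> P' t) -> collapses (coned P Q) (coned P' Q).
Proof.
elim=> [{}P|{}P sigma v {}P' vs Pv PP' IH] QP'; first exact: collapses_refl.
have Qsigma j t : Q j t -> ~~ (sigma \subset t).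
  by move=> /QP' /(collapses_sub PP') /andP[].
apply: (@collapses_step _ _ (inl @: sigma) (inl v)).
- by apply/imsetP => -[w wsig [vw]]; rewrite vw wsig in vs.
- move=> s Ks; rewrite imset_inl_sub => sigs; move: Ks.
  apply: coned_ind => [s0 Ps|j sj /Qsigma]; last by rewrite sigs.
  by rewrite coned_base ?preim_inr_setU1l // preim_inl_setU1l; exact: Pv.
- have -> : star_removed (coned P Q) (inl @: sigma) =
      coned (star_removed P sigma) Q; last exact: IH.
  apply/funext => s; rewrite /star_removed imset_inl_sub /coned.
  rewrite andb_orl -andbA; congr (_ || _).
  apply/andP/existsP => [[/existsP[j /andP[sj Qj]] _]|[j /andP[sj Qj]]].
    by exists j; rewrite sj.
  by rewrite (Qsigma _ _ Qj); split=> //; apply/existsP; exists j; rewrite sj.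
Qed.

(** Each core of the collapse of the link is joined to the cone vertex. An empty core becomes the
    cone vertex alone, so a link that collapses to [fun=> false] makes its cone vertex disappear. *)
Lemma collapses_coned_link1 P Q j q' : collapses (Q j) q' ->
  collapses (coned P Q) (coned P (fun i => if i == j then q' else Q i)).
Proof.
move Eq : (Q j) => q Qq'; elim: Qq' Q Eq => {q q'} [q|q sigma v q' vs qv _ IH] Q Eq.
  suff -> : (fun i => if i == j then q else Q i) = Q by exact: collapses_refl.
  by apply/funext => i; case: eqVneq => // ->.
pose Q1 i := if i == j then star_removed q sigma else Q i.
have Q1j : Q1 j = star_removed q sigma by rewrite /Q1 eqxx.
have {}IH := IH _ Q1j.
have -> : (fun i => if i == j then q' else Q i) =
    (fun i => if i == j then q' else Q1 i).
  by apply/funext => i; rewrite /Q1; case: eqVneq.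
have coreP s : (inr j |: inl @: sigma \subset s) =
    (j \in inr @^-1: s) && (sigma \subset inl @^-1: s).
  by rewrite finset.subUset imset_inl_sub finset.sub1set inE.
apply: (@collapses_step _ _ (inr j |: inl @: sigma) (inl v)).
- rewrite !inE /=; apply/imsetP => -[w wsig [vw]]; by rewrite vw wsig in vs.
- move=> s Ks; rewrite coreP => /andP[js sigs]; move: Ks.
  apply: coned_ind => [s0|i si]; first by rewrite s0 inE in js.
  move: js; rewrite si inE => /eqP jE; rewrite -jE Eq => Qs.
  rewrite (@coned_apex _ _ _ j) ?preim_inr_setU1l ?jE // -jE Eq.
  by rewrite preim_inl_setU1l; exact: qv.
- suff -> : star_removed (coned P Q) (inr j |: inl @: sigma) = coned P Q1 by [].
  apply/funext => s; rewrite /star_removed coreP /coned.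
  have [s0|[i si]|nos] : [\/ inr @^-1: s = finset.set0,
      exists i, inr @^-1: s = [set i]%SET |
      (inr @^-1: s == finset.set0) = false /\
      forall i, (inr @^-1: s == [set i]%SET) = false].
  + have [->|n0] := eqVneq (inr @^-1: s) (finset.set0 : {set J}); first by constructor 1.
    have [/existsP[i /eqP ->]|] :=
      boolP [exists i, inr @^-1: s == [set i]%SET :> {set J}].
      by constructor 2; exists i.
    rewrite negb_exists => /forallP ni; constructor 3; split=> // i.
    exact/negbTE/ni.
  + have := coned_base P Q s0; have := coned_base P Q1 s0.
    by rewrite /coned => -> ->; rewrite s0 inE andbT.
  + have := coned_apex P Q si; have := coned_apex P Q1 si.
    rewrite /coned => -> ->; rewrite si inE /Q1 eq_sym.
    by case: eqVneq => [->|]; rewrite ?Eq ?andbT.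
  + case: nos => -> ni /=; transitivity false.
      by apply/negbTE/nandP; left; apply/existsP => -[i]; rewrite ni.
    by apply/esym/negbTE/existsP => -[i]; rewrite ni.
Qed.

Lemma collapses_coned_link P Q Q' : (forall j, collapses (Q j) (Q' j)) ->
  collapses (coned P Q) (coned P Q').
Proof.
move=> QQ'.
suff H (r : seq J) :
    collapses (coned P Q) (coned P (fun i => if i \in r then Q' i else Q i)).
  have -> : Q' = fun i => if i \in enum J then Q' i else Q i; last exact: H.
  by apply/funext => i; rewrite mem_enum.
elim: r => [|j r IH]; first exact: collapses_refl.
have [jr|jr] := boolP (j \in r).
  suff -> : (fun i => if i \in j :: r then Q' i else Q i) =
    (fun i => if i \in r then Q' i else Q i) by [].
  by apply/funext => i; rewrite inE; case: eqVneq => // ->; rewrite jr.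
apply: (collapses_trans IH).
have -> : (fun i => if i \in j :: r then Q' i else Q i) =
    (fun i => if i == j then Q' j else if i \in r then Q' i else Q i).
  by apply/funext => i; rewrite inE; case: eqVneq => // ->.
by apply: collapses_coned_link1; rewrite (negbTE jr).
Qed.

End cones.

(** * The combinatorics of the torus grid *)

(* The representative of [b - a] modulo [N] in the interval (-N/2, N/2]. *)
Definition sdiff (N a b : nat) : int :=
  if (N + 2 * a < 2 * b)%N then b%:Z - a%:Z - N%:Z
  else if (2 * b + N <= 2 * a)%N then b%:Z - a%:Z + N%:Z else b%:Z - a%:Z.

Section sdiff.
Variable N : nat.
Implicit Types a b c : nat.

Lemma sdiffE a b : (a < N)%N -> (b < N)%N ->
  [/\ - N%:Z < 2 * sdiff N a b, 2 * sdiff N a b <= N%:Z &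
  [\/ sdiff N a b = b%:Z - a%:Z, sdiff N a b = b%:Z - a%:Z - N%:Z |
      sdiff N a b = b%:Z - a%:Z + N%:Z]].
Proof.
move=> aN bN; rewrite /sdiff.
case: ifP => h1; first by split; [lia|lia|constructor 2].
by case: ifP => h2; split; [lia|lia|constructor 3|lia|lia|constructor 1].
Qed.

(** Both sides agree modulo [N], and they differ by less than 3N/2. *)
Lemma sdiff_triangle a b c : (a < N)%N -> (b < N)%N -> (c < N)%N ->
  [\/ sdiff N a b + sdiff N b c = sdiff N a c,
      sdiff N a b + sdiff N b c = sdiff N a c + N%:Z |
      sdiff N a b + sdiff N b c = sdiff N a c - N%:Z].
Proof.
move=> aN bN cN.
have [? ? H1] := sdiffE aN bN; have [? ? H2] := sdiffE bN cN.
have [? ? H3] := sdiffE aN cN.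
have [h|h] : sdiff N a b + sdiff N b c = sdiff N a c \/
  sdiff N a b + sdiff N b c != sdiff N a c by case: eqVneq; [left|right].
  by constructor 1.
case: H1 => H1; case: H2 => H2; case: H3 => H3; try (by constructor 2; lia);
  try (by constructor 3; lia); lia.
Qed.

Lemma sdiff_eq0 a b : (a < N)%N -> (b < N)%N -> sdiff N a b = 0 -> a = b.
Proof. by move=> aN bN; have [? ? []] := sdiffE aN bN; lia. Qed.

Lemma sdiff_inj a b c : (a < N)%N -> (b < N)%N -> (c < N)%N ->
  sdiff N a b = sdiff N a c -> b = c.
Proof.
by move=> aN bN cN; have [? ? []] := sdiffE aN bN; have [? ? []] := sdiffE aN cN; lia.
Qed.

Lemma sdiffxx a : (a < N)%N -> sdiff N a a = 0.
Proof. by move=> aN; have [? ? []] := sdiffE aN aN; lia. Qed.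

Lemma sdiffN a b : (a < N)%N -> (b < N)%N -> 2 * sdiff N a b < N%:Z ->
  sdiff N b a = - sdiff N a b.
Proof.
by move=> aN bN; have [? ? []] := sdiffE aN bN; have [? ? []] := sdiffE bN aN; lia.
Qed.

Lemma cyc_distE a b : (a < N)%N -> (b < N)%N ->
  cyc_dist N a b = `|sdiff N a b|%N.
Proof.
move=> aN bN; rewrite /cyc_dist /sdiff; case: ifP => h1; first lia.
by case: ifP => h2; lia.
Qed.

End sdiff.

Section cshift.
Variable N : nat.

(** The default [a] is not reached when [e] lies in (-N/2, N/2]. *)
Definition cshift (a : 'I_N) (e : int) : 'I_N :=
  odflt a [pick b : 'I_N | sdiff N a b == e].

Lemma cshiftE (a : 'I_N) (e : int) : - N%:Z < 2 * e -> 2 * e <= N%:Z ->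
  sdiff N a (cshift a e) = e.
Proof.
move=> e1 e2; rewrite /cshift; case: pickP => [b /eqP //|none].
have aN := ltn_ord a.
have ex (b : nat) : (b < N)%N -> sdiff N a b <> e.
  by move=> bN eb; have := none (Ordinal bN); rewrite /= eb eqxx.
pose z := a%:Z + e.
have [z0|z0] := ltrP z 0.
  have bN : (`|(z + N%:Z)%R| < N)%N by lia.
  case: (ex _ bN); rewrite /sdiff; case: ifP => h1; first by lia.
  by case: ifP => h2; lia.
have [zN|zN] := ltrP z N%:Z.
  have bN : (`|z| < N)%N by lia.
  case: (ex _ bN); rewrite /sdiff; case: ifP => h1; first by lia.
  by case: ifP => h2; lia.
have bN : (`|(z - N%:Z)%R| < N)%N by lia.
case: (ex _ bN); rewrite /sdiff; case: ifP => h1; first by lia.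
by case: ifP => h2; lia.
Qed.

End cshift.

(** * Cliques that lift to the plane, and the shrinking of their boxes *)

Section local_complexes.
Variable N : nat.
Let T : finType := ('I_N * 'I_N)%type.
Implicit Types (p q r : T) (s : {set T}).

Definition dx p q := sdiff N p.1 q.1.
Definition dy p q := sdiff N p.2 q.2.

Definition local_pair (a b : nat) p q :=
  [&& - a%:Z <= dx p q + dy p q, dx p q + dy p q <= a%:Z,
      - b%:Z <= dx p q - dy p q & dx p q - dy p q <= b%:Z].

(* Sets of width at most [a] in the direction x + y and at most [b] in the
   direction x - y; additivity of the differences says that they lift to the
   plane. *)
Definition local_cx (a b : nat) s :=
  [forall p in s, forall q in s, local_pair a b p q &&
    [forall r in s, (dx p q + dx q r == dx p r) && (dy p q + dy q r == dy p r)]].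

Lemma local_cxP a b s : reflect
  (exists X Y : T -> int, forall p q, p \in s -> q \in s ->
    [/\ dx p q = X q - X p, dy p q = Y q - Y p & local_pair a b p q])
  (local_cx a b s).
Proof.
apply: (iffP idP) => [|[X [Y XY]]]; last first.
  apply/forall_inP => p ps; apply/forall_inP => q qs.
  have [pqx pqy ->] := XY p q ps qs.
  apply/forall_inP => r rs.
  have [prx pry _] := XY p r ps rs; have [qrx qry _] := XY q r qs rs.
  by apply/andP; split; lia.
have [->|/set0Pn[l ls]] := eqVneq s finset.set0.
  by exists (fun=> 0), (fun=> 0) => p q; rewrite inE.
move=> /forall_inP H; exists (dx l), (dy l) => p q ps qs.
have /forall_inP /(_ p ps) /andP[_ /forall_inP /(_ q qs) /andP[/eqP e1 /eqP e2]] :=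
  H l ls.
have /forall_inP /(_ q qs) /andP[-> _] := H p ps.
by split=> //; lia.
Qed.

Lemma local_cx_down a b : down_closed (local_cx a b).
Proof.
move=> s t /fintype.subsetP ts /local_cxP[X [Y XY]]; apply/local_cxP.
by exists X, Y => p q /ts ps /ts qs; exact: XY.
Qed.

Lemma local_cx_coord a b s l : local_cx a b s -> l \in s ->
  exists X Y : T -> int, [/\ X l = 0, Y l = 0 & forall p q, p \in s -> q \in s ->
    [/\ dx p q = X q - X p, dy p q = Y q - Y p & local_pair a b p q]].
Proof.
move=> /local_cxP[X [Y XY]] ls.
exists (fun p => X p - X l), (fun p => Y p - Y l).
split; [exact: subrr|exact: subrr|move=> p q ps qs].
by have [-> -> ->] := XY p q ps qs; split=> //; lia.
Qed.

Lemma point_eq p q q' : dx p q = dx p q' -> dy p q = dy p q' -> q = q'.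
Proof.
case: q q' => [q1 q2] [q1' q2'] /= e1 e2; congr (_, _); apply: val_inj.
  exact: sdiff_inj e1.
exact: sdiff_inj e2.
Qed.

Definition cshift2 p (e f : int) : T := (cshift p.1 e, cshift p.2 f).

Lemma dx_cshift2 p e f : - N%:Z < 2 * e -> 2 * e <= N%:Z -> dx p (cshift2 p e f) = e.
Proof. by move=> *; rewrite /dx cshiftE. Qed.

Lemma dy_cshift2 p e f : - N%:Z < 2 * f -> 2 * f <= N%:Z -> dy p (cshift2 p e f) = f.
Proof. by move=> *; rewrite /dy cshiftE. Qed.

Variable k : nat.
Hypotheses (k_gt1 : (1 < k)%N) (NE : N = (3 * k)%N).

(** In the lift, [v] is placed at its difference from [l]. The bounds keep all coordinate
    differences at most [k], which is less than N/2, so they are the representatives chosen by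
    [sdiff] and nothing wraps round the torus. *)
Lemma local_cx_add a b s l v (X Y : T -> int) : (a <= k)%N -> (b <= k)%N ->
  l \in s -> X l = 0 -> Y l = 0 ->
  (forall p q, p \in s -> q \in s ->
    [/\ dx p q = X q - X p, dy p q = Y q - Y p & local_pair a b p q]) ->
  (forall p, p \in s ->
    [&& - a%:Z <= X p + Y p - (dx l v + dy l v),
        X p + Y p - (dx l v + dy l v) <= a%:Z,
        - b%:Z <= X p - Y p - (dx l v - dy l v) &
        X p - Y p - (dx l v - dy l v) <= b%:Z]) ->
  exists X' Y' : T -> int, [/\ {in s, X' =1 X}, {in s, Y' =1 Y},
   X' v = dx l v, Y' v = dy l v &
   forall p q, p \in v |: s -> q \in v |: s ->
    [/\ dx p q = X' q - X' p, dy p q = Y' q - Y' p & local_pair a b p q]].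
Proof.
move=> ak bk ls Xl Yl XY bnd.
have [vs|vs] := boolP (v \in s).
  have [lvx lvy _] := XY l v ls vs.
  exists X, Y; rewrite (finset.setUidPr _); last by rewrite finset.sub1set.
  by rewrite Xl subr0 in lvx; rewrite Yl subr0 in lvy.
pose X' p := if p == v then dx l v else X p.
pose Y' p := if p == v then dy l v else Y p.
have sv p : p \in s -> (p == v) = false.
  by move=> ps; apply: contraNF vs => /eqP <-.
exists X', Y'; rewrite /X' /Y' eqxx; split=> //.
  by move=> p ps /=; rewrite (sv p ps).
  by move=> p ps /=; rewrite (sv p ps).
have sp p : p \in s -> [/\ dx p v = dx l v - X p, dy p v = dy l v - Y p,
    dx v p = X p - dx l v & dy v p = Y p - dy l v].
  move=> ps; have [lpx lpy _] := XY l p ls ps; have [plx ply _] := XY p l ps ls.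
  have /and4P[b1 b2 b3 b4] := bnd p ps; have /and4P[c1 c2 c3 c4] := bnd l ls.
  have [[l1 l2] [p1 p2] [v1 v2]] : [/\ (l.1 < N /\ l.2 < N)%N,
    (p.1 < N /\ p.2 < N)%N & (v.1 < N /\ v.2 < N)%N] by split; split.
  rewrite /dx /dy in lpx lpy plx ply b1 b2 b3 b4 c1 c2 c3 c4 *.
  have t1 := sdiff_triangle p1 l1 v1; have [u1 u1' _] := sdiffE p1 v1.
  have t2 := sdiff_triangle p2 l2 v2; have [u2 u2' _] := sdiffE p2 v2.
  have e1 : sdiff N p.1 v.1 = sdiff N l.1 v.1 - X p by case: t1; lia.
  have e2 : sdiff N p.2 v.2 = sdiff N l.2 v.2 - Y p by case: t2; lia.
  by split=> //; rewrite sdiffN //; lia.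
move=> p q; rewrite !inE => /predU1P[->|ps] /predU1P[->|qs].
- rewrite !eqxx /local_pair /dx /dy !sdiffxx //.
  by split; rewrite ?subrr //; lia.
- rewrite eqxx (sv q qs); have [_ _ e1 e2] := sp q qs.
  by rewrite /local_pair e1 e2; have := bnd q qs; split=> //; lia.
- rewrite eqxx (sv p ps); have [e1 e2 _ _] := sp p ps.
  by rewrite /local_pair e1 e2; have := bnd p ps; split=> //; lia.
- by rewrite (sv p ps) (sv q qs); exact: XY.
Qed.

(* Cores: edges spanning the full width [a] that are not parallel to the
   direction x = y, then such parallel edges together with a lowest possible
   third vertex, then the remaining parallel edges. *)
Lemma collapses_local_width a b : (1 < a)%N -> (a <= k)%N -> (1 < b)%N ->
  (b <= k)%N -> collapses (local_cx a b) (local_cx a.-1 b).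
Proof.
move=> a1 ak b1 bk.
pose u p q := dx p q + dy p q; pose w p q := dx p q - dy p q.
pose C (i : T * T * option T) := let: (l, r, o) := i in (u l r == a%:Z) &&
  (if o is Some z then (w l r == 0) && (w l z == - b%:Z) else true).
pose core (i : T * T * option T) : {set T} := let: (l, r, o) := i in
  if o is Some z then [set l; r; z]%SET else [set l; r]%SET.
(* The apex lies one above [l] in x + y. In x - y it moves towards [r], where the points of the
   simplex leave room. If the edge is parallel to x = y it moves up, unless a third vertex at height
   [- b] forces it down. *)
pose apex (i : T * T * option T) := let: (l, r, o) := i in
  if (o == None) && (0 <= w l r) then cshift2 l 1 0 else cshift2 l 0 1.
pose rk (i : T * T * option T) := let: (l, r, o) := i in
  if o is Some z then 1%N else if w l r == 0 then 2%N else 0%N.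
have s10 l : u l (cshift2 l 1 0) = 1 /\ w l (cshift2 l 1 0) = 1.
  by rewrite /u /w dx_cshift2 ?dy_cshift2; lia.
have s01 l : u l (cshift2 l 0 1) = 1 /\ w l (cshift2 l 0 1) = -1.
  by rewrite /u /w dx_cshift2 ?dy_cshift2; lia.
have uxx l : u l l = 0 by rewrite /u /dx /dy !sdiffxx.
have wxx l : w l l = 0 by rewrite /w /dx /dy !sdiffxx.
apply: (@collapses_family _ _ C core apex rk).
- move=> [[l r] o] /= /andP[/eqP lr Co].
  have uv : u l (apex (l, r, o)) = 1.
    by rewrite /apex; case: ifP => _; [have [] := s10 l|have [] := s01 l].
  have nl : apex (l, r, o) != l by apply/eqP => e; rewrite e uxx in uv.
  have nr : apex (l, r, o) != r by apply/eqP => e; rewrite e lr in uv; lia.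
  case: o Co uv nl nr => [z /andP[_ /eqP wz]|_] uv nl nr; rewrite !inE !negb_or;
    rewrite ?nl ?nr //=.
  apply/eqP => e; have [_ wv] := s01 l.
  by rewrite /apex /= in e; rewrite -e wv in wz; lia.
- move=> [[l r] o] s /= /andP[/eqP lr Co] Ls cs rkmin.
  have ls : l \in s by apply: (fintype.subsetP cs); case: (o) => [?|]; rewrite !inE eqxx.
  have rs : r \in s.
    by apply: (fintype.subsetP cs); case: (o) => [?|]; rewrite !inE eqxx ?orbT.
  have [X [Y [Xl Yl XY]]] := local_cx_coord Ls ls.
  have uE p q : p \in s -> q \in s -> u p q = X q + Y q - X p - Y p.
    by move=> ps qs; have [e1 e2 _] := XY p q ps qs; rewrite /u e1 e2; lia.
  have wE p q : p \in s -> q \in s -> w p q = X q - Y q - X p + Y p.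
    by move=> ps qs; have [e1 e2 _] := XY p q ps qs; rewrite /w e1 e2; lia.
  have bE p q : p \in s -> q \in s -> [/\ - a%:Z <= u p q, u p q <= a%:Z,
      - b%:Z <= w p q & w p q <= b%:Z].
    by move=> ps qs; have [_ _ /and4P[]] := XY p q ps qs.
  have lrE := uE l r ls rs; rewrite lr in lrE.
  have wlrE := wE l r ls rs.
  set v := (if _ then _ else _).
  have [uv wv] : u l v = 1 /\ (w l v = 1 \/ w l v = -1).
    rewrite /v; case: ifP => _; [have [e1 e2] := s10 l|have [e1 e2] := s01 l].
      by split=> //; left.
    by split=> //; right.
  (* In the later rounds every full-width edge of [s] is parallel to x = y, since the other ones are
     cores of rank 0. *)
  have no0 : (0 < rk (l, r, o))%N -> forall l' r', l' \in s -> r' \in s ->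
      u l' r' = a%:Z -> w l' r' = 0.
    move=> rk0 l' r' ls' rs' ua; apply/eqP/negPn/negP => wn.
    have := rkmin (l', r', None); rewrite /= ua eqxx /= (negbTE wn) => /(_ isT).
    rewrite leqNgt rk0 /= => H; suff : false by [].
    by apply: H; rewrite finset.subUset !finset.sub1set ls' rs'.
  have bnd p : p \in s -> [&& - a%:Z <= X p + Y p - (dx l v + dy l v),
        X p + Y p - (dx l v + dy l v) <= a%:Z,
        - b%:Z <= X p - Y p - (dx l v - dy l v) &
        X p - Y p - (dx l v - dy l v) <= b%:Z].
    move=> ps; rewrite -/(u l v) -/(w l v) uv.
    have [q1 q2 q3 q4] := bE l p ls ps; have [q5 q6 q7 q8] := bE r p rs ps.
    rewrite (uE l p) // (wE l p) // in q1 q2 q3 q4.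
    rewrite (uE r p) // (wE r p) // in q5 q6 q7 q8.
    suff : - b%:Z <= X p - Y p - w l v /\ X p - Y p - w l v <= b%:Z by lia.
    rewrite /v; case: o Co cs rkmin {v uv wv} no0 => [z /andP[/eqP wlr /eqP wlz]|_] cs rkmin no0 /=.
      have zs : z \in s by apply: (fintype.subsetP cs); rewrite !inE eqxx !orbT.
      have [_ _ q9 q10] := bE z p zs ps.
      rewrite (wE z p) // in q9 q10; rewrite (wE l z) // in wlz.
      by have [_ ->] := s01 l; lia.
    have [w0|w0] := lerP 0 (w l r).
      have [_ ->] := s10 l; have [wlr|wlr] := eqVneq (w l r) 0; last by lia.
      (* A point at height [- b] would complete a core of rank 1, and those are gone by now. *)
      suff : X p - Y p <> - b%:Z by lia.
      move=> pb; have := rkmin (l, r, Some p); rewrite /= lr wlr eqxx /=.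
      have -> : w l p == - b%:Z by rewrite (wE l p) //; lia.
      move=> /(_ isT) H; suff : false by [].
      by apply: H; rewrite !finset.subUset !finset.sub1set ls rs ps.
    by have [_ ->] := s01 l; lia.
  have [X' [Y' [XX YY Xv Yv XY']]] := local_cx_add ak bk ls Xl Yl XY bnd.
  split; first by apply/local_cxP; exists X', Y'.
  have uE' p q : p \in v |: s -> q \in v |: s -> u p q = X' q + Y' q - X' p - Y' p.
    by move=> ps qs; have [e1 e2 _] := XY' p q ps qs; rewrite /u e1 e2; lia.
  have wE' p q : p \in v |: s -> q \in v |: s -> w p q = X' q - Y' q - X' p + Y' p.
    by move=> ps qs; have [e1 e2 _] := XY' p q ps qs; rewrite /w e1 e2; lia.
  have vs : v \in v |: s by rewrite !inE eqxx.
  have sub p : p \in s -> p \in v |: s by rewrite !inE orbC => ->.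
  have uX p : p \in s -> 0 <= X' p + Y' p /\ X' p + Y' p <= a%:Z.
    move=> ps; rewrite XX // YY //.
    have [q1 q2 q3 q4] := bE l p ls ps; have [q5 q6 q7 q8] := bE r p rs ps.
    rewrite (uE l p) // in q1 q2; rewrite (uE r p) // in q5 q6; lia.
  have uXv : X' v + Y' v = 1 by rewrite Xv Yv.
  (* The points of [s] have x + y between 0 and [a], and the apex lies at 1, strictly in between; so
     it is no end of a full-width edge. *)
  have edge l' r' : l' \in v |: s -> r' \in v |: s -> u l' r' = a%:Z ->
      l' \in s /\ r' \in s.
    move=> l's r's; rewrite uE' // => ua; move: l's r's ua.
    rewrite !inE => /predU1P[->|l's] /predU1P[->|r's] //; first by lia.
      by move: (uX r' r's) uXv; clear; lia.
    by move: (a1) (uX l' l's) uXv; clear; lia.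
  move=> [[l' r'] [z|]] /= /andP[/eqP ua]; last first.
    rewrite !finset.subUset !finset.sub1set => _ /andP[l's r's].
    by left; have [-> ->] := edge l' r' l's r's ua.
  move=> /andP[/eqP wa /eqP wz].
  rewrite !finset.subUset !finset.sub1set => /andP[/andP[l's r's] zs].
  have [l's' r's'] := edge l' r' l's r's ua.
  move: (zs); rewrite finset.in_setU1 => /predU1P[zv|zs']; last first.
    by left; rewrite l's' r's' zs'.
  (* The apex can only be the third vertex of a new core. Such a core has rank 1, which is allowed
     after rank 0; in the later rounds the apex differs from [l'] by 1 or -1 in x - y, which is not
     [- b]. *)
  have [/eqP rk0|rk0] := boolP (rk (l, r, o) == 0%N).
    by right; rewrite /rk in rk0; rewrite rk0.
  rewrite -lt0n in rk0.
  have wlr : w l r = 0 by apply: no0.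
  have ul' : u l l' = 0.
    have := uX l' l's'; have := uX r' r's'; have := uE' l' r' l's r's.
    rewrite ua XX // YY // XX // YY // (uE l l') // Xl Yl.
    by move: (X l') (Y l') (X r') (Y r'); clear; lia.
  have wl' : w l l' = 0.
    move: (no0 rk0 l' r l's' rs); rewrite (uE l' r) // (wE l' r) // (wE l l') //.
    rewrite (uE l l') // Xl Yl in ul'; rewrite wlr Xl Yl in wlrE.
    move: lrE wlrE ul'; rewrite Xl Yl.
    by move: (X l') (Y l') (X r) (Y r); clear; lia.
  rewrite zv wE' // in wz; rewrite (wE l l') // in wl'.
  rewrite (XX l') // (YY l') // in wz.
  move: wv wz wl'; rewrite /w -Xv -Yv Xl Yl.
  by move: (X' v) (Y' v) (X l') (Y l') (b1); clear; lia.
- move=> s; apply/idP/andP.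
    move=> /local_cxP[X [Y XY]]; split.
      apply/local_cxP; exists X, Y => p q ps qs; have [-> ->] := XY p q ps qs.
      by rewrite /local_pair => ?; split=> //; lia.
    apply/forall_inP => -[[l r] o] /= /andP[/eqP lr _]; apply/negP => cs.
    have ls : l \in s by apply: (fintype.subsetP cs); case: (o) => [?|]; rewrite !inE eqxx.
    have rs : r \in s.
      by apply: (fintype.subsetP cs); case: (o) => [?|]; rewrite !inE eqxx ?orbT.
    by have [_ _ /and4P[]] := XY l r ls rs; move: lr; rewrite /u; lia.
  move=> [/local_cxP[X [Y XY]] /forall_inP noC]; apply/local_cxP; exists X, Y.
  move=> p q ps qs; have [e1 e2 bpq] := XY p q ps qs; split=> //.
  have [e1' e2' _] := XY q p qs ps.
  have npq : u p q <> a%:Z.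
    move=> h; have := noC (p, q, None); rewrite /= h eqxx => /(_ isT).
    by rewrite finset.subUset !finset.sub1set ps qs.
  have nqp : u q p <> a%:Z.
    move=> h; have := noC (q, p, None); rewrite /= h eqxx => /(_ isT).
    by rewrite finset.subUset !finset.sub1set ps qs.
  by move: bpq npq nqp; rewrite /local_pair /u; lia.
Qed.

(** The apex [l + (1, -1)] has the same x + y as [l] and lies two above it in x - y. For [b] above 2
    this is strictly between [l] and [r], so no new edge has full length; at [b = 2] the apex would
    be [r] itself, and the shrinking stops. *)
Lemma collapses_local_height b : (2 < b)%N -> (b <= k)%N ->
  collapses (local_cx 1 b) (local_cx 1 b.-1).
Proof.
move=> b1 bk.
pose w p q := dx p q - dy p q.
pose C (i : T * T) := w i.1 i.2 == b%:Z.
pose core (i : T * T) : {set T} := [set i.1; i.2]%SET.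
pose apex (i : T * T) := cshift2 i.1 1 (-1).
have sx l : dx l (cshift2 l 1 (-1)) = 1 by rewrite dx_cshift2; lia.
have sy l : dy l (cshift2 l 1 (-1)) = -1 by rewrite dy_cshift2; lia.
apply: (@collapses_family _ _ C core apex (fun=> 0%N)).
- move=> [l r] /= /eqP lr; rewrite !inE negb_or; apply/andP; split.
    apply/eqP => e; have := sx l.
    by rewrite /apex /= in e; rewrite e /dx sdiffxx.
  apply/eqP => e; rewrite /apex /= in e.
  by have := sx l; have := sy l; rewrite e; rewrite /w /= in lr; lia.
- move=> [l r] s /= /eqP lr Ls cs _.
  have ls : l \in s by apply: (fintype.subsetP cs); rewrite !inE eqxx.
  have rs : r \in s by apply: (fintype.subsetP cs); rewrite !inE eqxx orbT.
  rewrite /= /w in lr.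
  have [X [Y [Xl Yl XY]]] := local_cx_coord Ls ls.
  rewrite /apex /=; set v := cshift2 _ _ _.
  have [lrx lry _] := XY l r ls rs.
  have bp p : p \in s -> [/\ - 1 <= X p + Y p, X p + Y p <= 1, 0 <= X p - Y p &
      X p - Y p <= b%:Z].
    move=> ps; have [e1 e2 /and4P[q1 q2 q3 q4]] := XY l p ls ps.
    by have [e5 e6 /and4P[q5 q6 q7 q8]] := XY r p rs ps; split; lia.
  have bnd p : p \in s -> [&& - 1%:Z <= X p + Y p - (dx l v + dy l v),
        X p + Y p - (dx l v + dy l v) <= 1%:Z,
        - b%:Z <= X p - Y p - (dx l v - dy l v) &
        X p - Y p - (dx l v - dy l v) <= b%:Z].
    by move=> /bp[q1 q2 q3 q4]; rewrite /v sx sy; lia.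
  have [X' [Y' [XX YY Xv Yv XY']]] :=
    local_cx_add (ltnW k_gt1) bk ls Xl Yl XY bnd.
  split; first by apply/local_cxP; exists X', Y'.
  move=> [l' r'] /eqP /= wl'; rewrite /= /w in wl'.
  rewrite !finset.subUset !finset.sub1set /= => /andP[l's r's]; left.
  have [e1 e2 _] := XY' l' r' l's r's; rewrite sx in Xv; rewrite sy in Yv.
  clearbody v.
  move: l's r's; rewrite !finset.in_setU1.
  move=> /predU1P[l'v|l's] /predU1P[r'v|r's]; rewrite ?l'v ?r'v in wl' e1 e2 *.
  + lia.
  + have [_ _ b3 b4] := bp r' r's; rewrite (XX r') // in e1; rewrite (YY r') // in e2.
    by lia.
  + have [_ _ b3 b4] := bp l' l's; rewrite (XX l') // in e1; rewrite (YY l') // in e2.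
    by lia.
  + by rewrite l's r's.
- move=> s; apply/idP/andP.
    move=> /local_cxP[X [Y XY]]; split.
      apply/local_cxP; exists X, Y => p q ps qs; have [-> ->] := XY p q ps qs.
      by rewrite /local_pair => ?; split=> //; lia.
    apply/forall_inP => -[l r] /= /eqP lr; apply/negP.
    rewrite !finset.subUset !finset.sub1set => /andP[ls rs].
    by have [_ _ /and4P[]] := XY l r ls rs; rewrite /= /w in lr; lia.
  move=> [/local_cxP[X [Y XY]] /forall_inP noC]; apply/local_cxP; exists X, Y.
  move=> p q ps qs; have [e1 e2 bpq] := XY p q ps qs; split=> //.
  have [e1' e2' _] := XY q p qs ps.
  have npq : w p q <> b%:Z.
    move=> h; have := noC (p, q); rewrite /C /= h eqxx => /(_ isT).
    by rewrite finset.subUset !finset.sub1set ps qs.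
  have nqp : w q p <> b%:Z.
    move=> h; have := noC (q, p); rewrite /C /= h eqxx => /(_ isT).
    by rewrite finset.subUset !finset.sub1set ps qs.
  by move: bpq npq nqp; rewrite /local_pair /w; lia.
Qed.

Lemma collapses_local : collapses (local_cx k k) (local_cx 1 2).
Proof.
have width a : (0 < a <= k)%N -> collapses (local_cx a k) (local_cx 1 k).
  elim: a => // -[|a] IH /andP[_ ak]; first exact: collapses_refl.
  apply: collapses_trans (IH _); last by rewrite (ltnW ak).
  exact: (@collapses_local_width a.+2).
have height b : (1 < b <= k)%N -> collapses (local_cx 1 b) (local_cx 1 2).
  elim: b => // -[|[|b]] IH /andP[_ bk] //; first exact: collapses_refl.
  apply: collapses_trans (IH _); last by rewrite (ltnW bk).
  exact: (@collapses_local_height b.+3).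
apply: collapses_trans (height k _); last by rewrite k_gt1 leqnn.
by apply: width; rewrite ltnW // leqnn.
Qed.

End local_complexes.

(** * The triangles that go round a line, and their role among the cliques *)

Section triangles.
Variables (k N : nat).
Hypotheses (k_gt1 : (1 < k)%N) (NE : N = (3 * k)%N).
Let T : finType := ('I_N * 'I_N)%type.
(* [(d, a, y)] stands for the horizontal ([d = false]) or vertical triangle on
   the line at height [y] with positions [a], [a + k], [a + 2k]. *)
Let J : finType := (bool * 'I_k * 'I_N)%type.
Implicit Types (d : bool) (p q r : T) (s t : {set T}) (j : J).

Definition crd d p : 'I_N := if d then p.2 else p.1.
Definition oth d p : 'I_N := if d then p.1 else p.2.
Definition pt d (c y : 'I_N) : T := if d then (y, c) else (c, y).

Lemma crd_pt d c y : crd d (pt d c y) = c. Proof. by case: d. Qed.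
Lemma oth_pt d c y : oth d (pt d c y) = y. Proof. by case: d. Qed.

Lemma crd_negb d p : crd (~~ d) p = oth d p. Proof. by case: d. Qed.

Lemma crd_oth_inj d p q : crd d p = crd d q :> nat -> oth d p = oth d q :> nat -> p = q.
Proof.
case: p q => [p1 p2] [q1 q2]; case: d => /= /val_inj -> /val_inj -> //.
Qed.

Definition on_line j p := oth j.1.1 p == j.2.
Definition pos j p : nat := crd j.1.1 p.

Definition tri_h j : {set T} := finset (fun p =>
  on_line j p && ((pos j p == j.1.2) || (pos j p == j.1.2 + k)%N ||
                  (pos j p == j.1.2 + 2 * k)%N)).

Lemma tri_corner_lt (a : 'I_k) (i : 'I_3) : (a + i * k < N)%N.
Proof.
clear k_gt1; by case: i => -[|[|[|//]]] i3; case: a => a ak /=; lia.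
Qed.

Definition corner j (i : 'I_3) : T :=
  pt j.1.1 (Ordinal (tri_corner_lt j.1.2 i)) j.2.

Lemma pos_corner j i : pos j (corner j i) = (j.1.2 + i * k)%N.
Proof. by rewrite /pos crd_pt. Qed.

Lemma on_line_corner j i : on_line j (corner j i).
Proof. by rewrite /on_line oth_pt. Qed.

Lemma corner_tri j i : corner j i \in tri_h j.
Proof.
rewrite inE on_line_corner pos_corner /=.
by case: i => -[|[|[|//]]] i3 /=; rewrite ?mul0n ?mul1n ?addn0 eqxx ?orbT.
Qed.

Lemma tri_sub j s : (forall i, corner j i \in s) -> tri_h j \subset s.
Proof.
move=> cs; apply/fintype.subsetP => p; rewrite inE => /andP[/eqP pl pp].
suff [i ip] : exists i : 'I_3, pos j p = (j.1.2 + i * k)%N.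
  rewrite (_ : p = corner j i) //; apply: (@crd_oth_inj j.1.1).
    by rewrite -/(pos j p) ip -pos_corner.
  by rewrite pl oth_pt.
case/orP: pp => [/orP[]|] /eqP ->.
- by exists ord0; rewrite mul0n addn0.
- by exists (@Ordinal 3 1 isT); rewrite mul1n.
- by exists (@Ordinal 3 2 isT).
Qed.

Definition cdiff d p q : int := sdiff N (crd d p) (crd d q).

Lemma torus_distE d p q :
  torus_dist N p q = (`|cdiff d p q| + `|cdiff (~~ d) p q|)%N.
Proof.
by rewrite /torus_dist !cyc_distE // /cdiff; case: d => //=; rewrite addnC.
Qed.

Definition vr_cx s := [forall p in s, forall q in s, (torus_dist N p q <= k)%N].

Lemma vr_cxP s : reflect {in s &, forall p q, (torus_dist N p q <= k)%N} (vr_cx s).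
Proof.
apply: (iffP forall_inP) => [H p q ps qs|H p ps].
  by have /forall_inP := H p ps; apply.
by apply/forall_inP => q qs; exact: H.
Qed.

Lemma vr_cx_down : down_closed vr_cx.
Proof.
move=> s t /fintype.subsetP ts /vr_cxP H.
by apply/vr_cxP => p q /ts ps /ts qs; exact: H.
Qed.

Lemma line_dist j p q : on_line j p -> on_line j q ->
  torus_dist N p q = `|sdiff N (pos j p) (pos j q)|%N.
Proof.
move=> /eqP pl /eqP ql; rewrite (torus_distE j.1.1) /cdiff.
by rewrite !crd_negb pl ql sdiffxx // addn0.
Qed.

Lemma vr_cx_tri j : vr_cx (tri_h j).
Proof.
apply/vr_cxP => p q; rewrite !inE => /andP[pl pp] /andP[ql qq].
rewrite (line_dist pl ql); have ak := ltn_ord j.1.2.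
have pN : (pos j p < N)%N by exact: ltn_ord.
have qN : (pos j q < N)%N by exact: ltn_ord.
have [h1 h2 h3] := sdiffE pN qN.
move: pp qq h1 h2 h3; move: (nat_of_ord _) (pos _ _) (pos _ _) (sdiff _ _ _).
by clear -NE => a x y z xx yy h1 h2 [] h3; lia.
Qed.

(** On a cycle of length 3k every position is at distance at least [k] from one of three equally
    spaced corners, with equality only at a corner. Nothing is left for an offset from the line. *)
Lemma tri_max j s : vr_cx s -> tri_h j \subset s -> s = tri_h j.
Proof.
move=> /vr_cxP Vs js; apply/eqP; rewrite finset.eqEsubset js andbT.
apply/fintype.subsetP => p ps.
have dist (i : 'I_3) : (`|sdiff N (j.1.2 + i * k)%N (pos j p)| +
    `|sdiff N j.2 (oth j.1.1 p)| <= k)%N.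
  have := Vs (corner j i) p (fintype.subsetP js _ (corner_tri j i)) ps.
  rewrite (torus_distE j.1.1) /cdiff crd_pt.
  by rewrite /corner /pos; case: (j.1.1).
have ak := ltn_ord j.1.2; have pN : (pos j p < N)%N by exact: ltn_ord.
have yN := ltn_ord j.2; have oN := ltn_ord (oth j.1.1 p).
have := dist ord0; have := dist (@Ordinal 3 1 isT); have := dist (@Ordinal 3 2 isT).
rewrite /= mul0n mul1n addn0 => d2 d1 d0.
have [_ _ h0] := @sdiffE N j.1.2 (pos j p) ltac:(lia) pN.
have [_ _ h1] := @sdiffE N (j.1.2 + k)%N (pos j p) ltac:(lia) pN.
have [_ _ h2] := @sdiffE N (j.1.2 + 2 * k)%N (pos j p) ltac:(lia) pN.
have y0 : sdiff N j.2 (oth j.1.1 p) = 0.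
  move: ak pN d0 d1 d2 h0 h1 h2.
  move: (nat_of_ord j.1.2) (pos j p) (sdiff _ j.2 _) => a x o.
  move: (sdiff _ a x) (sdiff _ (a + k) x) (sdiff _ (a + 2 * k) x); clear -NE k_gt1.
  by move=> s0 s1 s2 ? ? ? ? ? [] ? [] ? [] ?; lia.
have pl : on_line j p.
  by apply/eqP/val_inj; have := sdiff_eq0 yN oN y0.
rewrite inE pl /=.
move: ak pN d0 d1 d2 h0 h1 h2; rewrite y0.
move: (nat_of_ord j.1.2) (pos j p) => a x.
move: (sdiff _ a x) (sdiff _ (a + k) x) (sdiff _ (a + 2 * k) x); clear -NE k_gt1.
move=> s0 s1 s2 ak xN d0 d1 d2 h0 h1 h2.
by case: h0 => ?; case: h1 => ?; case: h2 => ?; lia.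
Qed.

(** If additivity fails, the three steps go once round the cycle of length 3k. Each is at most [k],
    so all are equal to [k] in absolute value, the other coordinates agree, and [p], [q], [r] are
    the corners of a triangle. *)
Lemma cdiff_triangle d s p q r : vr_cx s -> (forall j, ~~ (tri_h j \subset s)) ->
  p \in s -> q \in s -> r \in s -> cdiff d p q + cdiff d q r = cdiff d p r.
Proof.
move=> /vr_cxP Vs noH ps qs rs.
have := Vs p q ps qs; have := Vs q r qs rs; have := Vs p r ps rs.
rewrite !(torus_distE d).
have pN := ltn_ord (crd d p); have qN := ltn_ord (crd d q); have rN := ltn_ord (crd d r).
have tri := sdiff_triangle pN qN rN; rewrite -!/(cdiff _ _ _) in tri.
move=> dpr dqr dpq.
case: (eqVneq (cdiff d p q + cdiff d q r) (cdiff d p r)) => // ne; exfalso.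
have oE x y : cdiff (~~ d) x y = 0 -> oth d x = oth d y :> nat.
  by rewrite /cdiff !crd_negb => /sdiff_eq0; exact.
have opq : cdiff (~~ d) p q = 0 by case: tri => tri; lia.
have opr : cdiff (~~ d) p r = 0 by case: tri => tri; lia.
(* The index [a] of the triangle is the position of [p] modulo [k]. *)
have aP : exists a : 'I_k, [\/ crd d p = a :> nat, crd d p = (a + k)%N :> nat |
    crd d p = (a + 2 * k)%N :> nat].
  case: (ltnP (crd d p) k) => h1; first by exists (Ordinal h1); constructor 1.
  case: (ltnP (crd d p) (2 * k)) => h2.
    have h : (crd d p - k < k)%N by lia.
    by exists (Ordinal h); constructor 2; rewrite /=; lia.
  have h : (crd d p - 2 * k < k)%N by lia.
  by exists (Ordinal h); constructor 3; rewrite /=; lia.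
have [a pa] := aP; have := noH (d, a, oth d p); apply/negP/negPn.
apply: tri_sub => i; set x := corner _ _.
have xo : oth d x = oth d p by exact: oth_pt.
have xc : crd d x = (a + i * k)%N :> nat by rewrite /x /corner crd_pt.
suff [e|e|e] : [\/ crd d x = crd d p :> nat, crd d x = crd d q :> nat |
    crd d x = crd d r :> nat].
- by rewrite (crd_oth_inj e) // xo.
- by rewrite (crd_oth_inj e) // xo; exact: oE.
- by rewrite (crd_oth_inj e) // xo; exact: oE.
have [_ _ e1] := sdiffE pN qN; have [_ _ e2] := sdiffE qN rN.
have [_ _ e3] := sdiffE pN rN.
rewrite -!/(cdiff _ _ _) in e1 e2 e3; rewrite xc.
have ak := ltn_ord a; move: ak pN qN rN pa tri ne dpr dqr dpq e1 e2 e3.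
case: i {x xo xc} => -[|[|[|//]]] i3 /=;
  move: (nat_of_ord a) (nat_of_ord (crd d p)) (nat_of_ord (crd d q)) (nat_of_ord (crd d r))
    (cdiff d p q) (cdiff d q r) (cdiff d p r) (absz (cdiff (~~ d) p q))
    (absz (cdiff (~~ d) q r)) (absz (cdiff (~~ d) p r)); clear -NE k_gt1;
  move=> a0 x y z c1 c2 c3 o1 o2 o3 ? ? ? ? [] ? [] ? ? ? ? ? [] ? [] ? [] ?;
  first [lia | by constructor 1; lia | by constructor 2; lia | by constructor 3; lia].
Qed.

(** The bound [k] on |dx| + |dy| is the pair of bounds on |dx + dy| and |dx - dy|. A triangle does
    not lift, because its three steps of [k] go round the line. *)
Lemma local_cx_vr s :
  local_cx k k s = vr_cx s && [forall j, ~~ (tri_h j \subset s)].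
Proof.
apply/idP/andP => [Ls|[Vs /forallP noH]]; last first.
  apply/forall_inP => p ps; apply/forall_inP => q qs; apply/andP; split.
    have := elimT (vr_cxP s) Vs p q ps qs; rewrite (torus_distE false) /local_pair.
    by rewrite /dx /dy /cdiff /=; lia.
  apply/forall_inP => r rs; apply/andP; split; apply/eqP.
    exact: (@cdiff_triangle false s).
  exact: (@cdiff_triangle true s).
split.
  apply/vr_cxP => p q ps qs; have /local_cxP[X [Y XY]] := Ls; have [_ _ h] := XY p q ps qs.
  rewrite (torus_distE false) /cdiff /crd /=; move: h; rewrite /local_pair /dx /dy.
  by move: (sdiff _ p.1 _) (sdiff _ p.2 _); clear => x y; lia.
apply/forallP => j; apply/negP => /fintype.subsetP js.
have tri p q r : p \in s -> q \in s -> r \in s ->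
    cdiff j.1.1 p q + cdiff j.1.1 q r = cdiff j.1.1 p r.
  move=> ps qs rs; have /local_cxP[X [Y XY]] := Ls.
  have [e1 e2 _] := XY p q ps qs; have [e3 e4 _] := XY q r qs rs.
  have [e5 e6 _] := XY p r ps rs; rewrite /dx /dy in e1 e2 e3 e4 e5 e6.
  by rewrite /cdiff /crd; case: j.1.1; lia.
have := tri _ _ _ (js _ (corner_tri j ord0))
  (js _ (corner_tri j (@Ordinal 3 1 isT))) (js _ (corner_tri j (@Ordinal 3 2 isT))).
rewrite /cdiff -!/(pos j _) !pos_corner /= mul0n mul1n addn0.
have ak := ltn_ord j.1.2.
have [l1 u1 h1] := @sdiffE N j.1.2 (j.1.2 + k)%N ltac:(lia) ltac:(lia).
have [l2 u2 h2] := @sdiffE N (j.1.2 + k)%N (j.1.2 + 2 * k)%N ltac:(lia) ltac:(lia).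
have [l3 u3 h3] := @sdiffE N j.1.2 (j.1.2 + 2 * k)%N ltac:(lia) ltac:(lia).
move: l1 u1 h1 l2 u2 h2 l3 u3 h3; move: (nat_of_ord j.1.2) => a.
move: (sdiff _ a (a + k)) (sdiff _ (a + k) _) (sdiff _ a (a + 2 * k)).
by clear -NE k_gt1 => x y z ? ? [] ? ? ? [] ? ? ? [] ? ?; lia.
Qed.

End triangles.

(** * The arcs cut out by a triangle, and the trade of triangles for cones over lines *)

Section arcs.
Variables (k N : nat).
Hypotheses (k_gt1 : (1 < k)%N) (NE : N = (3 * k)%N).
Let T : finType := ('I_N * 'I_N)%type.
Let J : finType := (bool * 'I_k * 'I_N)%type.
Implicit Types (p q : T) (s t : {set T}) (j : J).

Definition wrap_sub (st c : nat) : nat := (if st <= c then c - st else c + N - st)%N.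

(** Measured from the first corner, so that the corners of [tri_h j] sit at 0, [k] and [2 * k] for
    every [j]. *)
Definition rel_pos j p : nat := wrap_sub j.1.2 (pos j p).

Definition arc_pos (i : 'I_3) j p : nat := wrap_sub (i * k) (rel_pos j p).

Definition arcs j t := [exists i : 'I_3,
  [forall p in t, on_line j p && (arc_pos i j p <= k)%N]].

Definition arcs_tri j t := arcs j t || (t \subset tri_h j).

Definition path_link j t := [forall p in t, on_line j p] &&
  [forall p in t, forall q in t, (`|sdiff N (pos j p) (pos j q)| <= 1)%N].

Lemma rel_lt j p : (rel_pos j p < N)%N.
Proof.
rewrite /rel_pos /wrap_sub; have ak := ltn_ord j.1.2.
have pN : (pos j p < N)%N by exact: ltn_ord.
by case: ifP => h; lia.
Qed.

Lemma rel_sdiff j p q : sdiff N (pos j p) (pos j q) = sdiff N (rel_pos j p) (rel_pos j q).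
Proof.
have rp := rel_lt j p; have rq := rel_lt j q; have ak := ltn_ord j.1.2.
have pN : (pos j p < N)%N by exact: ltn_ord.
have qN : (pos j q < N)%N by exact: ltn_ord.
have [l1 u1 h1] := sdiffE pN qN; have [l2 u2 h2] := sdiffE rp rq.
move: l1 u1 h1 l2 u2 h2 rp rq ak pN qN.
move: (sdiff N (pos j p) (pos j q)) (sdiff N (rel_pos j p) (rel_pos j q)).
rewrite /rel_pos /wrap_sub; move: (nat_of_ord j.1.2) (pos j p) (pos j q).
clear -NE => a b c x y l1 u1 h1 l2 u2 h2 rp rq ak pN qN.
by case: ifP h2 rp rq => ?; case: ifP => ? h2 rp rq; case: h1 => ?; case: h2 => ?; lia.
Qed.

Definition unrel_nat (a r : nat) : nat := (if a + r < N then a + r else a + r - N)%N.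

Lemma unrel_lt (a : 'I_k) (r : 'I_N) : (unrel_nat a r < N)%N.
Proof.
by rewrite /unrel_nat; have := ltn_ord a; have := ltn_ord r; case: ifP; lia.
Qed.

Lemma unrelK a r : (a < N)%N -> (r < N)%N -> wrap_sub a (unrel_nat a r) = r.
Proof.
rewrite /wrap_sub /unrel_nat => aN rN.
by case: (ltnP (a + r) N) => h1; case: ifP => h2; lia.
Qed.

Definition rel_pt j (r : 'I_N) : T := pt j.1.1 (Ordinal (unrel_lt j.1.2 r)) j.2.

Lemma on_line_rel_pt j (r : 'I_N) : on_line j (rel_pt j r).
Proof. by rewrite /on_line oth_pt. Qed.

Lemma rel_rel_pt j (r : 'I_N) : rel_pos j (rel_pt j r) = r.
Proof.
rewrite /rel_pos /pos crd_pt /=; apply: unrelK => //.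
by apply: (leq_trans (ltn_ord _)); lia.
Qed.

Lemma rel_inj j p q : on_line j p -> on_line j q -> rel_pos j p = rel_pos j q -> p = q.
Proof.
move=> /eqP pl /eqP ql pq; apply: (@crd_oth_inj _ j.1.1); last by rewrite pl ql.
move: pq; rewrite -!/(pos j _) /rel_pos /wrap_sub; have ak := ltn_ord j.1.2.
have pN : (pos j p < N)%N by exact: ltn_ord.
have qN : (pos j q < N)%N by exact: ltn_ord.
by case: ifP => h1; case: ifP => h2; lia.
Qed.

Lemma tri_relE j p : p \in tri_h j = on_line j p &&
  [|| rel_pos j p == 0%N, rel_pos j p == k | rel_pos j p == (2 * k)%N].
Proof.
rewrite inE; congr (_ && _); rewrite /rel_pos /wrap_sub; have ak := ltn_ord j.1.2.
have pN : (pos j p < N)%N by exact: ltn_ord.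
by case: ifP => h1; lia.
Qed.

Lemma arc_posE (i : 'I_3) j p : (arc_pos i j p <= k)%N =
  if i == 0%N :> nat then (rel_pos j p <= k)%N else
  if i == 1%N :> nat then (k <= rel_pos j p <= 2 * k)%N else
  (2 * k <= rel_pos j p)%N || (rel_pos j p == 0%N).
Proof.
rewrite /arc_pos /wrap_sub; have := rel_lt j p.
by case: i => -[|[|[|//]]] i3 /=; try case: ifP; lia.
Qed.

(** An arc has length [k], less than N/2, so along it positions subtract without wrapping. *)
Lemma arc_pos_sdiff i j p q : (arc_pos i j p <= k)%N -> (arc_pos i j q <= k)%N ->
  sdiff N (pos j p) (pos j q) = (arc_pos i j q)%:Z - (arc_pos i j p)%:Z.
Proof.
rewrite rel_sdiff /arc_pos /wrap_sub; have rp := rel_lt j p; have rq := rel_lt j q.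
have [l1 u1 h1] := sdiffE rp rq; move: l1 u1 h1 rp rq.
move: (rel_pos j p) (rel_pos j q) (sdiff _ _ _); clear -NE k_gt1 => b c x l1 u1 h1 rp rq.
case: i => -[|[|[|//]]] i3 /=; do 2 try case: ifP => ?; move=> ? ?;
  case: h1 => ?; lia.
Qed.

Lemma arcs_down j : down_closed (arcs j).
Proof.
move=> s t /fintype.subsetP ts /existsP[i /forall_inP si].
by apply/existsP; exists i; apply/forall_inP => p /ts; exact: si.
Qed.

Lemma arcs_tri_down j : down_closed (arcs_tri j).
Proof.
move=> s t ts; rewrite /arcs_tri => /orP[/(arcs_down ts) -> //|sj].
by rewrite (fintype.subset_trans ts sj) orbT.
Qed.

Lemma arcs_local j t : arcs j t -> local_cx k k t.
Proof.
move=> /existsP[i /forall_inP ti].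
have d0 p q : p \in t -> q \in t -> sdiff N (oth j.1.1 p) (oth j.1.1 q) = 0.
  by move=> /ti/andP[/eqP -> _] /ti/andP[/eqP -> _]; rewrite sdiffxx.
have d1 p q : p \in t -> q \in t -> sdiff N (crd j.1.1 p) (crd j.1.1 q) =
    (arc_pos i j q)%:Z - (arc_pos i j p)%:Z.
  by move=> /ti/andP[_ ?] /ti/andP[_ ?]; exact: arc_pos_sdiff.
have bd p : p \in t -> (arc_pos i j p <= k)%N by move=> /ti/andP[].
apply/local_cxP; exists (fun p => if j.1.1 then 0 else (arc_pos i j p)%:Z),
  (fun p => if j.1.1 then (arc_pos i j p)%:Z else 0) => p q pt qt.
have := d0 p q pt qt; have := d1 p q pt qt; have := bd p pt; have := bd q qt.
rewrite /local_pair /dx /dy /crd /oth; case: j.1.1 => bp bq e1 e0;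
  by rewrite e0 e1 subrr; split=> //; lia.
Qed.

Lemma arcs_tri_vr j t : arcs_tri j t -> vr_cx k t.
Proof.
move=> /orP[/arcs_local|tj]; last exact: vr_cx_down tj (vr_cx_tri NE j).
by rewrite (local_cx_vr k_gt1 NE) => /andP[].
Qed.

Lemma arcs_no_tri j j' t : arcs j t -> ~~ (tri_h j' \subset t).
Proof.
by move=> /arcs_local; rewrite (local_cx_vr k_gt1 NE) => /andP[_ /forallP]; apply.
Qed.

Lemma tri_h_inj : injective (@tri_h k N).
Proof.
move=> j j' jj'.
have := corner_tri NE j (ord0 : 'I_3); have := corner_tri NE j (@Ordinal 3 1 isT).
have := corner_tri NE j (@Ordinal 3 2 isT).
rewrite jj' !inE /on_line /pos /corner /=.
case: j j' {jj'} => [[d a] y] [[d' a'] y'] /=.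
have ak := ltn_ord a; have ak' := ltn_ord a'; have yN := ltn_ord y.
have yN' := ltn_ord y'.
case: (eqVneq d d') => [-> | dd'].
  rewrite !oth_pt !crd_pt /= => /andP[/eqP -> h2] /andP[_ h1] /andP[_ h0].
  congr (_, _, _); apply: val_inj => /=; lia.
have -> : d' = ~~ d by case: d d' dd' => -[].
have e u v : oth (~~ d) (pt d u v) = u :> 'I_N by case: d {dd'}.
rewrite !e => /andP[/eqP h2 _] /andP[/eqP h1 _] /andP[/eqP h0 _].
have := congr1 val h0; rewrite -h1 /=; lia.
Qed.

(** A face of the triangle that misses a corner lies in the closed arc opposite to that corner;
    conversely an arc lifts to the plane and so contains no triangle. *)
Lemma arcs_triE j t : arcs_tri j t && [forall j' : J, ~~ (tri_h j' \subset t)] = arcs j t.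
Proof.
apply/andP/idP => [[/orP[//|tj] /forallP /(_ j) jt]|tj]; last first.
  rewrite /arcs_tri tj; split=> //; apply/forallP => j'; exact: arcs_no_tri tj.
have [i ci] : exists i, corner NE j i \notin t.
  apply/existsP; rewrite -negb_forall; apply: contra jt => /forallP c.
  exact: (tri_sub (NE := NE)).
have relc i' : rel_pos j (corner NE j i') = (i' * k)%N.
  rewrite /rel_pos pos_corner /wrap_sub leq_addr; lia.
have nrel p : p \in t -> on_line j p /\ rel_pos j p <> (i * k)%N /\
    [\/ rel_pos j p = 0%N, rel_pos j p = k | rel_pos j p = (2 * k)%N].
  move=> pt; have := fintype.subsetP tj p pt; rewrite tri_relE => /andP[pl pr].
  split=> //; split.
    by move=> pi; rewrite -(@rel_inj j p _ pl (on_line_corner _ _ _)) ?pt ?relc // in ci.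
  by case/or3P: pr => /eqP; [constructor 1|constructor 2|constructor 3].
have arc_i (i' : 'I_3) : (forall r : nat, r <> (i * k)%N ->
      [\/ r = 0%N, r = k | r = (2 * k)%N] ->
      (if i' == 0%N :> nat then (r <= k)%N else
       if i' == 1%N :> nat then (k <= r <= 2 * k)%N else (2 * k <= r)%N || (r == 0%N)))
    -> arcs j t.
  move=> H; apply/existsP; exists i'; apply/forall_inP => p /nrel[-> [r1 r2]] /=.
  by rewrite arc_posE; exact: H.
case: i {ci nrel} arc_i => -[|[|[|//]]] i3 arc_i.
- by apply: (arc_i (@Ordinal 3 1 isT)) => r /= rn [] ?; lia.
- by apply: (arc_i (@Ordinal 3 2 isT)) => r /= rn [] ?; lia.
- by apply: (arc_i ord0) => r /= rn [] ?; lia.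
Qed.

Let r0_lt : (0 < N)%N. Proof. lia. Qed.
Let rk_lt : (k < N)%N. Proof. lia. Qed.
Let r2k_lt : (2 * k < N)%N. Proof. lia. Qed.

(** Each arc spans a full simplex, so an inner point of an arc is dominated by the corner where the
    arc starts. What remains is the simplex on the three corners, which is a cone. The empty simplex
    goes too, so a cone over [arcs_tri j] can be attached freely. *)
Lemma collapses_arcs_tri j : collapses (arcs_tri j) (fun=> false).
Proof.
apply: (@collapses_trans _ _ (fun t => t \subset tri_h j)); last first.
  have -> : (fun=> false) = star_removed (fun t => t \subset tri_h j) finset.set0.
    by apply/funext => t; rewrite /star_removed finset.sub0set andbF.
  apply: (@collapses1 _ _ _ (corner NE j ord0)); first by rewrite inE.
  by move=> s sj _; rewrite finset.subUset finset.sub1set corner_tri.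
pose C p := on_line j p && (p \notin tri_h j).
pose apex p := rel_pt j (if (rel_pos j p < k)%N then Ordinal r0_lt else
  if (rel_pos j p < 2 * k)%N then Ordinal rk_lt else Ordinal r2k_lt).
have apex_tri p : apex p \in tri_h j.
  rewrite tri_relE on_line_rel_pt rel_rel_pt /=.
  by case: ifP => _; [|case: ifP => _]; rewrite eqxx ?orbT.
apply: (@collapses_family _ _ C (fun p => [set p]%SET) apex (fun=> 0%N)).
- move=> p /andP[_ pn]; rewrite finset.in_set1; apply: contraNneq pn => <-.
  exact: apex_tri.
- move=> p s /andP[pl pn] Ks; rewrite finset.sub1set => ps _; split; last first.
    move=> q /andP[_ qn]; rewrite !finset.sub1set finset.in_setU1.
    move=> /predU1P[qE|->]; last by left.
    by rewrite qE apex_tri in qn.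
  case/orP: Ks => [/existsP[i /forall_inP si]|sj]; last first.
    by rewrite (fintype.subsetP sj) in pn.
  apply/orP; left; apply/existsP; exists i; apply/forall_inP => q.
  rewrite finset.in_setU1 => /predU1P[->|]; last exact: si.
  rewrite on_line_rel_pt /=; have /andP[_] := si p ps.
  move: pn; rewrite tri_relE pl /= !arc_posE rel_rel_pt; have := rel_lt j p.
  case: i {si} => -[|[|[|//]]] i3 /=; case: ifP => ? /=; try lia;
    case: ifP => ? /=; lia.
- move=> t; apply/idP/andP => [tj|[Kt /forall_inP nC]].
    split; first by rewrite /arcs_tri tj orbT.
    apply/forall_inP => p /andP[_ pn]; rewrite finset.sub1set.
    by apply: contra pn; exact: (fintype.subsetP tj).
  apply/fintype.subsetP => p pt; apply/negPn/negP => pn.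
  suff pl : on_line j p by have := nC p; rewrite /C pl pn finset.sub1set pt => /(_ isT).
  case/orP: Kt => [/existsP[i /forall_inP /(_ p pt) /andP[]] //|tj].
  by rewrite (fintype.subsetP tj) in pn.
Qed.

Lemma path_linkP j t : reflect ((forall p, p \in t -> on_line j p) /\
    forall p q, p \in t -> q \in t -> (`|sdiff N (pos j p) (pos j q)| <= 1)%N)
  (path_link j t).
Proof.
apply: (iffP andP) => [[/forall_inP l /forall_inP h]|[l h]].
  by split=> // p q /h /forall_inP; exact.
split; first exact/forall_inP.
by apply/forall_inP => p pt; apply/forall_inP => q; exact: h.
Qed.

Lemma path_link_down j : down_closed (path_link j).
Proof.
move=> s t /fintype.subsetP ts /path_linkP[l h]; apply/path_linkP.
by split=> [p /ts|p q /ts ps /ts]; [exact: l|exact: h].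
Qed.

Lemma path_link_local j t : path_link j t -> local_cx 1 2 t.
Proof.
move=> /path_linkP[l h].
have d0 p q : p \in t -> q \in t -> sdiff N (oth j.1.1 p) (oth j.1.1 q) = 0.
  by move=> /l/eqP -> /l/eqP ->; rewrite sdiffxx.
have [->|/set0Pn[p0 p0t]] := eqVneq t finset.set0.
  by apply/local_cxP; exists (fun=> 0), (fun=> 0) => p q; rewrite inE.
have d1 p q : p \in t -> q \in t -> sdiff N (crd j.1.1 p) (crd j.1.1 q) =
    sdiff N (pos j p0) (pos j q) - sdiff N (pos j p0) (pos j p).
  move=> pt qt; rewrite -!/(pos j _).
  have pN : (pos j p < N)%N by exact: ltn_ord.
  have qN : (pos j q < N)%N by exact: ltn_ord.
  have p0N : (pos j p0 < N)%N by exact: ltn_ord.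
  move: (sdiff_triangle p0N pN qN) (h _ _ p0t pt) (h _ _ p0t qt) (h _ _ pt qt).
  move: (sdiff N (pos j p0) (pos j p)) (sdiff N (pos j p0) (pos j q))
    (sdiff N (pos j p) (pos j q)) => x y z.
  by clear -NE k_gt1 => -[] ? ? ? ?; lia.
apply/local_cxP; exists (fun p => if j.1.1 then 0 else sdiff N (pos j p0) (pos j p)),
  (fun p => if j.1.1 then sdiff N (pos j p0) (pos j p) else 0) => p q pt qt.
have := d0 p q pt qt; have e1 := d1 p q pt qt; have := h p q pt qt.
rewrite /pos e1; move: e1; rewrite /local_pair /dx /dy /pos /crd /oth.
case: j.1.1 => e1 bpq e0; rewrite e0 e1 subrr; split=> //; move: bpq;
  by move: (_ - _) => z; clear; lia.
Qed.

(** The longest edges within an arc go first, with the successor of the start as apex: [p] and [q]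
    are then the extreme points of the simplex, and every new edge is shorter. *)
Lemma collapses_arcs j : collapses (arcs j) (path_link j).
Proof.
pose C (x : 'I_3 * T * T) := let: (i, p, q) := x in
  [&& on_line j p, on_line j q, (arc_pos i j p <= k)%N, (arc_pos i j q <= k)%N &
   (arc_pos i j p + 2 <= arc_pos i j q)%N].
pose core (x : 'I_3 * T * T) : {set T} := [set x.1.2; x.2]%SET.
have succ_lt p : ((if (rel_pos j p).+1 < N then (rel_pos j p).+1 else 0) < N)%N.
  by case: ifP.
pose apex (x : 'I_3 * T * T) := rel_pt j (Ordinal (succ_lt x.1.2)).
pose rk (x : 'I_3 * T * T) := (k - (arc_pos x.1.1 j x.2 - arc_pos x.1.1 j x.1.2))%N.
have apex_pos i p q : C (i, p, q) ->
    arc_pos i j (apex (i, p, q)) = (arc_pos i j p).+1.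
  move=> /and5P[_ _ pk qk pq]; move: pk qk pq; rewrite /arc_pos rel_rel_pt /=.
  rewrite /wrap_sub; have := rel_lt j p; have := rel_lt j q.
  move: (rel_pos j p) (rel_pos j q); clear -NE k_gt1 => b c.
  case: (ltnP b.+1 N) => ?; case: i => -[|[|[|//]]] i3 /=;
    do 3 try case: ifP => ?; lia.
(* Two different arcs share a single corner, so an edge determines its arc. *)
have arc_uniq i i' p q : C (i, p, q) -> (arc_pos i' j p <= k)%N ->
    (arc_pos i' j q <= k)%N -> i' = i.
  move=> /and5P[_ _ pk qk pq] pk' qk'; apply/eqP/negPn/negP => ii'.
  suff e : rel_pos j p = rel_pos j q by move: pq; rewrite /arc_pos e addn2 ltnNge leqnSn.
  move: pk qk pk' qk' ii'; rewrite !arc_posE; move: (rel_pos j p) (rel_pos j q).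
  clear -NE k_gt1 => b c.
  case: i i' => -[|[|[|//]]] i3 [[|[|[|//]]] i3'] /=; first [by rewrite eqxx|lia].
apply: (@collapses_family _ _ C core apex rk).
- move=> [[i p] q] /[dup] Cx /and5P[_ _ _ _ pq]; rewrite /core /= !inE negb_or.
  by apply/andP; split; apply/eqP => e; have := apex_pos _ _ _ Cx; rewrite e; lia.
- move=> [[i p] q] s /[dup] Cx /and5P[pl ql pk qk pq] /existsP[i' /forall_inP si].
  rewrite /core /= finset.subUset !finset.sub1set => /andP[ps qs] rkmin.
  have i'i : i' = i.
    by apply: arc_uniq Cx _ _; [have /andP[] := si p ps|have /andP[] := si q qs].
  subst i'; have axp := apex_pos _ _ _ Cx.
  split.
    apply/existsP; exists i; apply/forall_inP => x; rewrite finset.in_setU1.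
    move=> /predU1P[->|/si //]; rewrite on_line_rel_pt axp /=; lia.
  move=> [[i' p'] q'] /[dup] Cx' /and5P[pl' ql' pk' qk' pq'] /=.
  rewrite finset.subUset !finset.sub1set => /andP[ps' qs'].
  have inarc x : x \in apex (i, p, q) |: s -> (arc_pos i j x <= k)%N.
    rewrite finset.in_setU1 => /predU1P[->|/si /andP[] //].
    rewrite axp; apply: leq_trans qk; apply: leq_trans pq.
    by rewrite addn2.
  have i'i : i = i' by apply: arc_uniq Cx' _ _; exact: inarc.
  subst i'; rewrite /rk /=.
  have rkmin' x y : x \in s -> y \in s -> (arc_pos i j y <= arc_pos i j x +
      (arc_pos i j q - arc_pos i j p))%N.
    move=> xs ys; have [xy|xy] := leqP (arc_pos i j x + 2) (arc_pos i j y); last first.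
      move: xy pq; move: (arc_pos i j p) (arc_pos i j q) (arc_pos i j x) (arc_pos i j y).
      by clear; lia.
    have /andP[xl xk] := si x xs; have /andP[yl yk] := si y ys.
    have := rkmin (i, x, y); rewrite /C xl yl xk yk xy /= => /(_ isT).
    rewrite finset.subUset !finset.sub1set xs ys /rk /= => /(_ isT).
    move: pk qk pq xk yk xy; move: (arc_pos i j p) (arc_pos i j q).
    by move: (arc_pos i j x) (arc_pos i j y); clear; lia.
  move: ps' qs'; rewrite !finset.in_setU1.
  move=> /predU1P[p'E|ps'] /predU1P[q'E|qs'].
  + by rewrite p'E q'E addn2 ltnNge leqnSn in pq'.
  + right; rewrite p'E axp.
    move: (rkmin' p q' ps qs') pk qk pq pk' qk' pq'; rewrite p'E axp.
    by move: (arc_pos i j p) (arc_pos i j q) (arc_pos i j q'); clear; lia.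
  + right; rewrite q'E axp.
    move: (rkmin' p' q ps' qs) pk qk pq pk' qk' pq'; rewrite q'E axp.
    by move: (arc_pos i j p) (arc_pos i j q) (arc_pos i j p'); clear; lia.
  + by left; rewrite finset.subUset !finset.sub1set ps' qs'.
- move=> t; apply/idP/andP => [/path_linkP[l h]|[/existsP[i /forall_inP ti] /forall_inP nC]].
    split; last first.
      apply/forall_inP => -[[i p] q] /= /and5P[_ _ pk qk pq].
      rewrite finset.subUset !finset.sub1set; apply/negP => /andP[pt qt].
      by have := h p q pt qt; rewrite (arc_pos_sdiff pk qk); lia.
    have [->|/set0Pn[p1 p1t]] := eqVneq t finset.set0.
      by apply/existsP; exists ord0; apply/forall_inP => p; rewrite inE.
    (* The first of at most two consecutive points: a point behind [p1] if there is one, and [p1]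
       otherwise. *)
    have [p0 p0t p0min] : exists2 p0, p0 \in t & forall q, q \in t ->
        0 <= sdiff N (pos j p0) (pos j q) <= 1.
      have [/forall_inP all0|] :=
        boolP [forall q in t, 0 <= sdiff N (pos j p1) (pos j q)].
        by exists p1 => // q qt; have := all0 q qt; have := h p1 q p1t qt; lia.
      rewrite negb_forall => /existsP[p0]; rewrite negb_imply => /andP[p0t neg].
      exists p0 => // q qt.
      have aN : (pos j p1 < N)%N by exact: ltn_ord.
      have bN : (pos j p0 < N)%N by exact: ltn_ord.
      have cN : (pos j q < N)%N by exact: ltn_ord.
      move: neg (sdiff_triangle aN bN cN) (h _ _ p1t p0t) (h _ _ p1t qt) (h _ _ p0t qt).
      move: (sdiff N (pos j p1) (pos j p0)) (sdiff N (pos j p1) (pos j q))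
        (sdiff N (pos j p0) (pos j q)).
      by clear -NE k_gt1 => x y z neg [] ? ? ? ?; lia.
    (* An arc that does not end at [p0], so that it also contains the successor of [p0]. *)
    have [i i0] : exists i : 'I_3, (arc_pos i j p0 < k)%N.
      have := rel_lt j p0; rewrite /arc_pos /wrap_sub.
      have [h1|h1] := ltnP (rel_pos j p0) k; first by exists ord0 => /=; lia.
      have [h2|h2] := ltnP (rel_pos j p0) (2 * k) => h3.
        by exists (@Ordinal 3 1 isT) => /=; case: ifP; lia.
      by exists (@Ordinal 3 2 isT) => /=; case: ifP; lia.
    apply/existsP; exists i; apply/forall_inP => q qt; rewrite l //=.
    have := p0min q qt; rewrite rel_sdiff; move: i0; rewrite /arc_pos /wrap_sub.
    have rp := rel_lt j p0; have rq := rel_lt j q.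
    have [l1 u1 h1] := sdiffE rp rq; move: l1 u1 h1 rp rq.
    move: (rel_pos j p0) (rel_pos j q) (sdiff _ _ _); clear -NE k_gt1.
    move=> b c x l1 u1 h1 rp rq.
    case: i => -[|[|[|//]]] i3 /=; do 2 try case: ifP => ?; move=> ? ?;
      case: h1 => ?; lia.
  apply/path_linkP; split=> [p /ti/andP[]//|p q pt qt].
  have /andP[pl pk] := ti p pt; have /andP[ql qk] := ti q qt.
  rewrite (arc_pos_sdiff pk qk).
  have npq : ~~ (arc_pos i j p + 2 <= arc_pos i j q)%N.
    apply/negP => pq; have := nC (i, p, q); rewrite /C pl ql pk qk pq => /(_ isT).
    by rewrite finset.subUset !finset.sub1set pt qt.
  have nqp : ~~ (arc_pos i j q + 2 <= arc_pos i j p)%N.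
    apply/negP => qp; have := nC (i, q, p); rewrite /C pl ql pk qk qp => /(_ isT).
    by rewrite finset.subUset !finset.sub1set pt qt.
  lia.
Qed.

(* Coning off each triangle together with the three arcs it cuts on its line,
   discarding the triangle, and pushing the arcs into the line replaces the
   triangle by a cone over the whole line. *)
Lemma collapses_vr :
  collapses (coned (@vr_cx k N) arcs_tri) (coned (@local_cx N 1 2) path_link).
Proof.
have tri_sub_set j (t : {set T + J}) : (inl @: tri_h j \subset t) =
    (tri_h j \subset inl @^-1: t) by exact: imset_inl_sub.
apply: (@collapses_trans _ _ (coned (@local_cx N k k) arcs)).
  (* The triangle is maximal in [vr_cx] and lies in no link but its own, so the only simplices
     removed are the triangle and its join with [inr j]. *)
  apply: (@collapses_family _ _ predT (fun j => inl @: tri_h j) (fun j => inr j)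
    (fun=> 0%N)).
  - by move=> j _; apply/imsetP => -[].
  - move=> j s _ Ks; rewrite tri_sub_set => js _; split; last first.
      move=> j' _; rewrite tri_sub_set preim_inl_setU1r => j's; left.
      by rewrite tri_sub_set.
    have arcs_tri_tri : arcs_tri j (tri_h j) by rewrite /arcs_tri subxx orbT.
    move: Ks; apply: coned_ind => [s0 Vs|i si Qs].
      rewrite (@coned_apex _ _ _ _ _ j); last by rewrite preim_inr_setU1r s0 finset.setU0.
      by rewrite preim_inl_setU1r (tri_max k_gt1 NE Vs js).
    have ts : inl @^-1: s = tri_h j by exact: tri_max (arcs_tri_vr Qs) js.
    have ij : i = j.
      case/orP: Qs => [Qs|is_].
        by have := @arcs_no_tri i j _ Qs; rewrite js.
      apply: tri_h_inj; apply: (tri_max k_gt1 NE (vr_cx_tri NE i)).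
      by rewrite -ts.
    subst i; rewrite (@coned_apex _ _ _ _ _ j) ?preim_inl_setU1r //.
    by rewrite preim_inr_setU1r si; apply/finset.setUidPl.
  - move=> s; under eq_forallb do rewrite tri_sub_set.
    rewrite /coned local_cx_vr // andb_orl -andbA; congr (_ || _).
    apply/existsP/andP => [[j /andP[sj]]|[/existsP[j /andP[sj Qj]] noH]].
      rewrite -arcs_triE => /andP[Qj noH]; split=> //.
      by apply/existsP; exists j; rewrite sj.
    by exists j; rewrite sj -arcs_triE Qj.
apply: (@collapses_trans _ _ (coned (@local_cx N k k) path_link)).
  by apply: collapses_coned_link => j; exact: collapses_arcs.
apply: collapses_coned_base; first exact: collapses_local.
exact: path_link_local.
Qed.

End arcs.

(** * The maximal triangles taken out of the coned grid, and the collapse of the rest *)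

Section facets.
Variables (k N : nat).
Hypotheses (k_gt1 : (1 < k)%N) (NE : N = (3 * k)%N).
Let T : finType := ('I_N * 'I_N)%type.
Let J : finType := (bool * 'I_k * 'I_N)%type.
Implicit Types (p q : T) (t : {set T}) (j : J) (y : 'I_N).

Let N_gt4 : (4 < N)%N. Proof. by lia. Qed.
Let z0_lt : (0 < N)%N. Proof. by lia. Qed.
Let zl_lt : (N.-1 < N)%N. Proof. by lia. Qed.
Let zk_lt : (0 < k)%N. Proof. by lia. Qed.
Let z0 : 'I_N := Ordinal z0_lt.
Let zl : 'I_N := Ordinal zl_lt.

Definition grid_cx := coned (@local_cx N 1 2) (@path_link k N).

Definition kept_col : J := (true, Ordinal zk_lt, z0).
Definition kept_row j := ~~ j.1.1 && (j.1.2 == 0%N :> nat).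

Definition strip1 y : T := (z0, y).
Definition strip2 y : T := (zl, cshift y 1).
Definition strip3 y : T := (z0, cshift y 1).
Definition strip_tri y : {set T} := [set strip1 y; strip2 y; strip3 y]%SET.

(** The indices of the cones are reused for the triangles to be removed: a kept row stands for a
    triangle in the strip between it and the next row, any other index for the triangle of its cone
    over the edge from [N - 1] to 0. Leaving out [kept_col] gives the right number. The vertices are
    named one by one because they later serve as coordinates. *)
Definition facet1 j : T + J := if kept_row j then inl (strip1 j.2) else inr j.
Definition facet2 j : T + J :=
  if kept_row j then inl (strip2 j.2) else inl (pt j.1.1 zl j.2).
Definition facet3 j : T + J :=
  if kept_row j then inl (strip3 j.2) else inl (pt j.1.1 z0 j.2).
Definition facet j : {set T + J} := [set facet1 j; facet2 j; facet3 j]%SET.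

Lemma cshift1E y : sdiff N y (cshift y 1) = 1.
Proof. by apply: cshiftE; lia. Qed.

Lemma sdiff_zl : sdiff N z0 zl = -1 /\ sdiff N zl z0 = 1.
Proof.
change (sdiff N 0 N.-1 = -1 /\ sdiff N N.-1 0 = 1).
have [l1 u1 e1] := sdiffE z0_lt zl_lt; have [l2 u2 e2] := sdiffE zl_lt z0_lt.
move: l1 u1 e1 l2 u2 e2; move: (sdiff N 0 _) (sdiff N _ 0); clear -N_gt4.
by move=> x y ? ? [] ? ? ? [] ?; lia.
Qed.

Lemma strip_diff y : [/\ dx (strip1 y) (strip2 y) = -1, dy (strip1 y) (strip2 y) = 1,
  dx (strip1 y) (strip3 y) = 0 & dy (strip1 y) (strip3 y) = 1].
Proof.
have [e1 e2] := sdiff_zl; rewrite /dx /dy /= !cshift1E; split=> //.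
exact: sdiffxx.
Qed.

Lemma strip_max y t : local_cx 1 2 t -> strip_tri y \subset t -> t = strip_tri y.
Proof.
move=> Lt; rewrite /strip_tri !finset.subUset !finset.sub1set.
move=> /andP[/andP[t1 t2] t3]; apply/eqP; rewrite finset.eqEsubset andbC.
rewrite !finset.subUset !finset.sub1set t1 t2 t3 /=.
apply/fintype.subsetP => q qt.
have [X [Y [X1 Y1 XY]]] := local_cx_coord Lt t1.
have [e1 e2 e3 e4] := strip_diff y.
have [x2 y2 _] := XY _ _ t1 t2; have [x3 y3 _] := XY _ _ t1 t3.
have [xq yq b1] := XY _ _ t1 qt; have [_ _ b2] := XY _ _ t2 qt.
have [f1 f2 b3] := XY _ _ t3 qt; have [g1 g2 _] := XY _ _ t2 qt.
rewrite e1 e2 in x2 y2; rewrite e3 e4 in x3 y3.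
have : [\/ X q = 0 /\ Y q = 0, X q = -1 /\ Y q = 1 | X q = 0 /\ Y q = 1].
  move: b1 b2 b3; rewrite /local_pair f1 f2 g1 g2 xq yq.
  move: x2 y2 x3 y3; rewrite X1 Y1.
  move: (X (strip2 y)) (Y (strip2 y)) (X (strip3 y)) (Y (strip3 y)) (X q) (Y q).
  clear => a b c d u v *.
  have [?|?] := eqVneq u 0; have [?|?] := eqVneq v 0.
  - by constructor 1.
  - by constructor 3; lia.
  - by exfalso; lia.
  - by constructor 2; lia.
rewrite !inE => -[] [xE yE].
- by rewrite (@point_eq _ (strip1 y) q (strip1 y)) ?eqxx // /dx /dy ?sdiffxx //;
    rewrite -/(dx _ _) -/(dy _ _) ?xq ?yq ?X1 ?Y1; lia.
- by rewrite (@point_eq _ (strip1 y) q (strip2 y)) ?eqxx ?orbT // ?e1 ?e2 ?xq ?yq;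
    lia.
- by rewrite (@point_eq _ (strip1 y) q (strip3 y)) ?eqxx ?orbT // ?e3 ?e4 ?xq ?yq;
    lia.
Qed.

Lemma strip_local y : local_cx 1 2 (strip_tri y).
Proof.
have [e1 e2] := sdiff_zl; have s1 := cshift1E y.
have s2 : sdiff N (cshift y 1) y = -1 by rewrite sdiffN // s1; lia.
have sxx (a : 'I_N) : sdiff N a a = 0 by exact: sdiffxx.
have s00 := sdiffxx z0_lt; have sll := sdiffxx zl_lt.
apply/local_cxP; exists (dx (strip1 y)), (dy (strip1 y)) => p q.
rewrite !inE => /orP[/orP[]|] /eqP -> /orP[/orP[]|] /eqP ->;
  by rewrite /local_pair /dx /dy /= ?e1 ?e2 ?s1 ?s2 ?sxx ?s00 ?sll;
     split; lia.
Qed.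

Lemma path_no_strip j y t : path_link j t -> ~~ (strip_tri y \subset t).
Proof.
move=> /path_linkP[l _]; rewrite !finset.subUset !finset.sub1set.
apply/negP => /andP[/andP[/l/eqP t1 /l/eqP t2] _].
have := cshift1E y; have [e _] := sdiff_zl.
move: t1; rewrite -t2 /oth /strip1 /strip2; case: j.1.1 => /= h.
  by rewrite -h sdiffxx in e.
by rewrite -h sdiffxx.
Qed.

Lemma facet_row_sub j (s : {set T + J}) : kept_row j ->
  (facet j \subset s) = (strip_tri j.2 \subset inl @^-1: s).
Proof.
move=> rj; rewrite /facet /facet1 /facet2 /facet3 rj.
by rewrite !finset.subUset !finset.sub1set !inE.
Qed.

Lemma facet_fan_sub j (s : {set T + J}) : ~~ kept_row j ->
  (facet j \subset s) = [&& j \in inr @^-1: s,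
    pt j.1.1 zl j.2 \in inl @^-1: s & pt j.1.1 z0 j.2 \in inl @^-1: s].
Proof.
move=> /negbTE rj; rewrite /facet /facet1 /facet2 /facet3 rj.
by rewrite !finset.subUset !finset.sub1set !inE andbA.
Qed.

Lemma facet_preim_row j : kept_row j ->
  inl @^-1: facet j = strip_tri j.2 /\ inr @^-1: facet j = finset.set0.
Proof.
move=> rj; rewrite /facet /facet1 /facet2 /facet3 rj.
by split; apply/setP => x; rewrite !inE.
Qed.

Lemma facet_preim_fan j : ~~ kept_row j ->
  inl @^-1: facet j = [set pt j.1.1 zl j.2; pt j.1.1 z0 j.2]%SET /\
  inr @^-1: facet j = [set j]%SET.
Proof.
move=> /negbTE rj; rewrite /facet /facet1 /facet2 /facet3 rj.
split; apply/setP => x; rewrite !inE ?orbF //.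
Qed.

Lemma sum_set_ext (s s' : {set T + J}) : inl @^-1: s = inl @^-1: s' ->
  inr @^-1: s = inr @^-1: s' -> s = s'.
Proof.
by move=> /setP l /setP r; apply/setP => -[x|x];
  [have := l x|have := r x]; rewrite !inE.
Qed.

Lemma grid_facet j : grid_cx (facet j).
Proof.
rewrite /grid_cx; have [rj|rj] := boolP (kept_row j).
  by have [e1 e2] := facet_preim_row rj; rewrite coned_base // e1 strip_local.
have [e1 e2] := facet_preim_fan rj; rewrite (coned_apex _ _ e2) e1.
apply/path_linkP; split=> [p|p q]; rewrite !inE.
  by case/orP => /eqP ->; rewrite /on_line oth_pt.
have [d1 d2] := sdiff_zl.
by case/orP => /eqP -> /orP[] /eqP ->; rewrite /pos !crd_pt ?sdiffxx // ?d1 ?d2.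
Qed.

Lemma facet_max j (s : {set T + J}) : grid_cx s -> facet j \subset s -> s = facet j.
Proof.
have [rj|rj] := boolP (kept_row j).
  rewrite facet_row_sub //; have [e1 e2] := facet_preim_row rj.
  apply: coned_ind => [s0 Ls|i si /path_no_strip Qs js]; last first.
    by have := Qs j.2; rewrite js.
  by move=> /(strip_max Ls) st; apply: sum_set_ext; rewrite ?e1 ?e2.
rewrite facet_fan_sub //; have [e1 e2] := facet_preim_fan rj.
apply: coned_ind => [s0 Ls|i si Qs]; first by rewrite s0 inE.
rewrite si inE => /and3P[/eqP ji zls z0s]; subst i.
apply: sum_set_ext; rewrite ?e1 ?e2 //; apply/eqP.
rewrite finset.eqEsubset andbC finset.subUset !finset.sub1set zls z0s /=.
have /path_linkP[l h] := Qs.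
apply/fintype.subsetP => q qs; rewrite !inE.
have hl := h _ _ zls qs; have h0 := h _ _ z0s qs.
rewrite /pos !crd_pt /= in hl h0.
have qN := ltn_ord (crd j.1.1 q).
have : crd j.1.1 q = 0%N :> nat \/ crd j.1.1 q = N.-1 :> nat.
  have [_ _ hl'] := sdiffE zl_lt qN; have [_ _ h0'] := sdiffE z0_lt qN.
  move: hl h0 hl' h0' qN; rewrite /= -!/(nat_of_ord _).
  move: (nat_of_ord (crd _ _)) (sdiff _ N.-1 _) (sdiff _ 0 _).
  clear -N_gt4 => c u v ? ? [] ? [] ? ?; lia.
have oq := l q qs; case=> qE; apply/orP; [right|left]; apply/eqP.
  apply: (@crd_oth_inj _ j.1.1); first by rewrite crd_pt qE.
  by rewrite oth_pt; exact: congr1 (eqP oq).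
apply: (@crd_oth_inj _ j.1.1); first by rewrite crd_pt qE.
by rewrite oth_pt; exact: congr1 (eqP oq).
Qed.

Lemma facet_inj : injective facet.
Proof.
move=> j j' jj'.
have [rj|rj] := boolP (kept_row j); have [rj'|rj'] := boolP (kept_row j').
- have [e1 _] := facet_preim_row rj; have [e1' _] := facet_preim_row rj'.
  rewrite jj' in e1.
  have st : strip_tri j.2 = strip_tri j'.2 by rewrite -e1 -e1'.
  have zlz : (z0 == zl) = false.
    by apply/negbTE/eqP => /(congr1 val) /=; lia.
  have mem u : (z0, u) \in strip_tri j'.2 -> u = j'.2 \/ u = cshift j'.2 1.
    rewrite !inE /strip1 /strip2 /strip3 !xpair_eqE zlz eqxx /= orbF.
    by case/orP => /eqP; [left|right].
  have m1 : strip1 j.2 \in strip_tri j'.2 by rewrite -st !inE eqxx.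
  have m3 : strip3 j.2 \in strip_tri j'.2 by rewrite -st !inE eqxx orbT.
  have yy : j.2 = j'.2.
    case: (mem _ m1) => // y1; rewrite y1 in m3.
    have s1 := cshift1E j'.2; have s2 := cshift1E (cshift j'.2 1).
    case: (mem _ m3) => e; rewrite e in s2.
      by rewrite sdiffN ?s1 // in s2; lia.
    by rewrite sdiffxx in s2.
  case: j j' rj rj' yy {jj' e1 e1' st m1 m3 mem} => [[d a] y] [[d' a'] y'] /=.
  move=> /andP[/negbTE /= -> /eqP /= a0] /andP[/negbTE /= -> /eqP /= a'0] ->.
  by congr (_, _, _); apply: val_inj; rewrite /= a0 a'0.
- have [_ e2] := facet_preim_row rj; have [_ e2'] := facet_preim_fan rj'.
  by move: e2; rewrite jj' e2' => /setP/(_ j'); rewrite !inE eqxx.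
- have [_ e2] := facet_preim_fan rj; have [_ e2'] := facet_preim_row rj'.
  by move: e2'; rewrite -jj' e2 => /setP/(_ j); rewrite !inE eqxx.
- have [_ e2] := facet_preim_fan rj; have [_ e2'] := facet_preim_fan rj'.
  by move: e2; rewrite jj' e2' => /setP/(_ j); rewrite !inE eqxx => /eqP.
Qed.

Lemma facet_distinct j : [/\ facet1 j != facet2 j, facet2 j != facet3 j &
  facet1 j != facet3 j].
Proof.
have zlz : z0 <> zl by move=> /(congr1 val) /=; lia.
rewrite /facet1 /facet2 /facet3; case: (kept_row j); last first.
  split=> //; apply/eqP => -[e].
  by have := congr1 (crd j.1.1) e; rewrite !crd_pt => /esym.
have inj (p q : T) : p.1 <> q.1 -> inl p != inl q :> T + J.
  by move=> pq; apply/eqP => -[] e; apply: pq; rewrite e.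
split; [exact: inj|apply: inj => /esym; exact: zlz|].
apply/eqP => -[e]; have := cshift1E j.2; rewrite -{1}e.
by rewrite sdiffxx.
Qed.

Definition strip_free t := local_cx 1 2 t && [forall y, ~~ (strip_tri y \subset t)].

Definition fan_link j t := path_link j t && (kept_row j || (j == kept_col) ||
  ~~ ((pt j.1.1 zl j.2 \in t) && (pt j.1.1 z0 j.2 \in t))).

Definition kept_link j t := (kept_row j || (j == kept_col)) && path_link j t.

(** As the facets are maximal, deleting them is the same as deleting their stars. This acts
    separately on the grid, which loses a triangle in each strip, and on the links, where a cycle
    loses an edge. *)
Lemma grid_minus_facets (s : {set T + J}) :
  grid_cx s && [forall (j | j != kept_col), s != facet j] =
  coned strip_free fan_link s.
Proof.
have -> : grid_cx s && [forall (j | j != kept_col), s != facet j] =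
    grid_cx s && [forall (j | j != kept_col), ~~ (facet j \subset s)].
  case Ks : (grid_cx s) => //=; apply: eq_forallb => j.
  congr (_ ==> ~~ _); apply/eqP/idP => [->|]; first exact: subxx.
  exact: facet_max.
apply/andP/idP.
  move=> [Ks /forall_inP nof]; move: Ks; apply: coned_ind => [s0 Ls|j sj Qs].
    rewrite coned_base // /strip_free Ls; apply/forallP => y.
    have := nof (false, Ordinal zk_lt, y); rewrite facet_row_sub //=.
    by apply; apply/eqP.
  rewrite (coned_apex _ _ sj) /fan_link Qs /=.
  have [//|rj] := boolP (kept_row j); have [//|jc] /= := eqVneq j kept_col.
  by have := nof j jc; rewrite facet_fan_sub // sj inE eqxx.
apply: coned_ind => [s0 /andP[Ls /forallP nos]|j sj /andP[Qs Q]].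
  split; first by rewrite /grid_cx coned_base.
  apply/forall_inP => j _; have [rj|rj] := boolP (kept_row j).
    by rewrite facet_row_sub.
  by rewrite facet_fan_sub // s0 inE.
split; first by rewrite /grid_cx (coned_apex _ _ sj).
apply/forall_inP => i ic; have [ri|ri] := boolP (kept_row i).
  by rewrite facet_row_sub //; exact: path_no_strip Qs.
rewrite facet_fan_sub // sj inE; case: eqVneq => //= ij; subst i.
by move: Q; rewrite (negbTE ri) (negbTE ic).
Qed.

Lemma pos_pt j c : pos j (pt j.1.1 c j.2) = c.
Proof. by rewrite /pos crd_pt. Qed.

Lemma on_line_pt j c : on_line j (pt j.1.1 c j.2).
Proof. by rewrite /on_line oth_pt. Qed.

Lemma on_line_inj j p q : on_line j p -> on_line j q -> pos j p = pos j q -> p = q.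
Proof.
move=> /eqP pl /eqP ql pq; apply: (@crd_oth_inj _ j.1.1) => //.
by rewrite pl ql.
Qed.

(** Without the edge from [N - 1] to 0 the line is a path, which is pulled in from its far end. The
    last point goes together with the empty simplex, so the cone vertex will disappear as well. *)
Lemma collapses_fan j : ~~ kept_row j -> j != kept_col ->
  collapses (fan_link j) (fun=> false).
Proof.
move=> rj jc.
have fanE t : fan_link j t =
    path_link j t && ~~ ((pt j.1.1 zl j.2 \in t) && (pt j.1.1 z0 j.2 \in t)).
  by rewrite /fan_link (negbTE rj) (negbTE jc).
pose C p := on_line j p && (pos j p != 0%N).
have pred_lt p : ((pos j p).-1 < N)%N.
  by apply: leq_ltn_trans (leq_pred _) _; exact: ltn_ord.
pose apex p := pt j.1.1 (Ordinal (pred_lt p)) j.2.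
pose K' t := fan_link j t && [forall (p | C p), ~~ ([set p]%SET \subset t)].
have posN p : (pos j p < N)%N by exact: ltn_ord.
apply: (@collapses_trans _ _ K').
  apply: (@collapses_family _ _ C (fun p => [set p]%SET) apex
    (fun p => N - pos j p)%N).
  - move=> p /andP[pl p0]; rewrite finset.in_set1; apply/eqP => e.
    by have := pos_pt j (Ordinal (pred_lt p)); rewrite -/(apex p) e /=; lia.
  - move=> p s /andP[pl p0]; rewrite fanE => /andP[/path_linkP[l h] nb].
    rewrite finset.sub1set => ps pmin.
    have apos : pos j (apex p) = (pos j p).-1 by exact: pos_pt.
    have near q : q \in s -> pos j q = pos j p \/ pos j q = (pos j p).-1.
      move=> qs; have := h p q ps qs.
      have qp : (pos j q <= pos j p)%N.
        rewrite leqNgt; apply/negP => pq.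
        have := pmin q; rewrite /C (l q qs) finset.sub1set qs /=.
        have -> : pos j q != 0%N by rewrite -lt0n; apply: leq_ltn_trans pq.
        by move=> /(_ isT isT); have := posN q; have := posN p; lia.
      (* The only neighbour of [p] that could wrap round is excluded by the missing edge. *)
      have nz : ~ (pos j p = N.-1 /\ pos j q = 0%N).
        move=> [pE qE]; move/negP: nb; apply.
        rewrite (@on_line_inj j (pt j.1.1 zl j.2) p) ?on_line_pt ?pos_pt ?pE ?l //.
        by rewrite ps (@on_line_inj j (pt j.1.1 z0 j.2) q) ?on_line_pt ?pos_pt ?qE ?l.
      have [_ _ e] := sdiffE (posN p) (posN q); move: e qp nz (posN p) (posN q) p0.
      move: (pos j p) (pos j q) (sdiff _ _ _); clear -N_gt4 => a b u e.
      move=> *; case: e => ?; lia.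
    have near' q : q \in apex p |: s -> on_line j q /\
        (pos j q = pos j p \/ pos j q = (pos j p).-1).
      rewrite finset.in_setU1 => /predU1P[->|qs]; last by split; [exact: l|exact: near].
      by split; [exact: on_line_pt|right].
    split; last first.
      move=> q /andP[ql q0]; rewrite !finset.sub1set finset.in_setU1.
      move=> /predU1P[qE|qs]; [right|by left].
      rewrite qE apos; rewrite qE apos in q0; have := posN p.
      by move: q0 p0; clear; lia.
    rewrite fanE; apply/andP; split.
      apply/path_linkP; split=> [q /near'[]//|q q' /near'[_ qE] /near'[_ q'E]].
      have [l1 u1 e] := sdiffE (posN q) (posN q').
      move: e l1 u1 qE q'E (posN p) p0; move: (pos j p) (pos j q) (pos j q') (sdiff _ _ _).
      by clear -N_gt4 => a b c u [] ? ? ? [] ? [] ? ? ?; lia.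
    apply/negP => /andP[/near'[_ e1] /near'[_ e2]]; rewrite !pos_pt /= in e1 e2.
    by move: e1 e2 p0; clear -N_gt4; lia.
  - by [].
have -> : (fun=> false) = star_removed K' finset.set0.
  by apply/funext => t; rewrite /star_removed finset.sub0set andbF.
apply: (@collapses1 _ _ _ (pt j.1.1 z0 j.2)); first by rewrite inE.
move=> s /andP[]; rewrite fanE => /andP[/path_linkP[l h] _] /forall_inP nC _.
have all0 q : q \in pt j.1.1 z0 j.2 |: s -> on_line j q /\ pos j q = 0%N.
  rewrite finset.in_setU1 => /predU1P[->|qs]; first by rewrite on_line_pt pos_pt.
  split; first exact: l.
  apply/eqP/negPn/negP => q0; have := nC q.
  by rewrite /C (l q qs) q0 finset.sub1set qs => /(_ isT).
rewrite /K' fanE; apply/andP; split; first apply/andP; first split.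
- apply/path_linkP; split=> [q /all0[]//|q q' /all0[_ ->] /all0[_ ->]].
  by rewrite sdiffxx.
- by apply/negP => /andP[/all0[_]]; rewrite pos_pt /=; lia.
- apply/forall_inP => p /andP[_ p0]; rewrite finset.sub1set.
  by apply: contra p0 => /all0[_ ->].
Qed.

(** The edges between neighbouring rows, except the vertical ones on column 0, which stay for the
    cone kept there. *)
Definition strip_core (x : bool * T * T) := let: (vert, p, q) := x in
  [&& dx p q == (if vert then 0 else -1), dy p q == 1 & ~~ vert || (p.1 != 0%N :> nat)].

Definition lines t := strip_free t &&
  [forall (x | strip_core x), ~~ ([set x.1.2; x.2]%SET \subset t)].

(** The number of steps from column 0 to [p] in the direction of decreasing x, which is the
    direction of the peeling. *)
Definition strip_height p : nat := if p.1 == 0%N :> nat then 0 else (N - p.1)%N.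

Lemma strip_height_pred p q : dx p q = -1 -> q.1 != 0%N :> nat ->
  strip_height q = (strip_height p).+1.
Proof.
rewrite /dx /strip_height => pq q0; have pN := ltn_ord p.1; have qN := ltn_ord q.1.
have [_ _ e] := sdiffE pN qN; move: pq q0 pN qN e.
move: (nat_of_ord p.1) (nat_of_ord q.1) (sdiff _ _ _); clear -N_gt4.
move=> a b u -> b0 aN bN e; rewrite (negbTE b0).
by case: eqVneq => a0; case: e => ?; lia.
Qed.

(* Each strip between two consecutive rows is peeled off from the removed
   triangle on, alternating between its diagonal and vertical edges. *)
Lemma collapses_strips : collapses strip_free lines.
Proof.
pose core (x : bool * T * T) : {set T} := [set x.1.2; x.2]%SET.
pose apex (x : bool * T * T) : T :=
  cshift2 x.1.2 (-1) (if x.1.1 then 1 else 0).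
pose rk (x : bool * T * T) : nat :=
  if x.1.1 then (2 * strip_height x.1.2).-1 else (2 * strip_height x.1.2)%N.
have dxa x : dx x.1.2 (apex x) = -1 by apply: dx_cshift2; lia.
have dya x : dy x.1.2 (apex x) = if x.1.1 then 1 else 0.
  by apply: dy_cshift2; case: x.1.1; lia.
apply: (@collapses_family _ _ strip_core core apex rk) => //.
- move=> x; rewrite /strip_core; case: x => [[vert p] q] /and3P[/eqP ex /eqP ey _].
  have := dxa (vert, p, q); have := dya (vert, p, q) => /= ya xa.
  rewrite /core !inE negb_or /=; apply/andP; split; apply/eqP => e.
    by rewrite e /dx sdiffxx in xa.
  by move: ya xa; rewrite e ex ey; case: (vert).
- case=> [[vert p] q] s /and3P[/eqP ex /eqP ey ev] /andP[Ls /forallP nos].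
  rewrite /core /= finset.subUset !finset.sub1set => /andP[ps qs] rkmin.
  have [X [Y [X0 Y0 XY]]] := local_cx_coord Ls ps.
  have [qx qy _] := XY p q ps qs.
  (* Besides the ends of the edge, only the third vertices of the two triangles of the torus that
     contain it can occur. *)
  have rel r : r \in s -> [\/ X r = 0 /\ Y r = 0, X r = X q /\ Y r = Y q |
      X r = (if vert then -1 else 0 : int) /\ Y r = 1] \/
      X r = (if vert then 1 else -1 : int) /\ Y r = 0.
    move=> rs; have [e1 e2 b1] := XY p r ps rs; have [e3 e4 b2] := XY q r qs rs.
    move: b1 b2; rewrite /local_pair e1 e2 e3 e4.
    rewrite X0 Y0 in qx qy *; rewrite ex in qx; rewrite ey in qy.
    move: qx qy; move: (X q) (Y q) (X r) (Y r).
    clear; case: vert => a b c d ? ?; subst => ? ?.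
      have [?|?] := eqVneq c 0; have [?|?] := eqVneq d 0.
      - by left; constructor 1.
      - by left; constructor 2; lia.
      - by right; lia.
      - by left; constructor 3; lia.
    have [?|?] := eqVneq c 0; have [?|?] := eqVneq d 0.
    - by left; constructor 1.
    - by left; constructor 3; lia.
    - by right; lia.
    - by left; constructor 2; lia.
  have ptE (r r' : T) : r \in s -> X r = dx p r' -> Y r = dy p r' -> r = r'.
    move=> rs h1 h2; have [e1 e2 _] := XY p r ps rs.
    by apply: (@point_eq _ p); rewrite ?e1 ?e2 ?X0 ?Y0 ?subr0.
  have Xq : X q = if vert then 0 else -1 by rewrite -ex qx X0 subr0.
  have Yq : Y q = 1 by rewrite -ey qy Y0 subr0.
  (* the third vertex of the already removed triangle on [p, q] is absent *)
  have rel' r : r \in s -> [\/ X r = 0 /\ Y r = 0, X r = X q /\ Y r = Y q |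
      X r = -1 /\ Y r = (if vert then 1 else 0 : int)].
    move=> rs; case: (rel r rs) => [[[? ?]|[? ?]|[xr yr]]|[xr yr]];
      [by constructor 1|by constructor 2| |].
      case: (vert) xr yr Xq ev rkmin ex ey => xr yr Xq ev rkmin ex ey.
        by constructor 3.
      (* For a diagonal edge the preceding triangle is the removed facet if [p] is on column 0;
         otherwise it has already lost its vertical edge. *)
      exfalso; have [p0|p0] := eqVneq (p.1 : nat) 0%N.
        have := nos p.2; rewrite !finset.subUset !finset.sub1set.
        have p1 : p.1 = z0 by apply: val_inj.
        have [e1 e2 e3 e4] := strip_diff p.2.
        have p_ : p = strip1 p.2 by rewrite /strip1 -p1 -surjective_pairing.
        rewrite -p_ in e1 e2 e3 e4 *.
        rewrite -(ptE q (strip2 p.2)) // ?e1 ?e2 //.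
        by rewrite -(ptE r (strip3 p.2)) // ?e3 ?e4 // ps qs rs.
      have [e1 e2 _] := XY p r ps rs.
      have := rkmin (true, p, r); rewrite /= e1 e2 X0 Y0 xr yr p0 /=.
      rewrite finset.subUset !finset.sub1set ps rs => /(_ isT isT).
      by rewrite /rk /= /strip_height (negbTE p0); have := ltn_ord p.1; lia.
    case: (vert) xr yr Xq ev rkmin ex ey => xr yr Xq ev rkmin ex ey.
      (* For a vertical edge the preceding triangle has already lost its diagonal. *)
      exfalso; have [e1 e2 _] := XY r q rs qs.
      have := rkmin (false, r, q); rewrite /= e1 e2 Xq Yq xr yr /=.
      rewrite finset.subUset !finset.sub1set qs rs => /(_ isT isT).
      have [e3 e4 _] := XY r p rs ps.
      rewrite /rk /= (@strip_height_pred r p) //; last by rewrite e3 X0 xr.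
      by move: (strip_height r); clear; lia.
    by constructor 3.
  set v := apex _; have vx : dx p v = -1 := dxa (vert, p, q).
  have vy : dy p v = if vert then 1 else 0 := dya (vert, p, q).
  have bnd r : r \in s -> [&& - 1%:Z <= X r + Y r - (dx p v + dy p v),
        X r + Y r - (dx p v + dy p v) <= 1%:Z,
        - 2%:Z <= X r - Y r - (dx p v - dy p v) &
        X r - Y r - (dx p v - dy p v) <= 2%:Z].
    move=> /rel'; rewrite vx vy Xq Yq.
    by case: (vert) => -[] [-> ->].
  have [X' [Y' [XX YY Xv Yv XY']]] :=
    local_cx_add k_gt1 NE (ltnW k_gt1) k_gt1 ps X0 Y0 XY bnd.
  have near r : r \in v |: s -> [\/ X' r = 0 /\ Y' r = 0 /\ r = p,
      [/\ X' r = X q, Y' r = 1 & r \in s] |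
      X' r = -1 /\ Y' r = (if vert then 1 else 0 : int)].
    rewrite finset.in_setU1 => /predU1P[->|rs].
      by constructor 3; rewrite Xv Yv vx vy.
    rewrite XX // YY //; case: (rel' r rs) => -[h1 h2].
    - constructor 1; split=> //; split=> //.
      by apply: ptE => //; rewrite ?h1 ?h2 /dx /dy sdiffxx.
    - by constructor 2; rewrite h2 Yq.
    - by constructor 3.
  have vmem r : r \in v |: s -> X' r != -1 \/ Y' r != (if vert then 1 else 0 : int) ->
      r \in s.
    rewrite finset.in_setU1 => /predU1P[->|//].
    by rewrite Xv Yv vx vy !eqxx => -[].
  split.
    apply/andP; split; first by apply/local_cxP; exists X', Y'.
    apply/forallP => y; apply/negP.
    rewrite !finset.subUset !finset.sub1set => /andP[/andP[t1 t2] t3].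
    have [e1 e2 e3 e4] := strip_diff y.
    have [x2 y2 _] := XY' _ _ t1 t2; have [x3 y3 _] := XY' _ _ t1 t3.
    rewrite e1 e2 in x2 y2; rewrite e3 e4 in x3 y3.
    have n1 := near _ t1; have n2 := near _ t2; have n3 := near _ t3.
    case: (vert) Xq ev n1 n2 n3 {rkmin rel rel' bnd vmem vy near} => Xq ev n1 n2 n3.
      case: n1 => [[x1 [y1 pE]]|[x1 y1 _]|[x1 y1]].
      + by move: ev; rewrite -pE.
      + by case: n3 => [[? [? _]]|[? ? _]|[? ?]]; lia.
      + by case: n3 => [[? [? _]]|[? ? _]|[? ?]]; lia.
    case: n1 => [[x1 [y1 pE]]|[x1 y1 _]|[x1 y1]].
    + by case: n3 => [[? [? _]]|[? ? _]|[? ?]]; lia.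
    + by case: n3 => [[? [? _]]|[? ? _]|[? ?]]; lia.
    + by case: n2 => [[? [? _]]|[? ? _]|[? ?]]; lia.
  case=> [[vert' p'] q'] /and3P[/eqP ex' /eqP ey' ev'] /=.
  rewrite !finset.subUset !finset.sub1set => /andP[p's q's].
  have [x2 y2 _] := XY' _ _ p's q's.
  have np := near _ p's; have nq := near _ q's.
  rewrite /rk /=; rewrite ex' in x2; rewrite ey' in y2.
  (* A new core is the next edge of the strip: the diagonal from [p] after a vertical edge, the
     vertical edge at the apex after a diagonal. *)
  case: (vert) (vert') Xq ev np nq x2 ev' vx vy Yv vmem => -[] Xq ev np nq x2 ev' vx vy Yv vmem
    {rkmin rel rel' bnd near}.
  + left; apply/andP; split; apply: vmem => //.
      by case: np => [[? [? _]]|[? ? _]|[? ?]]; case: nq => [[? [? _]]|[? ? _]|[? ?]]; lia.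
    by case: np => [[? [? _]]|[? ? _]|[? ?]]; case: nq => [[? [? _]]|[? ? _]|[? ?]]; lia.
  + right; suff -> : p' = p.
      have : (0 < strip_height p)%N.
        by rewrite /strip_height; move: ev => /= /negbTE -> /=; rewrite subn_gt0.
      by rewrite /=; move: (strip_height p); clear; lia.
    case: np => [[? [? //]]|[? ? _]|[? ?]];
      by case: nq => [[? [? _]]|[? ? _]|[? ?]]; lia.
  + have [pv|pv] := eqVneq p' v; last first.
      left; move: p's q's; rewrite !finset.in_setU1 (negbTE pv) /= => p's.
      rewrite p's => /predU1P[q'v|//]; move: nq; rewrite q'v Xv Yv vx vy => nq.
      rewrite q'v Xv Yv vx vy in x2 y2.
      by case: np => [[? [? _]]|[? ? _]|[? ?]]; lia.
    right; rewrite pv (@strip_height_pred p v) //; last by rewrite -pv.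
    by rewrite /=; move: (strip_height p); clear; lia.
  + left; apply/andP; split; apply: vmem => //.
      by case: np => [[? [? _]]|[? ? _]|[? ?]]; case: nq => [[? [? _]]|[? ? _]|[? ?]]; lia.
    by case: np => [[? [? _]]|[? ? _]|[? ?]]; case: nq => [[? [? _]]|[? ? _]|[? ?]]; lia.
Qed.

Lemma kept_link_lines j t : kept_link j t -> lines t.
Proof.
move=> /andP[jk Pt]; have /path_linkP[l _] := Pt.
apply/andP; split; first apply/andP; first split.
- exact: path_link_local Pt.
- by apply/forallP => y; exact: path_no_strip Pt.
apply/forall_inP => -[[vert p] q] /and3P[/eqP ex /eqP ey ev] /=.
rewrite finset.subUset !finset.sub1set; apply/negP => /andP[/l/eqP pl /l/eqP ql].
case/orP: jk => [/andP[/negbTE d _]|/eqP jE].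
  by rewrite /oth d in pl ql; rewrite /dy pl ql sdiffxx in ey.
rewrite jE /oth /= in pl ql; rewrite /dx pl ql sdiffxx // in ex.
by case: (vert) ex ev => //=; rewrite pl.
Qed.

Let row y : J := (false, Ordinal zk_lt, y).

Let kept_rowE j : kept_row j -> j = row j.2.
Proof.
case: j => [[d a] y] /andP[/negbTE /= -> /eqP /= a0]; congr (_, _, _).
exact: val_inj.
Qed.

Let row_kept y : kept_row (row y). Proof. by rewrite /kept_row /=. Qed.

(** A point off column 0 is dominated by the cone vertex of its row. Afterwards the link of each
    such cone vertex is reduced to a point of column 0, so it goes too, and what remains is column 0
    with its cone. *)
Lemma collapses_lines : collapses (coned lines kept_link) (fun=> false).
Proof.
pose C (x : T + 'I_N) := if x is inl p then p.1 != 0%N :> nat else true.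
pose core (x : T + 'I_N) : {set T + J} := match x with
  | inl p => [set inl p]%SET | inr y => [set inr (row y)]%SET end.
pose apex (x : T + 'I_N) : T + J := match x with
  | inl p => inr (row p.2) | inr y => inl (z0, y) end.
pose rk (x : T + 'I_N) : nat := if x is inl _ then 0%N else 1%N.
pose K' (s : {set T + J}) := coned lines kept_link s &&
  [forall (x | C x), ~~ (core x \subset s)].
apply: (@collapses_trans _ _ K').
  apply: (@collapses_family _ _ C core apex rk) => //.
  - by move=> [p|y] _; rewrite /core /apex finset.in_set1.
  - move=> [p|y] s Cx Ks; rewrite /core finset.sub1set => xs xmin.
      split; last first.
        case=> [q|y] /= Cq qs; [left|by right].
        by move: qs; rewrite !finset.sub1set finset.in_setU1.
      rewrite /apex; move: Ks; apply: coned_ind => [s0 Ls|i si /andP[ik Pi]].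
        rewrite (@coned_apex _ _ _ _ _ (row p.2)); last first.
          by rewrite preim_inr_setU1r s0 finset.setU0.
        rewrite preim_inl_setU1r /kept_link row_kept /=.
        have /andP[/andP[Lc _] /forall_inP nC] := Ls.
        have pt : p \in inl @^-1: s by rewrite inE.
        have [X [Y [X0 Y0 XY]]] := local_cx_coord Lc pt.
        have nCe v a b : a \in inl @^-1: s -> b \in inl @^-1: s ->
            ~~ strip_core (v, a, b).
          move=> at_ bt; apply/negP => Cab; have := nC (v, a, b) Cab.
          by rewrite finset.subUset !finset.sub1set at_ bt.
        have dy0 q : q \in inl @^-1: s -> dy p q = 0.
          move=> qt; have [e1 e2 b] := XY p q pt qt; have [f1 f2 _] := XY q p qt pt.
          have n1 := nCe false p q pt qt; have n2 := nCe false q p qt pt.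
          have n3 := nCe true p q pt qt; have n4 := nCe true q p qt pt.
          rewrite X0 Y0 subr0 sub0r in e1 e2 f1 f2.
          have q1 : dx p q = 0 -> q.1 = p.1 :> nat.
            by move=> h; apply/esym; exact: sdiff_eq0 h.
          have p0 : p.1 != 0%N :> nat by exact: Cx.
          move: n1 n2 n3 n4 b q1; rewrite /strip_core /local_pair e1 e2 f1 f2 p0 /=.
          move: (X q) (Y q) (nat_of_ord q.1) => u v c.
          have [->|v0] := eqVneq v 0; first by [].
          have [u0|u0] := eqVneq u 0.
            move=> n1 n2 n3 n4 b /(_ u0) q1; move: n1 n2 n3 n4 b.
            by rewrite u0 q1 p0; clear; lia.
          by move=> n1 n2 n3 n4 b _; move: n1 n2 n3 n4 b v0 u0; clear; lia.
        have q2 q : q \in inl @^-1: s -> q.2 = p.2.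
          by move=> /dy0 h; apply/esym/val_inj; exact: sdiff_eq0 h.
        apply/path_linkP; split=> [q /q2 qp|q q' qt q't].
          by rewrite /on_line /oth /= qp.
        rewrite /pos /crd /=; have [_ _] := XY q q' qt q't.
        rewrite /local_pair /dy (q2 q qt) (q2 q' q't) sdiffxx // /dx.
        by move: (sdiff _ _ _); clear; lia.
      suff -> : inr (row p.2) |: s = s.
        by rewrite (coned_apex _ _ si) /kept_link ik Pi.
      apply/finset.setUidPr; rewrite finset.sub1set.
      have /path_linkP[l _] := Pi.
      have pl : on_line i p by apply: l; rewrite inE.
      have : i \in inr @^-1: s by rewrite si finset.set11.
      rewrite inE; case/orP: ik => [ik|/eqP iE].
        rewrite (kept_rowE ik); move: pl; rewrite /on_line /oth.
        by have /andP[/negbTE -> _] := ik => /eqP ->.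
      by move: pl Cx; rewrite iE /on_line /oth /= => /eqP ->.
    have cs : inr @^-1: s = [set row y]%SET.
      move: Ks; apply: coned_ind => [s0|i si] _.
        by have : row y \in inr @^-1: s; [rewrite inE|rewrite s0 inE].
      have : row y \in inr @^-1: s by rewrite inE.
      by rewrite si inE => /eqP ->.
    have s0 q : q \in inl @^-1: s -> q.1 = z0.
      rewrite inE => qs; apply/val_inj/eqP/negPn/negP => q0.
      by have := xmin (inl q) q0; rewrite /= finset.sub1set qs => /(_ isT).
    split; last first.
      case=> [q|y'] /= Cq qs; left; move: qs; last first.
        by rewrite !finset.sub1set finset.in_setU1.
      rewrite !finset.sub1set finset.in_setU1 => /orP[/eqP [qE]|//].
      by rewrite qE in Cq.
    rewrite /apex (@coned_apex _ _ _ _ _ (row y)) ?preim_inr_setU1l // preim_inl_setU1l.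
    move: Ks; rewrite (coned_apex _ _ cs) => /andP[_ /path_linkP[l h]].
    have all0 q : q \in (z0, y) |: inl @^-1: s -> q = (z0, y).
      rewrite finset.in_setU1 => /predU1P[//|qs]; have := l q qs.
      rewrite /on_line /oth /= => /eqP q2.
      by rewrite (surjective_pairing q) q2 (s0 q qs).
    rewrite /kept_link row_kept; apply/path_linkP.
    split=> [q /all0 -> |q q' /all0 -> /all0 ->].
      by rewrite /on_line /oth.
    by rewrite sdiffxx.
have -> : (fun=> false) = star_removed K' finset.set0.
  by apply/funext => s; rewrite /star_removed finset.sub0set andbF.
apply: (@collapses1 _ _ _ (inr kept_col)); first by rewrite inE.
move=> s /andP[Ks /forall_inP nC] _.
have norow y : inr (row y) \notin s.
  by have := nC (inr y) isT; rewrite /= finset.sub1set.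
have s0 q : q \in inl @^-1: s -> q.1 = z0.
  rewrite inE => qs; apply/val_inj/eqP/negPn/negP => q0.
  by have := nC (inl q) q0; rewrite /= finset.sub1set qs.
apply/andP; split; last first.
  apply/forall_inP => -[q|y] Cq; rewrite /= finset.sub1set finset.in_setU1 /=.
    by apply/negP => qs; have := nC (inl q) Cq; rewrite /= finset.sub1set qs.
  exact: norow.
move: Ks; apply: coned_ind => [c0 /andP[/andP[Lc _] _]|i si /[dup] Ki /andP[ik _]].
  rewrite (@coned_apex _ _ _ _ _ kept_col); last first.
    by rewrite preim_inr_setU1r c0 finset.setU0.
  rewrite preim_inl_setU1r /kept_link eqxx orbT; apply/path_linkP.
  have /local_cxP[X [Y XY]] := Lc.
  split=> [q /s0 q0|q q' qs q's]; first by rewrite /on_line /oth /= q0.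
  rewrite /pos /crd /=; have [_ _] := XY q q' qs q's.
  rewrite /local_pair /dx (s0 q qs) (s0 q' q's) sdiffxx // /dy.
  by move: (sdiff _ _ _); clear; lia.
have ii : i \in inr @^-1: s by rewrite si finset.set11.
case/orP: ik => [ik|/eqP iE].
  by have := norow i.2; rewrite -kept_rowE //; rewrite inE in ii; rewrite ii.
suff -> : inr kept_col |: s = s by rewrite (coned_apex _ _ si).
by apply/finset.setUidPr; rewrite finset.sub1set -iE; rewrite inE in ii.
Qed.

Lemma collapses_grid_minus :
  collapses (coned strip_free fan_link) (fun=> false).
Proof.
apply: (@collapses_trans _ _ (coned strip_free kept_link)).
  apply: collapses_coned_link => j.
  have [kj|] := boolP (kept_row j || (j == kept_col)).
    suff -> : kept_link j = fan_link j by exact: collapses_refl.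
    by apply/funext => t; rewrite /kept_link /fan_link kj /= andbT.
  rewrite negb_or => /andP[kj jc].
  have -> : kept_link j = fun=> false.
    by apply/funext => t; rewrite /kept_link (negbTE kj) (negbTE jc).
  exact: collapses_fan.
apply: collapses_trans collapses_lines.
apply: collapses_coned_base; first exact: collapses_strips.
exact: kept_link_lines.
Qed.

Lemma grid_down : down_closed grid_cx.
Proof.
apply: coned_down => [|j|j t].
- exact: local_cx_down.
- exact: path_link_down.
- exact: path_link_local.
Qed.

End facets.

Local Open Scope classical_set_scope.
Local Open Scope ring_scope.

(** * Homotopy equivalences *)

Lemma within_continuous_comp_sub (X Y Z : topologicalType) (A : set X)
    (B : set Y) (f : X -> Y) (g : Y -> Z) :
  {within A, continuous f} -> f @` A `<=` B -> {within B, continuous g} ->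
  {within A, continuous (g \o f)}.
Proof.
move=> /subspace_continuousP cf fAB /subspace_continuousP cg.
apply/subspace_continuousP => x Ax.
apply: (@cvg_comp _ _ _ f g _ (within B (nbhs (f x)))); last first.
  by apply: cg; apply: fAB; exists x.
move=> U BU; have := cf x Ax _ BU.
rewrite /nbhs /= /within /=; apply: filterS => y.
by move=> Uy Ay; apply: Uy => //; apply: fAB; exists y.
Qed.

Lemma within_continuous_pair (X Y Z : topologicalType) (A : set X)
    (f : X -> Y) (g : X -> Z) :
  {within A, continuous f} -> {within A, continuous g} ->
  {within A, continuous (fun x => (f x, g x))}.
Proof.
move=> /subspace_continuousP cf /subspace_continuousP cg.
by apply/subspace_continuousP => x Ax; apply: cvg_pair; [exact: cf|exact: cg].
Qed.

Lemma continuous_pair (X Y Z : topologicalType) (f : X -> Y) (g : X -> Z) :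
  continuous f -> continuous g -> continuous (fun x => (f x, g x)).
Proof. by move=> cf cg x; apply: cvg_pair; [exact: cf|exact: cg]. Qed.

(** A continuous map from a compact set to a Hausdorff space is closed, so a closed preimage under
    [F] has a closed image, and [g] inherits continuity from [F]. *)
Lemma quotient_within_continuous (X Y Z : topologicalType) (A : set X)
    (q : X -> Y) (F : X -> Z) (g : Y -> Z) :
  compact A -> hausdorff_space Y ->
  {within A, continuous q} -> {within A, continuous F} ->
  {in A, forall x, g (q x) = F x} ->
  {within q @` A, continuous g}.
Proof.
move=> cA hY cq cF gqF; apply/continuous_closedP => W cW.
move/continuous_closedP/(_ _ cW)/closed_subspaceP : cF => [V cV VW].
apply/closed_subspaceP; exists (q @` (A `&` V)).
  apply: compact_closed => //; apply: continuous_compact.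
    by apply: continuous_subspaceW cq => x [].
  exact: compact_closedI.
rewrite eqEsubset; split=> y.
  move=> [[x [Ax Vx] <-] _]; split; last by exists x.
  change (W (g (q x))); rewrite gqF ?inE //.
  suff : (V `&` A) x by rewrite VW => -[].
  by split.
move=> [Wy [x Ax qxy]]; split; last by exists x.
exists x => //; split=> //.
have : (V `&` A) x.
  by rewrite VW; split=> //; change (W (F x)); rewrite -gqF ?inE// qxy.
by case.
Qed.

Lemma continuous_rV (R : realType) (T : topologicalType) (n : nat)
    (f : T -> 'rV[R]_n) :
  (forall i, continuous (fun x => f x ord0 i)) -> continuous f.
Proof.
move=> cf x A [P xP PA].
have : \forall y \near x, forall i, P ord0 i (f y ord0 i).
  by apply: filter_forall => i; exact: cf (xP ord0 i).
by apply: filterS => y fyP; apply: PA => i j; rewrite ord1.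
Qed.

Lemma continuous_coord (R : realType) (n : nat) (i : 'I_n) :
  continuous (fun x : 'rV[R]_n => x ord0 i).
Proof. exact: coord_continuous. Qed.

Section homotopy.
Variable R : realType.

Lemma he_sym (X Y : topologicalType) (A : set X) (B : set Y) :
  homotopy_equivalent R A B -> homotopy_equivalent R B A.
Proof. by move=> [f [g [fAB gBA H K]]]; exists g, f. Qed.

Lemma he_refl (X : topologicalType) (A : set X) : homotopy_equivalent R A A.
Proof.
have c (C : set X) : {within C, continuous (@id X)}.
  by apply: continuous_subspaceT => x.
have d (C : set (R * X)) : {within C, continuous (@snd R X)}.
  by apply: continuous_subspaceT => x; exact: cvg_snd.
exists id, id; split.
- by split=> // _ [y Ay <-].
- by split=> // _ [y Ay <-].
- by exists snd; split=> // x [[t y]] [_ /= Ay <-].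
- by exists snd; split=> // x [[t y]] [_ /= Ay <-].
Qed.

Definition homotopic_in (X Y : topologicalType) (A : set X) (B : set Y)
    (f g : X -> Y) :=
  exists H : R * X -> Y,
    [/\ {within `[0%R, 1%R] `*` A, continuous H},
        H @` (`[0%R, 1%R] `*` A) `<=` B &
        forall a, A a -> H (0, a) = f a /\ H (1, a) = g a].

Lemma homotopic_in_trans (X Y : topologicalType) (A : set X) (B : set Y)
    (f g h : X -> Y) :
  homotopic_in A B f g -> homotopic_in A B g h -> homotopic_in A B f h.
Proof.
move=> [F [cF FB Ffg]] [G [cG GB Ggh]].
(* Clamping keeps both rescaled times in the unit interval, so that each half of the concatenation
   is continuous on the whole cylinder. *)
pose a (p : R * X) := (Num.min (p.1 + p.1 : R) 1, p.2).
pose b (p : R * X) := (Num.max (p.1 + p.1 - 1 : R) 0, p.2).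
have c2 : continuous (fun p : R * X => (p.1 + p.1 : R)).
  by move=> p; apply: cvgD; exact: cvg_fst.
have ca : continuous a.
  apply: continuous_pair => p; last exact: cvg_snd.
  apply: (@continuous_min R _ (fun p : R * X => p.1 + p.1 : R^o)
    (fun=> 1 : R^o)); [exact: c2|exact: cvg_cst].
have cb : continuous b.
  apply: continuous_pair => p; last exact: cvg_snd.
  apply: (@continuous_max R _ (fun p : R * X => p.1 + p.1 - 1 : R^o)
    (fun=> 0 : R^o)); last exact: cvg_cst.
  by apply: cvgB; [exact: c2|exact: cvg_cst].
have aA : a @` (`[0%R, 1%R] `*` A) `<=` `[0%R, 1%R] `*` A.
  move=> _ [[t x] [/= t01 Ax] <-]; move: t01.
  rewrite ?in_itv /= => /andP[t0 t1].
  split=> //=; rewrite ?in_itv /= ge_min lexx orbT andbT le_min ler01 andbT.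
  by lra.
have bA : b @` (`[0%R, 1%R] `*` A) `<=` `[0%R, 1%R] `*` A.
  move=> _ [[t x] [/= t01 Ax] <-]; move: t01.
  rewrite ?in_itv /= => /andP[t0 t1].
  split=> //=; rewrite ?in_itv /= le_max lexx orbT /= ge_max ler01 andbT.
  by lra.
have cFa := within_continuous_comp_sub (continuous_subspaceT ca) aA cF.
have cGb := within_continuous_comp_sub (continuous_subspaceT cb) bA cG.
exists (fun p => if p.1 <= 2^-1 then F (a p) else G (b p)); split.
- apply/subspace_continuousP => -[t x] tA.
  move/subspace_continuousP/(_ _ tA) : cFa => cFa.
  move/subspace_continuousP/(_ _ tA) : cGb => cGb.
  have lt_near (P : pred R) : (\forall s \near nbhs t, P s) ->
    \forall p \near within (`[0%R, 1%R] `*` A) (nbhs (t, x)), P p.1.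
    move=> tP; apply: cvg_within.
    exact: (@cvg_fst _ _ (nbhs t) (nbhs x) _ P tP).
  rewrite /from_subspace /= in cFa cGb *.
  have [tlt|tgt|teq] := ltgtP t 2^-1.
  + apply: cvg_trans cFa.
    apply: near_eq_cvg.
    have := lt_near (fun s => s < 2^-1) (lt_nbhsl tlt).
    by apply: filterS => p /ltW /= ->.
  + apply: cvg_trans cGb.
    apply: near_eq_cvg.
    have := lt_near (fun s => 2^-1 < s) (lt_nbhsr tgt).
    by apply: filterS => p; rewrite ltNge => /negbTE /= ->.
  + have e : G (b (t, x)) = F (a (t, x)).
      rewrite /a /b /= teq.
      have -> : 2^-1 + 2^-1 = 1 :> R by lra.
      rewrite subrr minxx maxxx.
      by case: tA => _ /= Ax; rewrite (Ffg _ Ax).2 (Ggh _ Ax).1.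
    move=> U FU.
    have FUa := cFa _ FU; rewrite -e in FU; have FUb := cGb _ FU.
    have {}FUa : within (`[0%R, 1%R] `*` A) (nbhs (t, x)) [set p | U (F (a p))].
      exact: FUa.
    have {}FUb : within (`[0%R, 1%R] `*` A) (nbhs (t, x)) [set p | U (G (b p))].
      exact: FUb.
    suff : within (`[0%R, 1%R] `*` A) (nbhs (t, x))
      [set p | U (if p.1 <= 2^-1 then F (a p) else G (b p))] by [].
    by apply: filterS (filterI FUa FUb) => p [/= Fp Gp]; case: ifP.
- move=> _ [p pA <-]; case: ifP => _.
    by apply: FB; exists (a p) => //; apply: aA; exists p.
  by apply: GB; exists (b p) => //; apply: bA; exists p.
- move=> x Ax; rewrite /= /a /b /= addr0 invr_ge0 ler0n min_l// (Ffg _ Ax).1.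
  split=> //; rewrite ifF; last by apply/negbTE; rewrite -ltNge; lra.
  have -> : 1 + 1 - 1 = 1 :> R by rewrite addrK.
  by rewrite max_l // (Ggh _ Ax).2.
Qed.

Lemma he_trans (X Y Z : topologicalType) (A : set X) (B : set Y) (C : set Z) :
  homotopy_equivalent R A B -> homotopy_equivalent R B C ->
  homotopy_equivalent R A C.
Proof.
have aux (X1 Y1 Z1 : topologicalType) (A1 : set X1) (B1 : set Y1)
    (f1 : X1 -> Y1) (g1 : Y1 -> X1) (f2 : Y1 -> Z1) (g2 : Z1 -> Y1) :
    {within A1, continuous f1} /\ f1 @` A1 `<=` B1 ->
    {within B1, continuous g1} /\ g1 @` B1 `<=` A1 ->
    homotopic_in A1 A1 (g1 \o f1) id ->
    homotopic_in B1 B1 (g2 \o f2) id ->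
    homotopic_in A1 A1 ((g1 \o g2) \o (f2 \o f1)) id.
  move=> [cf1 f1A] [cg1 g1B] h1 [H [cH HB Hid]].
  apply: homotopic_in_trans h1.
  pose e (p : R * X1) := (p.1, f1 p.2).
  have eA : e @` (`[0%R, 1%R] `*` A1) `<=` `[0%R, 1%R] `*` B1.
    move=> _ [[t x] [/= t01 Ax] <-]; split=> //=; apply: f1A; by exists x.
  have ce : {within `[0%R, 1%R] `*` A1, continuous e}.
    apply: within_continuous_pair.
      by apply: continuous_subspaceT => p; exact: cvg_fst.
    apply: (@within_continuous_comp_sub _ _ _ _ A1 snd) => //.
      by apply: continuous_subspaceT => p; exact: cvg_snd.
    by move=> _ [p [_ ?] <-].
  exists (g1 \o (H \o e)); split.
  - apply: within_continuous_comp_sub cg1; last first.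
      move=> _ [p pA <-]; apply: HB; exists (e p) => //.
      by apply: eA; exists p.
    exact: within_continuous_comp_sub cH.
  - move=> _ [p pA <-]; apply: g1B; exists (H (e p)) => //; apply: HB.
    by exists (e p) => //; apply: eA; exists p.
  - move=> x Ax; rewrite /= /e /=.
    have Bf : B1 (f1 x) by apply: f1A; exists x.
    by rewrite (Hid _ Bf).1 (Hid _ Bf).2.
move=> [f1 [g1 [f1P g1P H1 K1]]] [f2 [g2 [f2P g2P H2 K2]]].
exists (f2 \o f1), (g1 \o g2); split.
- case: f1P f2P => [cf1 f1A] [cf2 f2B]; split.
    exact: within_continuous_comp_sub cf2.
  by move=> _ [x Ax <-]; apply: f2B; exists (f1 x) => //; apply: f1A; exists x.
- case: g1P g2P => [cg1 g1B] [cg2 g2C]; split.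
    exact: within_continuous_comp_sub cg1.
  by move=> _ [x Ax <-]; apply: g1B; exists (g2 x) => //; apply: g2C; exists x.
- exact: aux f1P g1P H1 H2.
- exact: aux g2P f2P K2 K1.
Qed.

(* The homotopy is run backwards to match the orientation in
   [homotopy_equivalent], whose homotopies end at the identity. *)
Lemma he_quotient (X Y : topologicalType) (A : set X) (q : X -> Y)
    (H : R * X -> X) :
  A !=set0 -> compact A -> hausdorff_space Y -> hausdorff_space (R * Y)%type ->
  {within A, continuous q} ->
  {within `[0%R, 1%R] `*` A, continuous H} ->
  H @` (`[0%R, 1%R] `*` A) `<=` A ->
  (forall x, A x -> H (0, x) = x) ->
  (forall x y, A x -> A y -> q x = q y -> H (1, x) = H (1, y)) ->
  (forall t x y, t \in `[0%R, 1%R] -> A x -> A y -> q x = q y ->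
    q (H (t, x)) = q (H (t, y))) ->
  homotopy_equivalent R A (q @` A).
Proof.
move=> [x0 _] cA hY hRY cq cH HA H0 H1 Ht.
(* A section for which no continuity is claimed; it only occurs in expressions that do not depend on
   the point chosen in the fibre of [q]. *)
pose s (y : Y) : X := xget x0 [set x | A x /\ q x = y].
have sP y : (q @` A) y -> A (s y) /\ q (s y) = y.
  move=> [x Ax qx].
  exact: (@xgetPex _ x0 [set z | A z /\ q z = y] (ex_intro _ x (conj Ax qx))).
have i01 : (1 : R) \in `[0%R, 1%R] by rewrite in_itv /= lexx ler01.
have i00 : (0 : R) \in `[0%R, 1%R] by rewrite in_itv /= lexx ler01.
have HAx t x : t \in `[0%R, 1%R] -> A x -> A (H (t, x)).
  by move=> t01 Ax; apply: HA; exists (t, x).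
pose r (p : R * X) := (1 - p.1, p.2).
have cr : continuous r.
  apply: continuous_pair => p; last exact: cvg_snd.
  by apply: cvgB; [exact: cvg_cst|exact: cvg_fst].
have r01 (t : R) : t \in `[0%R, 1%R] -> 1 - t \in `[0%R, 1%R].
  by rewrite !in_itv /= => /andP[? ?]; lra.
have rA : r @` (`[0%R, 1%R] `*` A) `<=` `[0%R, 1%R] `*` A.
  by move=> _ [[t x] [/= /r01 t01 Ax] <-].
have cHr := within_continuous_comp_sub (continuous_subspaceT cr) rA cH.
pose F (p : R * X) := q (H (r p)).
have cF : {within `[0%R, 1%R] `*` A, continuous F}.
  apply: (within_continuous_comp_sub cHr _ cq).
  by move=> _ [p [p1 p2] <-]; apply: HA; exists (r p) => //; apply: rA; exists p.
pose Q (p : R * X) := (p.1, q p.2).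
have cQ : {within `[0%R, 1%R] `*` A, continuous Q}.
  apply: within_continuous_pair.
    by apply: continuous_subspaceT => p; exact: cvg_fst.
  apply: (@within_continuous_comp_sub _ _ _ _ A snd) => //.
    by apply: continuous_subspaceT => p; exact: cvg_snd.
  by move=> _ [p [_ ?] <-].
have QA : Q @` (`[0%R, 1%R] `*` A) = `[0%R, 1%R] `*` (q @` A).
  rewrite eqEsubset; split.
    by move=> _ [[t x] [/= t01 Ax] <-]; split=> //=; exists x.
  by move=> [t y] [/= t01 [x Ax <-]]; exists (t, x).
exists q, (fun y => H (1, s y)); split.
- by split.
- split; last by move=> _ [y /sP[As _] <-]; exact: HAx.
  apply: (quotient_within_continuous (F := fun x => H (1, x))) => //.
    have c1 : {within A, continuous (fun x : X => (1 : R, x))}.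
      apply: continuous_subspaceT; apply: continuous_pair => x //.
      exact: cvg_cst.
    apply: (within_continuous_comp_sub c1 _ cH).
    by move=> _ [x Ax <-].
  move=> x; rewrite inE => Ax.
  have [As qs] := sP (q x) (ex_intro2 _ _ x Ax erefl); exact: H1.
- exists (H \o r); split=> //.
    move=> _ [p pA <-]; apply: HA; exists (r p) => //; apply: rA; by exists p.
  move=> x Ax; rewrite /= /r /= subr0 subrr H0//; split=> //.
  have [As qs] := sP (q x) (ex_intro2 _ _ x Ax erefl); exact: H1.
- exists (fun p => q (H (1 - p.1, s p.2))); split.
  + rewrite -QA; apply: (quotient_within_continuous (F := F)) => //.
      exact/compact_setX/cA/segment_compact.
    move=> [t x]; rewrite inE => -[/= t01 Ax].
    have [As qs] := sP (q x) (ex_intro2 _ _ x Ax erefl).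
    by apply: Ht => //; exact: r01.
  + move=> _ [[t y] [/= t01 /sP[As qs]] <-]; exists (H (1 - t, s y)) => //.
    by apply: HAx => //; exact: r01.
  + by move=> y /sP[As qs]; rewrite /= subr0 subrr H0.
Qed.

End homotopy.

(** * Geometric realizations *)

Lemma continuous_cstR (R : realType) (X : topologicalType) (c : R) :
  continuous (fun _ : X => c).
Proof. by move=> x; exact: cvg_cst. Qed.

Lemma continuous_addR (R : realType) (X : topologicalType) (f g : X -> R) :
  continuous f -> continuous g -> continuous (fun x => f x + g x).
Proof. by move=> cf cg x; apply: cvgD; [exact: cf|exact: cg]. Qed.

Lemma continuous_subR (R : realType) (X : topologicalType) (f g : X -> R) :
  continuous f -> continuous g -> continuous (fun x => f x - g x).
Proof. by move=> cf cg x; apply: cvgB; [exact: cf|exact: cg]. Qed.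

Lemma continuous_mulR (R : realType) (X : topologicalType) (f g : X -> R) :
  continuous f -> continuous g -> continuous (fun x => f x * g x).
Proof. by move=> cf cg x; apply: cvgM; [exact: cf|exact: cg]. Qed.

Lemma continuous_invR (R : realType) (X : topologicalType) (f : X -> R) :
  (forall x, f x != 0) -> continuous f -> continuous (fun x => (f x)^-1).
Proof. by move=> f0 cf x; apply: cvgV; [exact: f0|exact: cf]. Qed.

Lemma continuous_minR (R : realType) (X : topologicalType) (f g : X -> R) :
  continuous f -> continuous g -> continuous (fun x => Num.min (f x) (g x)).
Proof.
move=> cf cg x.
exact: (@continuous_min R X (f : X -> R^o) (g : X -> R^o) x (cf x) (cg x)).
Qed.

Lemma continuous_maxR (R : realType) (X : topologicalType) (f g : X -> R) :
  continuous f -> continuous g -> continuous (fun x => Num.max (f x) (g x)).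
Proof.
move=> cf cg x.
exact: (@continuous_max R X (f : X -> R^o) (g : X -> R^o) x (cf x) (cg x)).
Qed.

Lemma continuous_sumR (R : realType) (X : topologicalType) (I : Type)
    (r : seq I) (P : pred I) (f : I -> X -> R) :
  (forall i, continuous (f i)) -> continuous (fun x => \sum_(i <- r | P i) f i x).
Proof.
move=> cf; pose F r x := \sum_(i <- r | P i) f i x.
suff cF r0 : continuous (F r0) by exact: cF.
elim: r0 => [|i r0 IH].
  have -> : F [::] = fun=> 0 by apply/funext => x; rewrite /F big_nil.
  exact: continuous_cstR.
have -> : F (i :: r0) = fun x => (if P i then f i x else 0) + F r0 x.
  by apply/funext => x; rewrite /F big_cons; case: (P i); rewrite ?add0r.
apply: continuous_addR => //.
by case: (P i); [exact: cf|exact: continuous_cstR].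
Qed.

Section realization.
Variables (R : realType) (V : finType).
Implicit Types (x : 'rV[R]_#|V|) (K : {set V} -> bool) (s sigma : {set V}).

Definition bary x (v : V) : R := x ord0 (enum_rank v).

Definition point_of (F : V -> R) : 'rV[R]_#|V| := \row_i F (enum_val i).

Lemma bary_point_of F v : bary (point_of F) v = F v.
Proof. by rewrite /bary mxE enum_rankK. Qed.

Lemma bary_inj x y : bary x =1 bary y -> x = y.
Proof.
move=> xy; apply/rowP => i; have := xy (enum_val i).
by rewrite /bary enum_valK.
Qed.

Lemma sum_bary x : \sum_i x ord0 i = \sum_v bary x v.
Proof. by rewrite (reindex _ (onW_bij _ (@enum_rank_bij V))). Qed.

Lemma geomE K x : geom_realization R K x <->
  [/\ forall v, 0 <= bary x v, \sum_v bary x v = 1 &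
      exists2 s, K s & forall v, v \notin s -> bary x v = 0].
Proof.
split=> [[x0 [x1 [s [Ks xs]]]]|[x0 x1 [s Ks xs]]].
  by split=> [v||]; [exact: x0|rewrite -sum_bary|exists s].
split; first by move=> i; rewrite -(enum_valK i); exact: x0.
by rewrite sum_bary; split=> //; exists s; split.
Qed.

Lemma continuous_bary v : continuous (fun x => bary x v).
Proof. exact: continuous_coord. Qed.

Lemma continuous_point_of (X : topologicalType) (F : X -> V -> R) :
  (forall v, continuous (fun p => F p v)) ->
  continuous (fun p => point_of (F p)).
Proof.
move=> cF; apply: continuous_rV => i.
by under eq_fun do rewrite mxE; exact: cF.
Qed.

(** The default 1 is an upper bound for barycentric coordinates, so on a realization this is the
    least coordinate whenever [sigma] is nonempty. *)
Definition min_bary sigma x : R := \big[Num.min/1]_(v in sigma) bary x v.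

Lemma continuous_min_bary sigma : continuous (min_bary sigma).
Proof.
pose F r x : R := \big[Num.min/1]_(v <- r) if v \in sigma then bary x v else 1.
have cF r : continuous (F r).
  elim: r => [|v r IH].
    have -> : F [::] = fun=> 1 by apply/funext => x; rewrite /F big_nil.
    exact: continuous_cstR.
  have -> : F (v :: r) =
      fun x => Num.min (if v \in sigma then bary x v else 1) (F r x).
    by apply/funext => x; rewrite /F big_cons.
  apply: continuous_minR => //.
  by case: (v \in sigma); [exact: continuous_bary|exact: continuous_cstR].
have -> : min_bary sigma = F (index_enum V).
  by apply/funext => x; rewrite /min_bary bigmin_mkcond.
exact: cF.
Qed.

Lemma min_bary_ge0 sigma x : (forall v, 0 <= bary x v) -> 0 <= min_bary sigma x.
Proof. by move=> x0; apply/bigmin_geP; split. Qed.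

Lemma min_bary_le sigma x v : v \in sigma -> min_bary sigma x <= bary x v.
Proof. exact: bigmin_le_cond. Qed.

Lemma bary_le1 x v : (forall u, 0 <= bary x u) -> \sum_u bary x u = 1 ->
  bary x v <= 1.
Proof.
by move=> x0 <-; rewrite (bigD1 v)//= lerDl; apply: sumr_ge0.
Qed.

Lemma min_bary_attained sigma x v :
  (forall u, 0 <= bary x u) -> \sum_u bary x u = 1 -> v \in sigma ->
  exists2 w, w \in sigma & min_bary sigma x = bary x w.
Proof.
move=> x0 x1 vs; have [|w ws mw] := eq_bigmin (x := 1) v (mem sigma) (bary x) vs.
  by move=> u _; exact: bary_le1.
by exists w.
Qed.

Lemma min_bary_eq0 sigma x v : (forall u, 0 <= bary x u) -> v \in sigma ->
  bary x v = 0 -> min_bary sigma x = 0.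
Proof.
by move=> x0 vs xv; apply/le_anti; rewrite min_bary_ge0// andbT -xv min_bary_le.
Qed.

Lemma min_bary_out sigma s x : (forall u, 0 <= bary x u) ->
  (forall v, v \notin s -> bary x v = 0) -> ~~ (sigma \subset s) ->
  min_bary sigma x = 0.
Proof.
by move=> x0 xs /subsetPn[v vs vns]; apply: min_bary_eq0 vs _ => //; exact: xs.
Qed.

(* The mass that [x] carries uniformly on [sigma] is pushed to the apex [v]. *)
Definition collapse_htpy sigma (v : V) (p : R * 'rV[R]_#|V|) :=
  point_of (fun u => bary p.2 u + (1 - p.1) * (min_bary sigma p.2 *
     (#|sigma|%:R * (u == v)%:R - (u \in sigma)%:R))).

Lemma continuous_collapse_htpy sigma v : continuous (collapse_htpy sigma v).
Proof.
apply: continuous_point_of => u; apply: continuous_addR.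
  by move=> p; apply: (continuous_comp _ (@continuous_bary u p.2)); exact: cvg_snd.
apply: continuous_mulR.
  by apply: continuous_subR; [exact: continuous_cstR|move=> p; exact: cvg_fst].
apply: continuous_mulR; last exact: continuous_cstR.
move=> p; apply: (continuous_comp _ (@continuous_min_bary sigma p.2)).
exact: cvg_snd.
Qed.

Lemma he_collapse K sigma v : down_closed K -> sigma != finset.set0 ->
  v \notin sigma -> (forall s, K s -> sigma \subset s -> K (v |: s)) ->
  homotopy_equivalent R (geom_realization R K)
    (geom_realization R (star_removed K sigma)).
Proof.
move=> dK /set0Pn[w0 w0s] vs Kv.
set A := geom_realization R K; set B := geom_realization R _.
pose H := collapse_htpy sigma v.
have BA : B `<=` A.
  move=> x /geomE[x0 x1 [s /andP[Ks _] xs]]; apply/geomE; split=> //.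
  by exists s.
have sum_H t x : \sum_u bary (H (t, x)) u = \sum_u bary x u.
  under eq_bigr do rewrite bary_point_of /=.
  rewrite big_split /= -[RHS]addr0; congr (_ + _).
  rewrite -!mulr_sumr sumrB -mulr_sumr (bigD1 v)//= eqxx big1 => [|u /negbTE -> //].
  rewrite addr0 mulr1.
  have -> : \sum_(u : V) (u \in sigma)%:R = #|sigma|%:R :> R.
    rewrite -sum1_card natr_sum [RHS]big_mkcond.
    by apply: eq_bigr => u _; case: ifP.
  by rewrite subrr !mulr0.
have H_ge0 t x : 0 <= t <= 1 -> (forall u, 0 <= bary x u) ->
    forall u, 0 <= bary (H (t, x)) u.
  move=> /andP[t0 t1] x0 u; rewrite bary_point_of /=.
  have m0 := min_bary_ge0 sigma x0.
  have [us|us] := boolP (u \in sigma).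
    have /negbTE -> : u != v by apply: contraNneq vs => <-.
    rewrite mulr0 sub0r mulrN1 mulrN subr_ge0.
    apply: le_trans (min_bary_le x us).
    by rewrite -[leRHS]mul1r ler_wpM2r //; lra.
  by rewrite subr0 addr_ge0 // mulr_ge0 ?mulr_ge0 // subr_ge0.
have H_fix t x : min_bary sigma x = 0 -> H (t, x) = x.
  by move=> m0; apply: bary_inj => u; rewrite bary_point_of /= m0 mul0r mulr0 addr0.
have H_supp t x s : (forall u, u \notin s -> bary x u = 0) -> sigma \subset s ->
    forall u, u \notin v |: s -> bary (H (t, x)) u = 0.
  move=> xs sigs u; rewrite !inE negb_or => /andP[/negbTE uv us].
  have /negbTE usig : u \notin sigma by apply: contra us; exact: (fintype.subsetP sigs).
  by rewrite bary_point_of /= uv usig xs // mulr0 subr0 !mulr0 addr0.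
have HA t x : 0 <= t <= 1 -> A x -> A (H (t, x)).
  move=> t01 /[dup] Ax /geomE[x0 x1 [s Ks xs]].
  have [sigs|nsigs] := boolP (sigma \subset s); last first.
    by rewrite H_fix //; exact: min_bary_out nsigs.
  apply/geomE; split; [exact: H_ge0|by rewrite sum_H|exists (v |: s)].
    exact: Kv.
  exact: H_supp.
have HB x : A x -> B (H (0, x)).
  move=> /geomE[x0 x1 [s Ks xs]].
  have [sigs|nsigs] := boolP (sigma \subset s); last first.
    rewrite H_fix; last exact: min_bary_out nsigs.
    by apply/geomE; split=> //; exists s => //; rewrite /star_removed Ks.
  have [w ws mw] := min_bary_attained x0 x1 w0s.
  (* At time 0 all the uniform mass is gone, so a least coordinate on [sigma] vanishes and its
     vertex leaves the support. *)
  have Hw : bary (H (0, x)) w = 0.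
    have /negbTE wv : w != v by apply: contraNneq vs => <-.
    by rewrite bary_point_of /= wv ws mulr0 sub0r subr0 mul1r mulrN1 mw subrr.
  apply/geomE; split; [by apply: H_ge0 => //; lra|by rewrite sum_H|].
  exists ((v |: s) :\ w).
    rewrite /star_removed (dK _ _ (subD1set _ _) (Kv _ Ks sigs)) /=.
    by apply/subsetPn; exists w => //; rewrite !inE eqxx.
  move=> u; rewrite in_setD1 negb_and negbK => /orP[/eqP -> //|].
  exact: H_supp.
have HBfix t x : B x -> H (t, x) = x.
  move=> /geomE[x0 x1 [s /andP[Ks nsigs] xs]].
  by apply: H_fix; exact: min_bary_out nsigs.
have cH (C : set (R * 'rV[R]_#|V|)) : {within C, continuous H}.
  by apply: continuous_subspaceT; exact: continuous_collapse_htpy.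
exists (fun x => H (0, x)), id; split.
- split; last by move=> _ [x Ax <-]; exact: HB.
  apply: continuous_subspaceT => x.
  apply: (@continuous_comp _ _ _ (fun x => (0 : R, x)) H); last first.
    exact: continuous_collapse_htpy.
  by apply: continuous_pair => [|y]; [exact: continuous_cstR|].
- split; last by move=> _ [x Bx <-]; exact: BA.
  by apply: continuous_subspaceT => x.
- exists H; split=> //.
    move=> _ [[t x] [/= t01 Ax] <-]; exact: HA.
  move=> x Ax; split=> //; apply: bary_inj => u.
  by rewrite bary_point_of /= subrr mul0r addr0.
- exists snd; split=> [||x Bx]; last by rewrite HBfix.
    by apply: continuous_subspaceT => p; exact: cvg_snd.
  by move=> _ [[t x] [/= _ Bx] <-].
Qed.

Lemma he_collapses K K' : collapses K K' -> down_closed K -> K' finset.set0 ->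
  homotopy_equivalent R (geom_realization R K) (geom_realization R K').
Proof.
elim=> [{}K _ _|{}K sigma v {}K' vs Kv KK' IH dK K'0]; first exact: he_refl.
apply: he_trans (IH (star_removed_down dK) K'0).
(* As [K'] still contains the empty simplex, the core cannot be empty. *)
apply: he_collapse vs Kv => //; apply: contraTneq (collapses_sub KK' K'0) => ->.
by rewrite /star_removed finset.sub0set andbF.
Qed.

End realization.

Lemma he_homeo (R : realType) (X Y : topologicalType) (A : set X) (B : set Y)
    (f : X -> Y) (g : Y -> X) :
  continuous f -> continuous g -> f @` A `<=` B -> g @` B `<=` A ->
  (forall a, A a -> g (f a) = a) -> (forall b, B b -> f (g b) = b) ->
  homotopy_equivalent R A B.
Proof.
move=> cf cg fAB gBA fK gK; exists f, g; split.
- by split=> //; exact: continuous_subspaceT.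
- by split=> //; exact: continuous_subspaceT.
- exists snd; split=> [|_ [[t a] [/= _ Aa] <-] //|a Aa]; last by rewrite fK.
  by apply: continuous_subspaceT => p; exact: cvg_snd.
- exists snd; split=> [|_ [[t b] [/= _ Bb] <-] //|b Bb]; last by rewrite gK.
  by apply: continuous_subspaceT => p; exact: cvg_snd.
Qed.

Lemma closed_preimage (X Y : topologicalType) (f : X -> Y) (C : set Y) :
  continuous f -> closed C -> closed (f @^-1` C).
Proof. by move=> /continuous_closedP; exact. Qed.

Section realization2.
Variable R : realType.

Lemma compact_geom (V : finType) (K : {set V} -> bool) :
  compact (geom_realization R K).
Proof.
have -> : geom_realization R K =
    [set x : 'rV[R]_#|V| | forall i, (x ord0 i) \in `[0, 1]] `&`
    ([set x | \sum_v bary x v = 1] `&`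
    \bigcup_(s in [set s | K s]) \bigcap_(v in [set v | v \notin s])
      [set x | bary x v = 0]).
  rewrite eqEsubset; split => x.
    move=> /geomE[x0 x1 [s Ks xs]]; split.
      move=> i /=; rewrite in_itv /= -(enum_valK i).
      by rewrite -/(bary x (enum_val i)) x0 (bary_le1 _ x0).
    by split=> //; exists s => // v /= /xs.
  move=> [/= x01 [/= x1 [s /= Ks xs]]]; apply/geomE; split=> //.
    by move=> v; have := x01 (enum_rank v); rewrite in_itv /= => /andP[].
  by exists s => // v vs; exact: xs.
apply: compact_closedI.
  apply: (@rV_compact _  _ (fun=> `[(0:R), 1]%classic)) => _.
  exact: segment_compact.
apply: closedI.
  apply: (@closed_preimage _ _ _ [set 1 : R]); last exact: closed_eq.
  by apply: continuous_sumR => v; exact: continuous_bary.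
apply: closed_bigcup => [|s _].
  exact: finite_finset.
apply: closed_bigI => v _.
apply: (@closed_preimage _ _ _ [set 0 : R]); last exact: closed_eq.
exact: continuous_bary.
Qed.

(** The empty simplex carries no point, and a vertex with link [fun=> false] does not occur. So the
    empty simplex can be adjoined and room made for cone vertices before any cone is attached. *)
Lemma he_coned_none (T J : finType) (K K' : {set T} -> bool) :
  (forall s, s != finset.set0 -> K s = K' s) ->
  homotopy_equivalent R (geom_realization R K)
    (geom_realization R (coned K' (fun (_ : J) _ => false))).
Proof.
move=> KK'.
pose f (x : 'rV[R]_#|T|) : 'rV[R]_#|{: T + J}| :=
  point_of (fun u => if u is inl t then bary x t else 0).
pose g (y : 'rV[R]_#|{: T + J}|) : 'rV[R]_#|T| := point_of (fun t => bary y (inl t)).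
have y_inr y j : geom_realization R (coned K' (fun (_ : J) _ => false)) y ->
    bary y (inr j) = 0.
  move=> /geomE[_ _ [s Ks ys]]; apply: ys; apply: contraTN Ks => js.
  rewrite /coned negb_or negb_and; apply/andP; split.
    by apply/orP; left; apply/set0Pn; exists j; rewrite inE.
  by apply/existsP => -[i]; rewrite andbF.
have nonempty (V : finType) (x : 'rV[R]_#|V|) (s : {set V}) :
    \sum_v bary x v = 1 -> (forall v, v \notin s -> bary x v = 0) ->
    s != finset.set0.
  move=> x1 xs; apply: contra_eq_neq x1 => s0.
  rewrite big1 => [|v _]; first by rewrite eq_sym oner_eq0.
  by apply: xs; rewrite s0 inE.
apply: (@he_homeo R _ _ _ _ f g).
- apply: continuous_point_of => -[t|j]; first exact: continuous_bary.
  exact: continuous_cstR.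
- by apply: continuous_point_of => t; exact: continuous_bary.
- move=> _ [x /geomE[x0 x1 [s Ks xs]] <-]; apply/geomE; split.
  + by move=> u; rewrite bary_point_of; case: u.
  + under eq_bigr do rewrite bary_point_of.
    by rewrite big_sumType /= x1 big1 ?addr0.
  + have sr : inr @^-1: (inl @: s : {set T + J}) = finset.set0.
      by apply/setP => j; rewrite !inE; apply/imsetP => -[].
    have sl : inl @^-1: (inl @: s : {set T + J}) = s.
      by apply/setP => t; rewrite inE mem_imset // => ? ? [].
    exists (inl @: s); first by rewrite coned_base // sl -KK' // (nonempty _ x).
    move=> [t|j]; rewrite bary_point_of // => ts; apply: xs.
    by apply: contra ts => ts; exact: imset_f.
- move=> _ [y Yy <-]; have /geomE[y0 y1 [s Ks ys]] := Yy.
  have y1' : \sum_t bary y (inl t) = 1.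
    by rewrite -y1 big_sumType /= [X in _ + X]big1 ?addr0 // => j _; exact: y_inr.
  have gs t : t \notin inl @^-1: s -> bary (g y) t = 0.
    by rewrite inE bary_point_of => /ys.
  have g1 : \sum_t bary (g y) t = 1.
    by rewrite -y1'; apply: eq_bigr => t _; rewrite bary_point_of.
  apply/geomE; split=> //; first by move=> t; rewrite bary_point_of.
  exists (inl @^-1: s) => //; rewrite KK'; last exact: nonempty gs.
  by move: Ks; apply: coned_ind.
- by move=> x _; apply: bary_inj => t; rewrite !bary_point_of.
- move=> y Yy; apply: bary_inj => -[t|j]; rewrite !bary_point_of //.
  by rewrite y_inr.
Qed.

End realization2.

(** * Triangles attached to a cone *)

(** Three numbers are determined by their minimum and their differences; this makes the map to the
    spheres injective on an open triangle. *)
Lemma eq_of_min_shift (R : realDomainType) (a b c m a' b' c' m' : R) : m = m' ->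
  m <= a -> m <= b -> m <= c -> m' <= a' -> m' <= b' -> m' <= c' ->
  a - c = a' - c' -> b - c = b' - c' ->
  [\/ m = a, m = b | m = c] -> [\/ m' = a', m' = b' | m' = c'] -> c = c'.
Proof. by move=> mm ma mb mc ma' mb' mc' ac bc [] e [] e'; lra. Qed.

Section wedge.
Variables (R : realType) (V : finType) (m : nat) (K : {set V} -> bool).
Variables a b c : 'I_m -> V.
Hypothesis abc : forall i, [/\ a i != b i, b i != c i & a i != c i].

Let tri i : {set V} := [set a i; b i; c i]%SET.

Hypothesis m_gt0 : (0 < m)%N.
Hypothesis dK : down_closed K.
Hypothesis Ktri : forall i, K (tri i).
Hypothesis tri_max : forall i s, K s -> tri i \subset s -> s = tri i.
Hypothesis tri_inj : injective tri.

Let A s := K s && [forall i, s != tri i].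
Let X := geom_realization R (coned K (fun _ : unit => A)).

Let W : finType := (V + unit)%type.
Let apex : W := inr tt.
Let face i : {set W} := [set inl (a i); inl (b i); inl (c i)]%SET.
Let mf i (x : 'rV[R]_#|W|) := min_bary (face i) x.

Let in_face i u : (u \in face i) =
  [|| u == inl (a i), u == inl (b i) | u == inl (c i)].
Proof. by rewrite !inE orbA. Qed.

Let faceE i : face i = inl @: tri i.
Proof.
apply/setP => -[v|j]; rewrite in_face; last first.
  by apply/idP/imsetP => // -[].
rewrite mem_imset; last by move=> ? ? [].
by rewrite !inE orbA.
Qed.

Let apex_face i : apex \notin face i. Proof. by rewrite in_face. Qed.

Let face_sub i (s : {set W}) : (face i \subset s) = (tri i \subset inl @^-1: s).
Proof. by rewrite faceE imset_inl_sub. Qed.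

Let unit_set (s : {set unit}) : s = finset.set0 \/ s = [set tt]%SET.
Proof.
have [ts|ts] := boolP (tt \in s); [right|left]; apply/setP => -[].
  by rewrite ts inE.
by rewrite (negbTE ts) inE.
Qed.

Let sum_face i (F : W -> R) : \sum_(u in face i) F u =
  F (inl (a i)) + F (inl (b i)) + F (inl (c i)).
Proof.
have [ab bc ac] := abc i.
have inlE (u v : V) : (inl u == inl v :> W) = (u == v) by [].
rewrite /face -finset.setUA big_setU1 /=; last first.
  by rewrite in_setU1 finset.in_set1 !inlE negb_or ab.
by rewrite big_setU1 ?big_set1 ?addrA //= finset.in_set1 inlE.
Qed.

(** A positive [mf i x] puts [x] in the interior of the triangle [i], and by maximality in no other
    one; if all of them vanish, the support of [x] omits a vertex of each triangle and [x] lies in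
    the cone over [A]. *)
Let simplexP (x : 'rV[R]_#|W|) : X x ->
  (exists2 s, coned K (fun _ : unit => A) s & apex \in s /\
     forall u, u \notin s -> bary x u = 0) /\ (forall i, mf i x = 0) \/
  exists2 i, 0 < mf i x & (forall u, u \notin face i -> bary x u = 0) /\
     forall j, j != i -> mf j x = 0.
Proof.
move=> /geomE[x0 x1 [s Ks xs]].
have mf0 i : ~~ (face i \subset s) -> mf i x = 0 by exact: min_bary_out.
have cone_case (t : {set W}) : A (inl @^-1: t) -> apex \in t ->
    (forall u, u \notin t -> bary x u = 0) ->
  (exists2 s, coned K (fun _ : unit => A) s & apex \in s /\
     forall u, u \notin s -> bary x u = 0) /\ (forall i, mf i x = 0).
  move=> At ct xt; split.
    exists t => //; rewrite (@coned_apex _ _ _ _ _ tt) //.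
    have [t0|//] := unit_set (inr @^-1: t).
    by move/setP/(_ tt): t0; rewrite !inE ct.
  move=> i; apply: min_bary_out x0 xt _; rewrite face_sub.
  apply/negP => it; have /andP[Kt /forallP /(_ i)] := At.
  by rewrite -(tri_max Kt it) eqxx.
move: Ks; apply: coned_ind => [s0 Ks|[] st As]; last first.
  left; apply: (cone_case s) => //.
  by have := finset.set11 tt; rewrite -st inE.
have [As|nAs] := boolP (A (inl @^-1: s)).
  left; apply: (cone_case (apex |: s)).
  - by rewrite preim_inl_setU1r.
  - by rewrite !inE eqxx.
  - by move=> u; rewrite !inE negb_or => /andP[_ /xs].
move: nAs; rewrite /A Ks /= negb_forall => /existsP[i /negPn/eqP si].
have sE : s = face i.
  apply/setP => -[v|[]]; rewrite faceE.
    by rewrite mem_imset -?si ?inE // => ? ? [].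
  have : (tt \in inr @^-1: s) = false by rewrite s0 inE.
  by rewrite inE => ->; apply/esym/imsetP => -[].
have m_ge0 := min_bary_ge0 (face i) x0.
have [mi0|mi_neq0] := eqVneq (mf i x) 0; last first.
  right; exists i; first by rewrite lt_neqAle eq_sym mi_neq0.
  split; first by rewrite -sE.
  move=> j ji; apply: mf0; rewrite face_sub si; apply: contraNN ji => ji.
  by apply/eqP/tri_inj/esym/tri_max.
have [w wi mw] : exists2 w, w \in face i & mf i x = bary x w.
  by apply: (@min_bary_attained _ _ _ _ (inl (a i))) => //; rewrite in_face eqxx.
left; apply: (cone_case (apex |: (s :\ w))).
- rewrite preim_inl_setU1r.
  have sw : inl @^-1: (s :\ w) \proper tri i.
    rewrite -si; apply/properP; split.
      by apply/fintype.subsetP => u; rewrite !inE => /andP[].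
    move: wi; rewrite faceE -si => /imsetP[w' w's ->].
    by exists w' => //; rewrite !inE eqxx.
  rewrite /A (dK (proper_sub sw) (Ktri i)) /=; apply/forallP => j.
  apply/negP => /eqP sj; rewrite sj in sw.
  have tj := tri_max (Ktri i) (proper_sub sw).
  by rewrite tj fintype.properxx in sw.
- by rewrite !inE eqxx.
- move=> u; rewrite !inE !negb_or negb_and negbK => /andP[_ /orP[/eqP ->|/xs //]].
  by rewrite -mw.
Qed.

(* A point of a triangle is first pushed radially to the boundary and then along
   the cone to the apex; [mu] is the mass taken off each corner, at most [t / 6]
   so that the normalizing denominator stays at least 1 / 2. *)
Let cone_htpy (p : R * 'rV[R]_#|W|) : 'rV[R]_#|W| :=
  let mu i := Num.min (mf i p.2) (p.1 / 6) in
  let th := p.1 - 6 * \sum_i mu i in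
  point_of (fun u : W =>
    (1 - th) * (bary p.2 u - \sum_i mu i * (u \in face i)%:R)
      / Num.max 2^-1 (1 - 3 * \sum_i mu i) + th * (u == apex)%:R).

Let continuous_cone_htpy : continuous cone_htpy.
Proof.
have c1 : continuous (fun p : R * 'rV[R]_#|W| => p.1) by move=> p; exact: cvg_fst.
have c2 (f : 'rV[R]_#|W| -> R) : continuous f ->
    continuous (fun p : R * 'rV[R]_#|W| => f p.2).
  by move=> cf p; apply: (continuous_comp _ (cf p.2)); exact: cvg_snd.
have cmu i : continuous (fun p : R * 'rV[R]_#|W| => Num.min (mf i p.2) (p.1 / 6)).
  apply: continuous_minR; first exact: (c2 (mf i) (@continuous_min_bary R W (face i))).
  by apply: continuous_mulR => //; exact: continuous_cstR.
have cth : continuous (fun p : R * 'rV[R]_#|W| =>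
    p.1 - 6 * \sum_i Num.min (mf i p.2) (p.1 / 6)).
  apply: continuous_subR => //; apply: continuous_mulR.
    exact: continuous_cstR.
  exact: continuous_sumR.
apply: continuous_point_of => u; apply: continuous_addR; last first.
  by apply: continuous_mulR => //; exact: continuous_cstR.
apply: continuous_mulR.
  apply: continuous_mulR.
    by apply: continuous_subR => //; exact: continuous_cstR.
  apply: continuous_subR; first exact: (c2 (fun x => bary x u) (@continuous_bary R W u)).
  apply: continuous_sumR => i.
  apply: continuous_mulR => //.
  exact: continuous_cstR.
apply: continuous_invR.
  by move=> p; rewrite gt_eqF // lt_max invr_gt0 ltr0n.
apply: continuous_maxR; first exact: continuous_cstR.
apply: continuous_subR; first exact: continuous_cstR.
apply: continuous_mulR; first exact: continuous_cstR.
exact: continuous_sumR.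
Qed.

Let sum1 i (F : 'I_m -> R) : (forall j, j != i -> F j = 0) -> \sum_j F j = F i.
Proof. by move=> F0; rewrite (bigD1 i) //= big1 ?addr0. Qed.

Let htpy_cone t x u : 0 <= t -> (forall i, mf i x = 0) ->
  bary (cone_htpy (t, x)) u = (1 - t) * bary x u + t * (u == apex)%:R.
Proof.
move=> t0 mf0; rewrite bary_point_of /=.
have mu0 i : Num.min (mf i x) (t / 6) = 0 by rewrite mf0 min_l // divr_ge0.
under eq_bigr do rewrite mu0.
rewrite big1 // mulr0 subr0 max_r; last by rewrite mulr0 subr0; lra.
under eq_bigr do rewrite mu0 mul0r.
by rewrite big1 // mulr0 !subr0 divr1.
Qed.

Let htpy_face t x u i : 0 <= t -> (forall j, j != i -> mf j x = 0) ->
  let mu := Num.min (mf i x) (t / 6) in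
  bary (cone_htpy (t, x)) u = (1 - (t - 6 * mu)) *
    (bary x u - mu * (u \in face i)%:R) / Num.max 2^-1 (1 - 3 * mu) +
    (t - 6 * mu) * (u == apex)%:R.
Proof.
move=> t0 mf0 mu; rewrite bary_point_of /=.
have mu0 j : j != i -> Num.min (mf j x) (t / 6) = 0.
  by move=> /mf0 ->; rewrite min_l // divr_ge0.
rewrite (sum1 mu0) (@sum1 i) // => j /mu0 ->; exact: mul0r.
Qed.

Let face_facts x i : (forall u, 0 <= bary x u) -> \sum_u bary x u = 1 ->
  (forall u, u \notin face i -> bary x u = 0) ->
  [/\ bary x (inl (a i)) + bary x (inl (b i)) + bary x (inl (c i)) = 1,
      mf i x <= bary x (inl (a i)), mf i x <= bary x (inl (b i)),
      mf i x <= bary x (inl (c i)) &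
      [\/ mf i x = bary x (inl (a i)), mf i x = bary x (inl (b i)) |
          mf i x = bary x (inl (c i))]].
Proof.
move=> x0 x1 xi; split.
- rewrite -sum_face -x1 [RHS](bigID (mem (face i))) /= [X in _ + X]big1 ?addr0 //.
- by apply: min_bary_le; rewrite in_face eqxx.
- by apply: min_bary_le; rewrite in_face eqxx !orbT.
- by apply: min_bary_le; rewrite in_face eqxx !orbT.
- have [|w + mw] := @min_bary_attained R W (face i) x (inl (a i)) x0 x1.
    by rewrite in_face eqxx.
  by rewrite /mf mw in_face => /or3P[] /eqP ->; [constructor 1|constructor 2|constructor 3].
Qed.

Let htpy_in t x : 0 <= t <= 1 -> X x -> X (cone_htpy (t, x)).
Proof.
move=> /andP[t0 t1] /[dup] Xx /geomE[x0 x1 _].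
have [[[s Ks [cs xs]] mf0]|[i mi_gt0 [xi mf0]]] := simplexP Xx.
  apply/geomE; split.
  - by move=> u; rewrite htpy_cone // addr_ge0 ?mulr_ge0 ?subr_ge0 ?ler0n //; exact: x0.
  - under eq_bigr do rewrite htpy_cone //.
    rewrite big_split /= -!mulr_sumr x1 (bigD1 apex) //= ?eqxx big1 /=.
      by rewrite addr0 !mulr1 subrK.
    by move=> u /negbTE ->.
  - exists s => // u us; rewrite htpy_cone // xs // mulr0 add0r.
    by rewrite (_ : (u == apex) = false) ?mulr0 //; apply: contraNF us => /eqP ->.
have [s1 ma mb mc mabc] := face_facts x0 x1 xi.
pose mu := Num.min (mf i x) (t / 6).
have mu_le : mu <= mf i x by rewrite /mu ge_min lexx.
have mu_le6 : mu <= t / 6 by rewrite /mu ge_min lexx orbT.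
have mu_ge0 : 0 <= mu by rewrite le_min ltW //= divr_ge0.
have mu_or : mu = mf i x \/ mu = t / 6.
  by rewrite /mu; case: leP => _; [left|right].
have Hu u := htpy_face u t0 mf0; rewrite -/mu /= in Hu.
clearbody mu.
have maxE : Num.max 2^-1 (1 - 3 * mu) = 1 - 3 * mu by rewrite max_r //; lra.
rewrite maxE in Hu.
have xm u : 0 <= bary x u - mu * (u \in face i)%:R.
  case: (boolP (u \in face i)) => ui; last by rewrite mulr0 subr0.
  by rewrite mulr1 subr_ge0 (le_trans mu_le) // min_bary_le.
apply/geomE; split.
- move=> u; rewrite Hu; apply: addr_ge0; last first.
    by apply: mulr_ge0; [lra|exact: ler0n].
  by apply: divr_ge0; [apply: mulr_ge0; [lra|exact: xm]|lra].
- under eq_bigr do rewrite Hu.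
  rewrite big_split /= -!mulr_suml -!mulr_sumr sumrB x1 -mulr_sumr.
  have -> : \sum_(u : W) (u == apex)%:R = 1 :> R.
    by rewrite (bigD1 apex) //= ?eqxx big1 ?addr0 // => u /negbTE ->.
  have -> : \sum_(u : W) (u \in face i)%:R = 3 :> R.
    rewrite -[RHS](_ : \sum_(u in face i) 1 = 3); last by rewrite sum_face; lra.
    by rewrite [RHS]big_mkcond; apply: eq_bigr => u _; case: ifP.
  rewrite mulr1 [mu * 3]mulrC mulfK ?subrK //.
  by rewrite gt_eqF //; lra.
(* If [mu] is [t / 6], the cone parameter vanishes and the point stays in its triangle. If [mu] is
   the least coordinate, the point has reached the boundary and moves in the cone over it. *)
- have [mu_eq|mu_eq] := mu_or; last first.
    exists (face i).
      have s0 : inr @^-1: face i = finset.set0.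
        by apply/setP => j; rewrite inE in_face inE.
      rewrite coned_base // (_ : inl @^-1: face i = tri i) //.
      by apply/setP => v; rewrite !inE.
    move=> u ui; rewrite Hu xi // (negbTE ui) mulr0 subrr mulr0 mul0r add0r.
    by rewrite (_ : t - 6 * mu = 0) ?mul0r //; lra.
  have [w wi mw] : exists2 w, w \in face i & mf i x = bary x w.
    by apply: (@min_bary_attained _ _ _ _ (inl (a i))) => //; rewrite in_face eqxx.
  exists (apex |: (face i :\ w)).
    rewrite (@coned_apex _ _ _ _ _ tt); last first.
      by apply/setP => -[]; rewrite !inE eqxx.
    rewrite preim_inl_setU1r.
    have sw : inl @^-1: (face i :\ w) \proper tri i.
      move: wi; rewrite faceE => /imsetP[w' w's ->]; apply/properP; split.
        apply/fintype.subsetP => u; rewrite inE in_setD1 mem_imset => [/andP[]//|].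
        by move=> ? ? [].
      by exists w' => //; rewrite !inE eqxx.
    rewrite /A (dK (proper_sub sw) (Ktri i)) /=; apply/forallP => j.
    apply/negP => /eqP sj; rewrite sj in sw.
    have tj := tri_max (Ktri i) (proper_sub sw).
    by rewrite tj fintype.properxx in sw.
  move=> u; rewrite in_setU1 negb_or in_setD1 negb_and negbK => /andP[uc uwi].
  rewrite Hu (negbTE uc) mulr0 addr0; case/orP: uwi => [/eqP ->|ui].
    by rewrite wi mulr1 mu_eq -mw subrr mulr0 mul0r.
  by rewrite (negbTE ui) xi // mulr0 subrr mulr0 mul0r.
Qed.

Let j0 : 'I_3 := ord0.
Let j1 : 'I_3 := lift ord0 (ord0 : 'I_2).
Let j2 : 'I_3 := lift ord0 (lift ord0 (ord0 : 'I_1) : 'I_2).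

Let sphereE (p : 'rV[R]_3) (r : R) :
  (\sum_(j < 3) (p ord0 j - (if (j == 0 :> nat) then r else 0)) ^+ 2 = r ^+ 2)
  <-> p ord0 j0 ^+ 2 + p ord0 j1 ^+ 2 + p ord0 j2 ^+ 2 = 2 * r * p ord0 j0.
Proof.
rewrite !big_ord_recl big_ord0 /= !subr0 addr0 -/j0 -/j1 -/j2.
have -> : (p ord0 j0 - r) ^+ 2 = p ord0 j0 ^+ 2 - 2 * r * p ord0 j0 + r ^+ 2 by ring.
by split=> h; lra.
Qed.

Let row3P (p p' : 'rV[R]_3) : p ord0 j0 = p' ord0 j0 -> p ord0 j1 = p' ord0 j1 ->
  p ord0 j2 = p' ord0 j2 -> p = p'.
Proof.
move=> e0 e1 e2; apply/rowP => -[[|[|[|//]]] lt3].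
- by rewrite (_ : Ordinal lt3 = j0) //; exact: val_inj.
- by rewrite (_ : Ordinal lt3 = j1) //; exact: val_inj.
- by rewrite (_ : Ordinal lt3 = j2) //; exact: val_inj.
Qed.

Let al i (x : 'rV[R]_#|W|) := bary x (inl (a i)).
Let be i (x : 'rV[R]_#|W|) := bary x (inl (b i)).
Let ga i (x : 'rV[R]_#|W|) := bary x (inl (c i)).

(* The last square vanishes on the face and keeps the denominator nonzero
   everywhere. *)
Let den (i : 'I_m) x := mf i x ^+ 2 + (al i x - ga i x) ^+ 2 + (be i x - ga i x) ^+ 2 +
  (1 - al i x - be i x - ga i x) ^+ 2.

(** On the triangle, [den] is the squared length of d = (mf, al - ga, be - ga). The sphere of radius
    r has the equation |p|^2 = 2 r p_0, and a nonzero multiple of d satisfies it when the factor is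
    2 r d_0 / |d|^2. *)
Let coef (i : 'I_m) x := i.+1%:R * 2 * mf i x / den i x.

(* Inverse stereographic projection from the origin, after the homeomorphism
   [((al - ga) / mf, (be - ga) / mf)] of the open face with the plane. *)
Let quot x : 'rV[R]_3 := \row_(j < 3) \sum_i coef i x *
  (if j == 0%N :> nat then mf i x
   else if j == 1%N :> nat then al i x - ga i x else be i x - ga i x).

(** If all four squares vanish, the three coordinates are equal with sum 1, so [mf i x] is at least
    1/3 and its square is not zero. *)
Let den_gt0 i x : 0 < den i x.
Proof.
rewrite lt_neqAle eq_sym; apply/andP; split; last first.
  by rewrite /den !addr_ge0 // sqr_ge0.
apply/eqP; rewrite /den => d0.
have s1 := sqr_ge0 (mf i x); have s2 := sqr_ge0 (al i x - ga i x).
have s3 := sqr_ge0 (be i x - ga i x).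
have s4 := sqr_ge0 (1 - al i x - be i x - ga i x).
have /eqP : mf i x ^+ 2 = 0 by lra.
have /eqP : (al i x - ga i x) ^+ 2 = 0 by lra.
have /eqP : (be i x - ga i x) ^+ 2 = 0 by lra.
have /eqP : (1 - al i x - be i x - ga i x) ^+ 2 = 0 by lra.
rewrite !sqrf_eq0 => /eqP e4 /eqP e3 /eqP e2 /eqP e1.
have : 3^-1 <= mf i x.
  apply/bigmin_geP; split; first lra.
  move=> u; rewrite in_face => /or3P[] /eqP ->;
    rewrite -?/(al i x) -?/(be i x) -?/(ga i x); lra.
by rewrite e1; lra.
Qed.

Let continuous_quot : continuous quot.
Proof.
have cb v : continuous (fun x : 'rV[R]_#|W| => bary x v) by exact: continuous_bary.
have cm i : continuous (mf i) by exact: continuous_min_bary.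
have csq (f : 'rV[R]_#|W| -> R) : continuous f -> continuous (fun x => f x ^+ 2).
  by move=> cf; exact: continuous_mulR.
have cu i : continuous (fun x => al i x - ga i x).
  by apply: continuous_subR; exact: cb.
have cv i : continuous (fun x => be i x - ga i x).
  by apply: continuous_subR; exact: cb.
have cw i : continuous (fun x => 1 - al i x - be i x - ga i x).
  apply: continuous_subR; last exact: cb.
  apply: continuous_subR; last exact: cb.
  by apply: continuous_subR; [exact: continuous_cstR|exact: cb].
have cden i : continuous (den i).
  apply: continuous_addR; last exact: csq.
  apply: continuous_addR; last exact: csq.
  by apply: continuous_addR; exact: csq.
have ccoef i : continuous (coef i).
  apply: continuous_mulR.
    by apply: continuous_mulR => //; exact: continuous_cstR.
  by apply: continuous_invR => // x; rewrite gt_eqF ?den_gt0.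
apply: continuous_rV => j.
have -> : (fun x => quot x ord0 j) = fun x => \sum_i coef i x *
    (if j == 0%N :> nat then mf i x
     else if j == 1%N :> nat then al i x - ga i x else be i x - ga i x).
  by apply/funext => x; rewrite mxE.
apply: continuous_sumR => i; apply: continuous_mulR => //.
by case: (j == 0%N :> nat) => //; case: (j == 1%N :> nat).
Qed.

Let quot_cone x : (forall i, mf i x = 0) -> quot x = 0.
Proof.
move=> mf0; apply/rowP => j; rewrite !mxE big1 // => i _.
by rewrite /coef mf0 mulr0 !mul0r.
Qed.

Let quot_face x i : (forall j, j != i -> mf j x = 0) ->
  [/\ quot x ord0 j0 = coef i x * mf i x,
      quot x ord0 j1 = coef i x * (al i x - ga i x) &
      quot x ord0 j2 = coef i x * (be i x - ga i x)].
Proof.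
move=> mf0; have coef0 j : j != i -> coef j x = 0.
  by move=> /mf0 m0; rewrite /coef m0 mulr0 mul0r.
by split; rewrite mxE (@sum1 i) // => j /coef0 ->; rewrite mul0r.
Qed.

Let den_face x i : al i x + be i x + ga i x = 1 ->
  den i x = mf i x ^+ 2 + (al i x - ga i x) ^+ 2 + (be i x - ga i x) ^+ 2.
Proof.
move=> s1; rewrite /den (_ : 1 - al i x - be i x - ga i x = 0); last by lra.
by rewrite expr0n addr0.
Qed.

Let quot_sphere x i : (forall j, j != i -> mf j x = 0) ->
  al i x + be i x + ga i x = 1 ->
  quot x ord0 j0 ^+ 2 + quot x ord0 j1 ^+ 2 + quot x ord0 j2 ^+ 2 =
    2 * i.+1%:R * quot x ord0 j0.
Proof.
move=> mf0 s1; have [-> -> ->] := quot_face mf0.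
rewrite !exprMn -!mulrDr -(den_face s1) /coef; field.
by rewrite gt_eqF.
Qed.

Let quot_fiber x y : X x -> X y -> quot x = quot y ->
  (forall i, mf i x = 0) /\ (forall i, mf i y = 0) \/ x = y.
Proof.
move=> Xx Xy qxy.
have coef_gt0 i z : 0 < mf i z -> 0 < coef i z.
  by move=> mi; rewrite /coef divr_gt0 // mulr_gt0 // mulr_gt0 // ltr0n.
have [[_ mx0]|[i mi [xi mx0]]] := simplexP Xx;
  have [[_ my0]|[j mj [yj my0]]] := simplexP Xy; first by left.
- have [q0 _ _] := quot_face my0; move: q0.
  rewrite -qxy quot_cone // mxE => /eqP; rewrite eq_sym gt_eqF //.
  by rewrite mulr_gt0 // coef_gt0.
- have [q0 _ _] := quot_face mx0; move: q0.
  rewrite qxy quot_cone // mxE => /eqP; rewrite eq_sym gt_eqF //.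
  by rewrite mulr_gt0 // coef_gt0.
right.
have /geomE[x0 x1 _] := Xx; have /geomE[y0 y1 _] := Xy.
have [sx xa xb xc xor] := face_facts x0 x1 xi.
have [sy ya yb yc yor] := face_facts y0 y1 yj.
(* Away from the origin the equation of the sphere gives back its radius, hence the index. *)
have ij : i = j.
  have := quot_sphere mx0 sx; rewrite qxy (quot_sphere my0 sy).
  have [-> _ _] := quot_face my0.
  have cm : coef j y * mf j y != 0 by rewrite gt_eqF // mulr_gt0 // coef_gt0.
  move=> /(mulIf cm) /(mulfI _); rewrite pnatr_eq0 => /(_ isT) /eqP.
  by rewrite eqr_nat eqSS => /eqP /val_inj.
subst j; have [qx0 qx1 qx2] := quot_face mx0; have [qy0 qy1 qy2] := quot_face my0.
rewrite qxy qy0 in qx0; rewrite qxy qy1 in qx1; rewrite qxy qy2 in qx2.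
have kx := coef_gt0 _ _ mi; have ky := coef_gt0 _ _ mj.
rewrite -/(al i x) -/(be i x) -/(ga i x) in sx xa xb xc xor.
rewrite -/(al i y) -/(be i y) -/(ga i y) in sy ya yb yc yor.
move: (coef i x) (coef i y) kx ky qx0 qx1 qx2 => k l k0 l0 q0 q1 q2.
have kxa : k * mf i x <= k * al i x by rewrite ler_pM2l.
have kxb : k * mf i x <= k * be i x by rewrite ler_pM2l.
have kxc : k * mf i x <= k * ga i x by rewrite ler_pM2l.
have lya : l * mf i y <= l * al i y by rewrite ler_pM2l.
have lyb : l * mf i y <= l * be i y by rewrite ler_pM2l.
have lyc : l * mf i y <= l * ga i y by rewrite ler_pM2l.
rewrite !mulrBr in q1 q2.
(* Scaled by their values of [coef], the two points have the same least coordinate and the same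
   differences. *)
have gaE : k * ga i x = l * ga i y.
  apply: (eq_of_min_shift (esym q0) kxa kxb kxc lya lyb lyc (esym q1) (esym q2)).
    by case: xor => ->; [constructor 1|constructor 2|constructor 3].
  by case: yor => ->; [constructor 1|constructor 2|constructor 3].
have ks : k * al i x + k * be i x + k * ga i x = k by rewrite -!mulrDr sx mulr1.
have ls : l * al i y + l * be i y + l * ga i y = l by rewrite -!mulrDr sy mulr1.
have kl : k = l by lra.
subst l; have kN0 : k != 0 by rewrite gt_eqF.
have alE : al i x = al i y by apply: (mulfI kN0); lra.
have beE : be i x = be i y by apply: (mulfI kN0); lra.
have {}gaE : ga i x = ga i y by apply: (mulfI kN0); lra.
apply: bary_inj => u; have [|ui] := boolP (u \in face i).
  by rewrite in_face => /or3P[] /eqP ->.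
by rewrite xi // yj.
Qed.

Let apex_point : 'rV[R]_#|W| := point_of (fun u => (u == apex)%:R).

Let i0 : 'I_m := Ordinal m_gt0.

Let X_apex : X apex_point.
Proof.
apply/geomE; split.
- by move=> u; rewrite bary_point_of.
- under eq_bigr do rewrite bary_point_of.
  by rewrite (bigD1 apex) //= ?eqxx big1 ?addr0 // => u /negbTE ->.
- exists [set apex]%SET; last first.
    by move=> u; rewrite bary_point_of finset.in_set1 => /negbTE ->.
  rewrite (@coned_apex _ _ _ _ _ tt); last first.
    by apply/setP => -[]; rewrite !inE eqxx.
  have -> : inl @^-1: [set apex]%SET = finset.set0 :> {set V}.
    by apply/setP => v; rewrite !inE.
  rewrite /A (dK (finset.sub0set _) (Ktri i0)) /=; apply/forallP => i.
  by apply/negP => /eqP/setP/(_ (a i)); rewrite !inE eqxx.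
Qed.

Let mf_apex i : mf i apex_point = 0.
Proof.
have /geomE[x0 _ _] := X_apex.
apply: (@min_bary_eq0 _ _ _ _ (inl (a i))) => //; first by rewrite in_face eqxx.
by rewrite bary_point_of.
Qed.

Let quot_image : quot @` X = wedge_S2 R m.
Proof.
rewrite eqEsubset; split=> [_ [x Xx <-]|p [i /sphereE pi]].
  have [[_ mx0]|[i mi [xi mx0]]] := simplexP Xx.
    by exists i0; apply/sphereE; rewrite quot_cone // !mxE expr0n /= !addr0 mulr0.
  have /geomE[x0 x1 _] := Xx; have [sx _ _ _ _] := face_facts x0 x1 xi.
  by exists i; apply/sphereE; exact: quot_sphere.
have r_gt0 : 0 < i.+1%:R :> R by rewrite ltr0n.
have s0 := sqr_ge0 (p ord0 j0); have s1 := sqr_ge0 (p ord0 j1).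
have s2 := sqr_ge0 (p ord0 j2).
(* The sphere meets the plane of first coordinate 0 only at the origin, the image of the apex. *)
have [p00|p00] := eqVneq (p ord0 j0) 0.
  exists apex_point => //; rewrite (quot_cone mf_apex); apply/esym/row3P; rewrite ?mxE //.
    by apply/eqP; rewrite -sqrf_eq0; apply/eqP; rewrite p00 mulr0 in pi; lra.
  by apply/eqP; rewrite -sqrf_eq0; apply/eqP; rewrite p00 mulr0 in pi; lra.
have p0_gt0 : 0 < p ord0 j0.
  rewrite lt_neqAle eq_sym p00 -(pmulr_rge0 _ (mulr_gt0 (ltr0n R 2) r_gt0)) -pi.
  by rewrite !addr_ge0.
have [y0 pE0] : exists y, p ord0 j0 = y by exists (p ord0 j0).
have [y1 pE1] : exists y, p ord0 j1 = y by exists (p ord0 j1).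
have [y2 pE2] : exists y, p ord0 j2 = y by exists (p ord0 j2).
rewrite pE0 pE1 pE2 in pi; rewrite pE0 in p0_gt0; clear s0 s1 s2.
rename p0_gt0 into y0_gt0.
(* The shift that makes the least of [y1 + n], [y2 + n] and [n] equal to [y0]. Division by their sum
   [S] gives barycentric coordinates of a preimage, whose [coef] is then [S]. *)
pose n := y0 - Num.min (Num.min y1 y2) 0.
have [n1 n2 n3 nor] : [/\ y0 <= y1 + n, y0 <= y2 + n, y0 <= n &
    [\/ y0 = y1 + n, y0 = y2 + n | y0 = n]].
  rewrite /n; case: (leP y1 y2) => h12.
    case: (leP y1 0) => h; split; try lra; first by constructor 1; lra.
    by constructor 3; lra.
  case: (leP y2 0) => h; split; try lra; first by constructor 2; lra.
  by constructor 3; lra.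
pose S := y1 + y2 + 3 * n.
have S_gt0 : 0 < S by rewrite /S; lra.
clearbody n; have [ab bc ac] := abc i.
pose x : 'rV[R]_#|W| := point_of (fun u : W => if u == inl (a i) then (y1 + n) / S
  else if u == inl (b i) then (y2 + n) / S else if u == inl (c i) then n / S else 0).
have inlE (u v : V) : (inl u == inl v :> W) = (u == v) by [].
have alE : al i x = (y1 + n) / S by rewrite /al bary_point_of eqxx.
have beE : be i x = (y2 + n) / S.
  by rewrite /be bary_point_of inlE eq_sym (negbTE ab) eqxx.
have gaE : ga i x = n / S.
  have /negbTE ca : c i != a i by rewrite eq_sym.
  have /negbTE cb : c i != b i by rewrite eq_sym.
  by rewrite /ga bary_point_of !inlE ca cb eqxx.
have xi u : u \notin face i -> bary x u = 0.
  rewrite in_face !negb_or => /and3P[/negbTE ua /negbTE ub /negbTE uc].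
  by rewrite bary_point_of ua ub uc.
have x0 u : 0 <= bary x u.
  have [|/xi ->//] := boolP (u \in face i).
  rewrite in_face => /or3P[] /eqP ->;
    rewrite -?/(al i x) -?/(be i x) -?/(ga i x) ?alE ?beE ?gaE; apply: divr_ge0; lra.
have x1 : \sum_u bary x u = 1.
  rewrite (bigID (mem (face i))) /= [X in _ + X]big1 ?addr0 // sum_face.
  rewrite -/(al i x) -/(be i x) -/(ga i x) alE beE gaE -!mulrDl /S.
  by rewrite (_ : y1 + n + (y2 + n) + n = S) ?divff ?gt_eqF // /S; lra.
have Xx : X x.
  apply/geomE; split=> //; exists (face i) => //.
  have s0 : inr @^-1: face i = finset.set0.
    by apply/setP => j; rewrite inE in_face inE.
  rewrite coned_base // (_ : inl @^-1: face i = tri i) //.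
  by apply/setP => v; rewrite !inE.
have [_ ma mb mc mabc] := face_facts x0 x1 xi.
rewrite -/(al i x) -/(be i x) -/(ga i x) alE beE gaE in ma mb mc mabc.
have miE : mf i x = y0 / S.
  apply/le_anti/andP; split.
    by case: nor => ->.
  by case: mabc => ->; rewrite ler_pM2r ?invr_gt0.
have mi_gt0 : 0 < mf i x by rewrite miE divr_gt0.
have mx0 j : j != i -> mf j x = 0.
  have [[_ mf0]|[i' _ [_ mf0]]] := simplexP Xx.
    by rewrite mf0 ltxx in mi_gt0.
  have [-> //|ii'] := eqVneq i i'; first exact: mf0.
  by rewrite mf0 ?ltxx // in mi_gt0.
have sx : al i x + be i x + ga i x = 1.
  by have [] := face_facts x0 x1 xi.
have coefE : coef i x = S.
  rewrite /coef den_face // alE beE gaE miE -!mulrBl !addrK.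
  rewrite !exprMn -!mulrDl pi; field.
  by rewrite !gt_eqF.
have SN0 : S != 0 by rewrite gt_eqF.
have [q0 q1 q2] := quot_face mx0.
exists x => //; apply: row3P.
- by rewrite q0 pE0 coefE miE mulrC divfK.
- by rewrite q1 pE1 coefE alE gaE -mulrBl addrK mulrC divfK.
- by rewrite q2 pE2 coefE beE gaE -mulrBl addrK mulrC divfK.
Qed.

(** The homotopy [cone_htpy] contracts the cone over [A] to its apex without leaving the cone, so
    collapsing the cone to a point is a homotopy equivalence. The map [quot] does this collapsing
    and sends triangle [i] to the sphere of radius [i + 1]. *)
Lemma he_wedge_S2 : homotopy_equivalent R
  (geom_realization R (coned K (fun _ : unit => A))) (wedge_S2 R m).
Proof.
have cone_stays t x : 0 <= t <= 1 -> X x -> (forall i, mf i x = 0) ->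
    forall i, mf i (cone_htpy (t, x)) = 0.
  move=> t01 Xx mf0 i; have /geomE[x0 x1 _] := Xx.
  have /geomE[h0 _ _] := htpy_in t01 Xx; have /andP[t0 _] := t01.
  have [w wi mw] : exists2 w, w \in face i & mf i x = bary x w.
    by apply: (@min_bary_attained _ _ _ _ (inl (a i))) => //; rewrite in_face eqxx.
  apply: (min_bary_eq0 h0 wi); rewrite htpy_cone // -mw mf0 mulr0 add0r.
  rewrite (_ : (w == apex) = false) ?mulr0 //.
  by apply: contraNF (apex_face i) => /eqP <-.
rewrite -quot_image; apply: (@he_quotient R _ _ X quot cone_htpy).
- by exists apex_point.
- exact: compact_geom.
- exact: norm_hausdorff.
- exact: norm_hausdorff.
- exact: (continuous_subspaceT continuous_quot).
- exact: (continuous_subspaceT continuous_cone_htpy).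
- by move=> _ [[t x] [/= t01 Xx] <-]; exact: htpy_in.
- move=> x Xx; apply: bary_inj => u.
  have [[_ mx0]|[i mi [xi mx0]]] := simplexP Xx.
    by rewrite htpy_cone // subr0 mul1r mul0r addr0.
  rewrite (htpy_face _ _ mx0) // mul0r min_r ?ltW // !mulr0 !subr0 mul0r mul0r.
  by rewrite subr0 mul1r addr0 max_r ?divr1 //; lra.
- move=> x y Xx Xy /quot_fiber [//|//|[mx0 my0]|-> //].
  by apply: bary_inj => u; rewrite !htpy_cone // subrr !mul0r.
- move=> t x y t01 Xx Xy /quot_fiber [//|//|[mx0 my0]|-> //].
  have {}t01 : 0 <= t <= 1 by move: t01; rewrite in_itv.
  by rewrite !quot_cone // => i; exact: cone_stays.
Qed.

End wedge.

(** * The chain of homotopy equivalences from the Rips complex to the wedge *)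

Lemma he_grid_wedge (R : realType) (k N : nat) (k_gt1 : (1 < k)%N)
    (NE : N = (3 * k)%N) :
  homotopy_equivalent R (geom_realization R (@grid_cx k N))
    (wedge_S2 R (6 * k ^ 2 - 1)%N).
Proof.
set m := (6 * k ^ 2 - 1)%N; set j0 := kept_col k_gt1 NE.
have cardJ : #|[set~ j0]%SET| = m.
  by rewrite cardsC1 !card_prod card_bool !card_ord /m NE -mulnn subn1 mulnACA.
have [e [e_inj e_neq e_surj]] : exists e : 'I_m -> bool * 'I_k * 'I_N,
    [/\ injective e, forall i, e i != j0 &
        forall j, j != j0 -> exists i, e i = j].
  exists (fun i => enum_val (cast_ord (esym cardJ) i)); split.
  - by move=> i i' /enum_val_inj /cast_ord_inj.
  - by move=> i; have := enum_valP (cast_ord (esym cardJ) i); rewrite !inE.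
  - move=> j jj0; have jC : j \in [set~ j0]%SET by rewrite !inE.
    exists (cast_ord cardJ (enum_rank_in jC j)).
    by rewrite cast_ordK enum_rankK_in.
have m_gt0 : (0 < m)%N.
  by rewrite /m; move: (leq_mul k_gt1 k_gt1); rewrite -mulnn; lia.
pose K := @grid_cx k N.
pose A s := K s && [forall i, s != facet k_gt1 NE (e i)].
have AE : A = coned (strip_free k_gt1 NE) (fan_link k_gt1 NE).
  apply/funext => s; rewrite -grid_minus_facets /A; congr (_ && _).
  apply/forallP/forall_inP => [H j /e_surj[i <-] //|H i].
  exact: H (e_neq i).
have := @he_wedge_S2 R _ m K (fun i => facet1 k_gt1 NE (e i))
  (fun i => facet2 k_gt1 NE (e i)) (fun i => facet3 k_gt1 NE (e i))
  (fun i => facet_distinct k_gt1 NE (e i)) m_gt0 (grid_down k_gt1 NE)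
  (fun i => grid_facet k_gt1 NE (e i))
  (fun i s => @facet_max k N k_gt1 NE (e i) s)
  (fun i i' h => e_inj _ _ (facet_inj h)).
apply: he_trans; rewrite -/A.
apply: he_trans (he_coned_none R unit (fun s _ => erefl (K s))) _.
(* The link [A] collapses to nothing and takes the new cone vertex along, which leaves [K] without a
   cone. *)
apply/he_sym/he_collapses.
- apply: collapses_coned_link => _; rewrite AE; exact: collapses_grid_minus.
- apply: coned_down => [|_|_ s /andP[]//]; first exact: grid_down.
  have [dM dQ] : down_closed (strip_free k_gt1 NE) /\
      forall j, down_closed (fan_link k_gt1 NE j).
    split.
      move=> s t ts /andP[Ls /forallP nos]; apply/andP; split.
        exact: local_cx_down ts Ls.
      apply/forallP => y; apply: contra (nos y) => yt.
      exact: fintype.subset_trans yt ts.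
    move=> j s t ts /andP[Ps nb]; apply/andP; split.
      exact: path_link_down ts Ps.
    case/orP: nb => [->//|nb]; apply/orP; right; apply: contra nb.
    by move=> /andP[h1 h2]; rewrite !(fintype.subsetP ts).
  move=> s t ts /andP[Ks /forallP nof]; apply/andP; split.
    exact: (grid_down k_gt1 NE) ts Ks.
  apply/forallP => i; apply: contraNneq (nof i) => te.
  by apply/eqP/facet_max => //; rewrite -te.
- rewrite coned_set0.
  apply: (grid_down k_gt1 NE) (finset.sub0set _) (grid_facet k_gt1 NE j0).
Qed.

Theorem theorem5p10 (R : realType) (k : nat) (hk : (2 <= k)%N) :
  homotopy_equivalent R
    (geom_realization R (VR_simplex (torus_dist (3 * k)%N) k))
    (wedge_S2 R (6 * k ^ 2 - 1)%N).
Proof.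
apply: he_trans (he_grid_wedge R hk erefl).
pose J : finType := (bool * 'I_k * 'I_(3 * k))%type.
(* Adjoins the empty simplex and the cone vertices, which carry no cone yet. *)
apply: he_trans (@he_coned_none R _ J _ (@vr_cx k (3 * k)) _) _.
  by move=> s s0; rewrite /VR_simplex s0.
(* The cones over [arcs_tri] are attached by reading the collapse that removes them backwards. *)
apply: he_trans (_ : homotopy_equivalent R
  (geom_realization R (coned (@vr_cx k (3 * k)) (@arcs_tri k (3 * k)))) _).
  apply/he_sym/he_collapses.
  - by apply: collapses_coned_link => j; exact: collapses_arcs_tri.
  - apply: coned_down => [|j|j t].
    + exact: vr_cx_down.
    + exact: arcs_tri_down.
    + exact: arcs_tri_vr.
  - by rewrite coned_set0; apply/vr_cxP => p q; rewrite inE.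
apply: he_collapses; first exact: collapses_vr.
  apply: coned_down => [|j|j t].
  - exact: vr_cx_down.
  - exact: arcs_tri_down.
  - exact: arcs_tri_vr.
rewrite /grid_cx coned_set0.
by apply/local_cxP; exists (fun=> 0), (fun=> 0) => p q; rewrite !inE.
Qed.
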